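(* Let $V$ be a finite dimensional complex vector space and let $G\subset\operatorname{GL}(V)$ be a reductive subgroup. Let $G'=\{\phi\in\operatorname{GL}(V)\mid p\circ\phi=p\text{ for all }p\in\mathbb C[V]^G\}$. Let $U\subset V$ be the (open) subset of all $x\in V$ such that the orbit $G\cdot x$ is closed in $V$ and the stabilizer of $x$ in $G$ is trivial. Suppose that $V\setminus U$ has codimension at least $2$ in $V$. Then $G'=G$.
   Context: The base field is $\mathbb C$. Reductive means a (not necessarily connected) complex reductive linear algebraic group, here Zariski closed in $\operatorname{GL}(V)$. $\mathbb C[V]^G$ is the algebra of $G$-invariant polynomial functions on $V$. *)

(* Defs.v *)
From mathcomp Require Import all_boot all_order all_algebra.
From mathcomp Require Import mpoly.
From mathcomp Require Import classical_sets reals.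
From mathcomp Require Import complex.

Set Implicit Arguments.
Unset Strict Implicit.
Unset Printing Implicit Defensive.

Import GRing.Theory.

Local Open Scope classical_set_scope.
Local Open Scope ring_scope.

Section Zariski.

Variables (K : closedFieldType) (W : vectType K).

Definition polyfun (p : W -> K) : Prop :=
  exists q : {mpoly K[\dim {:W}]},
    forall x, p x = q.@[fun i => coord (vbasis {:W}) i x].

Definition zclosed (A : set W) : Prop :=
  exists2 S : set (W -> K), S `<=` polyfun
    & A = [set x | forall p, S p -> p x = 0].

Definition zclosure (A : set W) : set W :=
  [set x | forall Z, zclosed Z -> A `<=` Z -> Z x].

(* The Zariski closed sets of W induce on A its subspace topology. *)
Definition zconnected (A : set W) : Prop :=
  forall Y Z, zclosed Y -> zclosed Z -> A `<=` Y `|` Z ->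
    A `&` Y `&` Z = set0 -> A `<=` Y \/ A `<=` Z.

Definition zirreducible (A : set W) : Prop :=
  A !=set0 /\
  forall Y Z, zclosed Y -> zclosed Z -> A `<=` Y `|` Z ->
    A `<=` Y \/ A `<=` Z.

(* The codimension of a closed set is the infimum, over the irreducible closed
   sets Z it contains, of the supremum of the lengths k of the chains
   Z = c 0 < ... < c k of irreducible closed sets of W; it is infinite for the
   empty set. The codimension of any A is that of its closure. *)
Definition codim_ge (k : nat) (A : set W) : Prop :=
  forall Z, zclosed Z -> zirreducible Z -> Z `<=` zclosure A ->
    exists c : nat -> set W,
      [/\ c 0%N = Z,
          forall i, (i <= k)%N -> zclosed (c i) /\ zirreducible (c i)
        & forall i, (i < k)%N -> c i `<` c i.+1].

End Zariski.

Section LinearGroups.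

Variables (K : closedFieldType) (V : vectType K).
Implicit Types (G N : set 'End(V)) (x : V).

Definition GL : set 'End(V) := [set g | lker g == 0%VS].

Definition subgroupGL G : Prop :=
  [/\ G `<=` GL, G \1%VF,
      forall g h, G g -> G h -> G (g \o h)%VF
    & forall g, G g -> G g^-1%VF].

(* The regular functions on GL(V) are the p / det ^ m with p polynomial on
   End(V), so its closed sets are the traces of those of End(V). *)
Definition closed_subgroupGL G : Prop :=
  subgroupGL G /\ exists2 Z : set 'End(V), zclosed Z & G = GL `&` Z.

Definition normal_in N G : Prop :=
  N `<=` G /\ forall g n, G g -> N n -> N (g \o n \o g^-1)%VF.

Definition unipotent (u : 'End(V)) : Prop :=
  exists m : nat, forall x, iter m (fun y => (u - \1)%VF y) x = 0.

(* Reductive: the unipotent radical, i.e. the largest connected normal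
   unipotent closed subgroup, is trivial. G itself may be disconnected. *)
Definition reductive G : Prop :=
  closed_subgroupGL G /\
  forall N, closed_subgroupGL N -> zconnected N -> normal_in N G ->
    (forall u, N u -> unipotent u) -> N = [set \1%VF].

Definition invariant_polyfun G (p : V -> K) : Prop :=
  polyfun p /\ forall g, G g -> forall x, p (g x) = p x.

Definition invariant_preserver G : set 'End(V) :=
  [set phi | GL phi /\
    forall p, invariant_polyfun G p -> forall x, p (phi x) = p x].

Definition orbit G x : set V := [set g x | g in G].

Definition stabilizer G x : set 'End(V) := [set g | G g /\ g x = x].

Definition closed_free_points G : set V :=
  [set x | zclosed (orbit G x) /\ stabilizer G x = [set \1%VF]].

End LinearGroups.

(* Main.v *)
(** Let [phi] preserve the invariants of [G]. Closed orbits are separated by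
    invariants, so [phi x] lies in [G x] for [x] in [U], say [phi x = g(x) x]
    with a unique [g(x)] in [G]. Near each free closed orbit [G x0], the function
    [g] is a regular fraction: there is a polynomial covariant [F : V -> End V]
    with [F (h x) = h F(x)] and [F(x0) = 1], so [g(x) F(x) = F(phi x)]. Since the
    complement of [U] has codimension at least 2, for a suitable [u] in [U] and
    generic [v] all nonzero points of the plane spanned by [u] and [v] lie in [U].
    On that plane [g] is regular and homogeneous of degree 0, that is,
    [g(u + s v)] is a polynomial in [s] and a polynomial in [1 / s], hence
    constant; so [phi = g(u)] on a dense set.

    The covariant [F] comes from two facts. First, the orbit map of a free closed
    orbit is a closed embedding, i.e. [g] is a polynomial in [g x0]: the
    scheme-theoretic stabilizer is reduced in characteristic 0, which gives
    [h - g] as a combination of the entries of [h x0 - g x0] with coefficients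
    of the form [a(g) b(h)]; minors of the relations between these functions then
    express [g] locally, hence globally, through [g x0]. Second, reductive groups
    are linearly reductive: a trivial unipotent radical forces every ideal of
    nilpotent matrices in the Lie algebra to vanish (by Engel's theorem its
    exponentials generate a unipotent normal subgroup); since the Lie algebra is
    stable under replicas, its trace form on a module is nondegenerate modulo the
    kernel, and the Casimir element projects to invariants. *)

From HB Require Import structures.
Require Import Defs.
From mathcomp Require Import all_boot all_order all_algebra.
From mathcomp Require Import mpoly.
From mathcomp Require Import boolp classical_sets functions reals.
From mathcomp Require Import perm complex ring.

Set Implicit Arguments.
Unset Strict Implicit.
Unset Printing Implicit Defensive.

Import Order.TTheory GRing.Theory Num.Theory.

Local Open Scope classical_set_scope.
Local Open Scope ring_scope.

(** * Polynomial functions *)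

Section Polyfun.

(** [G] is closed in GL but not in the matrix space, where the ideals of polynomial functions live.
    The map g |-> diag(g, g^-T) makes it closed, hence the doubled sizes n + n; it also makes dual
    vectors available to the group. Reductivity only speaks of unipotent subgroups, while averaging
    needs nondegenerate trace forms. The bridge is a matrix B acting on each generalized eigenspace
    of X by the conjugate eigenvalue: tr(X B) is then a sum of squared moduli, and vanishes only if
    X is nilpotent. This is why the field carries a conjugation. Neither quotients nor schemes are
    formed: tangent spaces are read off from powers of maximal ideals of polynomial functions.
    Codimension 2 is used through one direction u outside the closure of the complement of [U] and
    one nonzero function b that vanishes on this complement and is constant along u. If b(v) is
    nonzero, all points v + s u lie in [U] and, [U] being a cone, so do all u + s v. *)

Variables (K : numClosedFieldType).

Definition lform (W : lmodType K) (l : W -> K) : Prop :=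
  forall a x y, l (a *: x + y) = a * l x + l y.

Section OneSpace.

Variable W : vectType K.
Implicit Types (p q : W -> K).

Lemma polyfun_cst (c : K) : polyfun (fun _ : W => c).
Proof. by exists c%:MP => x; rewrite mevalC. Qed.

Lemma polyfunD p q : polyfun p -> polyfun q -> polyfun (p + q).
Proof. by move=> [P hP] [Q hQ]; exists (P + Q) => x; rewrite mevalD -hP -hQ. Qed.

Lemma polyfunM p q : polyfun p -> polyfun q -> polyfun (p * q).
Proof. by move=> [P hP] [Q hQ]; exists (P * Q) => x; rewrite mevalM -hP -hQ. Qed.

Lemma polyfun0 : polyfun (0 : W -> K). Proof. exact: polyfun_cst. Qed.
Lemma polyfun1 : polyfun (1 : W -> K). Proof. exact: polyfun_cst. Qed.

Lemma polyfunZ (c : K) p : polyfun p -> polyfun (cst c * p).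
Proof. by move=> hp; apply: (polyfunM (polyfun_cst c) hp). Qed.

Lemma polyfunN p : polyfun p -> polyfun (- p).
Proof. by move=> hp; rewrite -mulN1r; apply: (polyfunM (polyfun_cst (-1)) hp). Qed.

Lemma polyfunB p q : polyfun p -> polyfun q -> polyfun (p - q).
Proof. by move=> hp hq; apply: polyfunD => //; apply: polyfunN. Qed.

Lemma polyfun_sum (I : Type) (r : seq I) (P : pred I) (F : I -> W -> K) :
  (forall i, P i -> polyfun (F i)) -> polyfun (\sum_(i <- r | P i) F i).
Proof.
by move=> hF; elim/big_rec: _ => [|i p Pi hp]; [exact: polyfun0 | apply: polyfunD; auto].
Qed.

Lemma polyfun_prod (I : Type) (r : seq I) (P : pred I) (F : I -> W -> K) :
  (forall i, P i -> polyfun (F i)) -> polyfun (\prod_(i <- r | P i) F i).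
Proof.
by move=> hF; elim/big_rec: _ => [|i p Pi hp]; [exact: polyfun1 | apply: polyfunM; auto].
Qed.

Lemma polyfunX p k : polyfun p -> polyfun (p ^+ k).
Proof.
move=> hp; elim: k => [|k IH]; first by rewrite expr0; exact: polyfun1.
by rewrite exprS; apply: polyfunM.
Qed.

Lemma lform0 (l : W -> K) : lform l -> l 0 = 0.
Proof.
by move=> hl; have := hl (-1) 0 0; rewrite scaler0 addr0 mulN1r addNr.
Qed.

Lemma lformZ (l : W -> K) a x : lform l -> l (a *: x) = a * l x.
Proof. by move=> hl; have := hl a x 0; rewrite !addr0 lform0 // addr0. Qed.

Lemma lformD (l : W -> K) x y : lform l -> l (x + y) = l x + l y.
Proof. by move=> hl; have := hl 1 x y; rewrite scale1r mul1r. Qed.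

Lemma lformB (l : W -> K) x y : lform l -> l (x - y) = l x - l y.
Proof. by move=> hl; rewrite lformD // -scaleN1r lformZ // mulN1r. Qed.

Lemma lform_sum (l : W -> K) (I : Type) (r : seq I) (P : pred I) (F : I -> W) :
  lform l -> l (\sum_(i <- r | P i) F i) = \sum_(i <- r | P i) l (F i).
Proof.
move=> hl; elim/big_rec2: _ => [|i x y _ <-]; first exact: lform0.
exact: lformD.
Qed.

Lemma lform_coord i : lform (coord (vbasis {:W}) i).
Proof. by move=> a x y; rewrite linearP. Qed.

Lemma lform_expand (l : W -> K) x : lform l ->
  l x = \sum_i coord (vbasis {:W}) i x * l (vbasis {:W})`_i.
Proof.
move=> hl; rewrite {1}(coord_vbasis (memvf x)) lform_sum //.
by apply: eq_bigr => i _; rewrite lformZ.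
Qed.

Lemma polyfun_lform (l : W -> K) : lform l -> polyfun l.
Proof.
move=> hl; exists (\sum_(i < \dim {:W}) (l (vbasis {:W})`_i) *: 'X_i) => x.
rewrite raddf_sum lform_expand //=; apply: eq_bigr => i _.
by rewrite mevalZ mevalXU mulrC.
Qed.

(** Polynomial functions form the algebra generated by the linear forms; in this form, later
    inductions mention neither a basis nor [mpoly]. Polynomiality of both arguments is supplied in
    each step because derivations obey the product rule only on polynomial functions. *)
Lemma polyfun_ind (P : (W -> K) -> Prop) :
  (forall c, P (fun=> c)) -> (forall l, lform l -> P l) ->
  (forall p q, polyfun p -> polyfun q -> P p -> P q -> P (p + q)) ->
  (forall p q, polyfun p -> polyfun q -> P p -> P q -> P (p * q)) ->
  forall p, polyfun p -> P p.
Proof.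
move=> hc hl hD hM p [q hq].
pose ev (r : {mpoly K[\dim {:W}]}) : W -> K :=
  fun x => r.@[fun i => coord (vbasis {:W}) i x].
suff H r : polyfun (ev r) /\ P (ev r).
  have -> : p = ev q by apply/funext => x; rewrite hq.
  exact: (H q).2.
have HM f g : polyfun f /\ P f -> polyfun g /\ P g -> polyfun (f * g) /\ P (f * g).
  by move=> [? ?] [? ?]; split; [exact: polyfunM | exact: hM].
have H1 c : polyfun (fun _ : W => c) /\ P (fun=> c).
  by split; [exact: polyfun_cst | exact: hc].
elim/mpolyind: r => [|c m r _ _ [pr Pr]].
  have -> : ev 0 = fun=> 0 by apply/funext => x; rewrite /ev meval0.
  exact: H1.
have -> : ev (c *: 'X_[m] + r) =
    (fun=> c) * (\prod_i (coord (vbasis {:W}) i : W -> K) ^+ m i) + ev r.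
  apply/funext => x; rewrite /ev mevalD mevalZ mevalX /=.
  congr (_ * _ + _); rewrite fct_prodE /=; apply: eq_bigr => i _.
  by rewrite exprfctE.
have [pm Pm] : polyfun ((fun=> c) * (\prod_i (coord (vbasis {:W}) i : W -> K) ^+ m i))
   /\ P ((fun=> c) * (\prod_i (coord (vbasis {:W}) i : W -> K) ^+ m i)).
  apply: (HM) => //; elim/big_rec: _ => [|i f _ hf]; first exact: H1.
  apply: (HM) => //; elim: (m i) => [|k IH]; first by rewrite expr0; exact: H1.
  rewrite exprS; apply: (HM) => //.
  have hli := lform_coord i.
  by split; [exact: polyfun_lform | exact: hl].
by split; [exact: polyfunD | exact: hD].
Qed.

End OneSpace.

Definition polymap (W W' : vectType K) (h : W -> W') : Prop :=
  forall l, lform l -> polyfun (l \o h).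

Lemma polyfun_comp (W W' : vectType K) (h : W -> W') (p : W' -> K) :
  polymap h -> polyfun p -> polyfun (p \o h).
Proof.
move=> hh; move: p; apply: polyfun_ind => [c|l hl|p q _ _ hp hq|p q _ _ hp hq].
- exact: polyfun_cst.
- exact: hh.
- exact: polyfunD hp hq.
- exact: polyfunM hp hq.
Qed.

Lemma lform_comp (W W' : lmodType K) (h : W -> W') (l : W' -> K) :
  linear h -> lform l -> lform (l \o h).
Proof. by move=> hh hl a x y; rewrite /= hh hl. Qed.

Lemma polymap_linear (W W' : vectType K) (h : W -> W') : linear h -> polymap h.
Proof. by move=> hh l hl; apply: polyfun_lform; apply: lform_comp. Qed.

Lemma polymapD (W W' : vectType K) (h h' : W -> W') :
  polymap h -> polymap h' -> polymap (fun x => h x + h' x).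
Proof.
move=> H H' l hl; have -> : l \o (fun x => h x + h' x) = (l \o h) + (l \o h').
  by apply/funext => x /=; rewrite lformD.
by apply: polyfunD; [exact: H | exact: H'].
Qed.

Lemma polymap_cst (W W' : vectType K) (y : W') : polymap (fun _ : W => y).
Proof. by move=> l _; exact: polyfun_cst. Qed.

Definition mxentry m n (i : 'I_m) (j : 'I_n) : 'M[K]_(m, n) -> K := fun A => A i j.

Lemma lform_mxentry m n (i : 'I_m) (j : 'I_n) : lform (mxentry i j).
Proof. by move=> a x y; rewrite /mxentry !mxE. Qed.

Lemma polyfun_mxentry m n (i : 'I_m) (j : 'I_n) : polyfun (mxentry i j).
Proof. exact/polyfun_lform/lform_mxentry. Qed.

Lemma lform_mxE m n (l : 'M[K]_(m, n) -> K) A : lform l ->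
  l A = \sum_i \sum_j A i j * l (delta_mx i j).
Proof.
move=> hl; rewrite {1}[A]matrix_sum_delta lform_sum //; apply: eq_bigr => i _.
by rewrite lform_sum //; apply: eq_bigr => j _; rewrite lformZ.
Qed.

Lemma polymap_mx (W : vectType K) m n (h : W -> 'M[K]_(m, n)) :
  (forall i j, polyfun (fun x => h x i j)) -> polymap h.
Proof.
move=> H l hl; have -> : l \o h =
    \sum_i \sum_j cst (l (delta_mx i j)) * (fun x => h x i j).
  apply/funext => x /=; rewrite lform_mxE // fct_sumE; apply: eq_bigr => i _.
  by rewrite fct_sumE; apply: eq_bigr => j _; rewrite mulrC.
by do 2!apply: polyfun_sum => ? _; apply: polyfunZ.
Qed.

Lemma polyfun_entry (W : vectType K) m n (h : W -> 'M[K]_(m, n)) i j :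
  polymap h -> polyfun (fun x => h x i j).
Proof. by move=> hh; apply: (hh (mxentry i j)); apply: lform_mxentry. Qed.

Lemma polymap_comp (W W' W'' : vectType K) (h : W -> W') (h' : W' -> W'') :
  polymap h -> polymap h' -> polymap (h' \o h).
Proof. by move=> H H' l hl; apply: (polyfun_comp H (H' l hl)). Qed.

Lemma polymap_mulmx (W : vectType K) m n k (f : W -> 'M[K]_(m, n)) (g : W -> 'M[K]_(n, k)) :
  polymap f -> polymap g -> polymap (fun x => f x *m g x).
Proof.
move=> hf hg; apply: polymap_mx => i j.
have -> : (fun x => (f x *m g x) i j) =
    \sum_(l < n) (fun x => f x i l) * (fun x => g x l j).
  by apply/funext => x; rewrite mxE fct_sumE.
by apply: polyfun_sum => l _; apply: polyfunM; apply: polyfun_entry.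
Qed.

Lemma polyfun_det (W : vectType K) n (f : W -> 'M[K]_n) :
  polymap f -> polyfun (fun x => \det (f x)).
Proof.
move=> hf; have -> : (fun x => \det (f x)) =
    \sum_(s : 'S_n) (cst ((-1) ^+ s) * \prod_i (fun x => f x i (s i))).
  apply/funext => x; rewrite fct_sumE; apply: eq_bigr => s _.
  by rewrite mulrfctE fct_prodE.
by apply: polyfun_sum => s _; apply: polyfunZ; apply: polyfun_prod => i _; apply: polyfun_entry.
Qed.

Lemma polymap_adj (W : vectType K) n (f : W -> 'M[K]_n) :
  polymap f -> polymap (fun x => \adj (f x)).
Proof.
move=> hf; apply: polymap_mx => i j.
have -> : (fun x => (\adj (f x)) i j) =
    cst ((-1) ^+ (j + i)) * (fun x => \det (row' j (col' i (f x)))).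
  by apply/funext => x; rewrite mxE.
apply: polyfunZ; apply: polyfun_det; apply: polymap_mx => a b.
have -> : (fun x => row' j (col' i (f x)) a b) = (fun x => f x (lift j a) (lift i b)).
  by apply/funext => x; rewrite !mxE.
exact: polyfun_entry.
Qed.

Definition polyfun1v (f : K -> K) : Prop := exists q : {poly K}, f = horner q.

Lemma polyfun1v_cst c : polyfun1v (fun=> c).
Proof. by exists c%:P; apply/funext => t; rewrite hornerC. Qed.
Lemma polyfun1v_id : polyfun1v id.
Proof. by exists 'X; apply/funext => t; rewrite hornerX. Qed.
Lemma polyfun1vD f g : polyfun1v f -> polyfun1v g -> polyfun1v (fun t => f t + g t).
Proof. by move=> [p ->] [q ->]; exists (p + q); apply/funext => t; rewrite hornerD. Qed.
Lemma polyfun1vM f g : polyfun1v f -> polyfun1v g -> polyfun1v (fun t => f t * g t).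
Proof. by move=> [p ->] [q ->]; exists (p * q); apply/funext => t; rewrite hornerM. Qed.

Lemma horner_eq_inj (p q : {poly K}) : (forall t, p.[t] = q.[t]) -> p = q.
Proof.
move=> h; apply/eqP; rewrite -subr_eq0; apply/eqP.
apply: (@roots_geq_poly_eq0 _ _ [seq i%:R | i <- iota 0 (size (p - q))]).
- by apply/allP => x _; rewrite /root hornerD hornerN h subrr.
- by rewrite map_inj_uniq ?iota_uniq // => i j /eqP; rewrite eqr_nat => /eqP.
- by rewrite size_map size_iota.
Qed.

Lemma horner_neq0 (p : {poly K}) : p != 0 -> exists t, p.[t] != 0.
Proof.
move=> /eqP p0; apply: contrapT => h; apply: p0; apply: horner_eq_inj => t.
by rewrite horner0; apply/eqP/negPn/negP => ht; apply: h; exists t.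
Qed.

Definition polycurve (W : vectType K) (c : K -> W) : Prop :=
  forall l, lform l -> polyfun1v (l \o c).

Lemma polycurve_comp (W : vectType K) (c : K -> W) (p : W -> K) :
  polycurve c -> polyfun p -> polyfun1v (p \o c).
Proof.
move=> hc; move: p; apply: polyfun_ind => [a|l hl|p q _ _ hp hq|p q _ _ hp hq].
- exact: polyfun1v_cst.
- exact: hc.
- exact: polyfun1vD hp hq.
- exact: polyfun1vM hp hq.
Qed.

Lemma polycurve_line (W : vectType K) (x v : W) : polycurve (fun t => x + t *: v).
Proof.
move=> l hl; have -> : l \o (fun t => x + t *: v) = fun t => l x + t * l v.
  by apply/funext => t /=; rewrite lformD // lformZ.
apply: polyfun1vD; first exact: polyfun1v_cst.
by apply: polyfun1vM; [exact: polyfun1v_id | exact: polyfun1v_cst].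
Qed.

Lemma polyfun_line (W : vectType K) (p : W -> K) (x v : W) : polyfun p ->
  exists q : {poly K}, forall t, p (x + t *: v) = q.[t].
Proof.
move=> hp; have [q hq] := polycurve_comp (polycurve_line x v) hp.
by exists q => t; rewrite -hq.
Qed.

(** Affine space is irreducible: both functions stay nonzero on the line through [x] and [y], where
    they are one-variable polynomials. *)
Lemma polyfun_mul_neq0 (W : vectType K) (p q : W -> K) x y :
  polyfun p -> polyfun q -> p x != 0 -> q y != 0 ->
  exists z, p z * q z != 0.
Proof.
move=> hp hq px qy.
have [P hP] := polyfun_line x (y - x) hp.
have [Q hQ] := polyfun_line x (y - x) hq.
have P0 : P != 0.
  by apply: contraNneq px => P0; have := hP 0; rewrite P0 horner0 scale0r addr0 => ->.
have Q0 : Q != 0.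
  apply: contraNneq qy => Q0; have := hQ 1; rewrite Q0 horner0 scale1r.
  by rewrite addrC subrK => ->.
have [t ht] : exists t, (P * Q).[t] != 0 by apply: horner_neq0; rewrite mulf_neq0.
by exists (x + t *: (y - x)); rewrite hP hQ -hornerM.
Qed.

End Polyfun.

(** * Ideals and zeros *)

Section Ideals.

Variable B : comPzRingType.
Implicit Types J S : set B.

Definition ideal J : Prop :=
  [/\ J 0, forall x y, J x -> J y -> J (x + y) & forall a x, J x -> J (a * x)].

Definition prime_ideal J : Prop :=
  [/\ ideal J, ~ J 1 & forall x y, J (x * y) -> J x \/ J y].

Lemma idealN J x : ideal J -> J x -> J (- x).
Proof. by move=> [_ _ hM] hx; rewrite -mulN1r; apply: hM. Qed.

Lemma idealB J x y : ideal J -> J x -> J y -> J (x - y).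
Proof. by move=> hJ hx hy; case: (hJ) => _ hD _; apply: hD => //; apply: idealN. Qed.

Lemma ideal_sum J (I : Type) (r : seq I) (P : pred I) (F : I -> B) :
  ideal J -> (forall i, P i -> J (F i)) -> J (\sum_(i <- r | P i) F i).
Proof.
by move=> [J0 JD _] hF; elim/big_rec: _ => // i x Pi hx; apply: JD => //; apply: hF.
Qed.

Lemma prime_idealX J x k : prime_ideal J -> J (x ^+ k) -> J x.
Proof.
move=> [_ J1 JP]; elim: k => [|k IH]; first by rewrite expr0.
by rewrite exprS => /JP[].
Qed.

Definition ideal_add J x : set B := [set y | exists2 z, J z & exists a, y = z + a * x].

Lemma ideal_addP J x : ideal J -> ideal (ideal_add J x).
Proof.
move=> [J0 JD JM]; split.
- by exists 0 => //; exists 0; rewrite mul0r addr0.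
- move=> _ _ [z Jz [a ->]] [z' Jz' [a' ->]]; exists (z + z'); first exact: JD.
  by exists (a + a'); ring.
- move=> b _ [z Jz [a ->]]; exists (b * z); first exact: JM.
  by exists (b * a); ring.
Qed.

Lemma sub_ideal_add J x : J `<=` ideal_add J x.
Proof. by move=> z Jz; exists z => //; exists 0; rewrite mul0r addr0. Qed.

Lemma mem_ideal_add J x : ideal J -> ideal_add J x x.
Proof. by case=> J0 _ _; exists 0 => //; exists 1; rewrite mul1r add0r. Qed.

Lemma maximal_disjoint_ideal J S : ideal J -> J `&` S = set0 ->
  exists A, [/\ ideal A, J `<=` A, A `&` S = set0 &
    forall A', ideal A' -> A `<=` A' -> A' `&` S = set0 -> A' `<=` A].
Proof.
move=> hJ JS.
pose P (A : set B) := A = set0 \/ [/\ ideal A, J `<=` A & A `&` S = set0].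
have [|A [PA Amax]] := @Zorn_bigcup B P.
  move=> F FP Ftot.
  have [[A0 FA0 A0ne]|hne] := pselect (exists2 A, F A & A !=set0); last first.
    left; apply/seteqP; split => // x [A FA Ax]; case: hne; exists A => //.
    by exists x.
  have ne A x : F A -> A x -> [/\ ideal A, J `<=` A & A `&` S = set0].
    by move=> FA Ax; have [A_0|//] := FP _ FA; move: Ax; rewrite A_0.
  have [a0 Aa0] := A0ne; have [hA0 JA0 _] := ne _ _ FA0 Aa0.
  right; split; first split.
  - by exists A0 => //; case: hA0.
  - move=> x y [A FA Ax] [A' FA' Ay].
    have [[_ AD _] _ _] := ne _ _ FA Ax; have [[_ AD' _] _ _] := ne _ _ FA' Ay.
    have [AA'|A'A] := Ftot _ _ FA FA'.
      by exists A' => //; apply: AD' => //; apply: AA'.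
    by exists A => //; apply: AD => //; apply: A'A.
  - move=> a x [A FA Ax]; have [[_ _ AM] _ _] := ne _ _ FA Ax.
    by exists A => //; apply: AM.
  - by move=> x Jx; exists A0 => //; apply: JA0.
  - apply/seteqP; split => // x [[A FA Ax] Sx].
    by have [_ _ <-] := ne _ _ FA Ax.
have PJ : P J by right; split.
case: PA => [A0|[hA JA AS]].
  exfalso; apply: (Amax J) PJ; rewrite A0; split => // J0.
  by case: hJ => /J0.
exists A; split => // A' hA' AA' A'S x A'x; apply: contrapT => nAx.
apply: (Amax A'); last by right; split => // y Jy; apply/AA'/JA.
by split => // A'A; apply/nAx/A'A.
Qed.

Lemma prime_disjoint J S : S 1 -> (forall x y, S x -> S y -> S (x * y)) -> ideal J ->
  J `&` S = set0 -> exists P, [/\ prime_ideal P, J `<=` P & P `&` S = set0].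
Proof.
move=> S1 SM hJ JS; have [P [hP JP PS Pmax]] := maximal_disjoint_ideal hJ JS.
have nP s : S s -> ~ P s by move=> Ss Ps; have : set0 s by rewrite -PS.
have key x : ~ P x -> exists s z a, [/\ S s, P z & s = z + a * x].
  move=> nPx; apply: contrapT => H; apply: nPx.
  apply: (Pmax (ideal_add P x)); [exact: ideal_addP|exact: sub_ideal_add| |exact: mem_ideal_add].
  apply/seteqP; split => // s [[z Pz [a e]] Ss].
  by apply: H; exists s, z, a.
exists P; split => //; split => //; first exact: nP.
move=> x y Pxy; apply: contrapT => /not_orP[/key [s [z [a [Ss Pz es]]]] /key [t [w [b [St Pw
  et]]]]].
apply: (nP (s * t)); first exact: SM.
case: hP => _ PD PM.
have -> : s * t = (w + b * y) * z + (a * x) * w + (a * b) * (x * y) by rewrite es et; ring.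
by apply: (PD); [apply: (PD)|]; apply: PM.
Qed.

Lemma prime_avoiding J f : ideal J -> (forall k, ~ J (f ^+ k)) ->
  exists P, [/\ prime_ideal P, J `<=` P & ~ P f].
Proof.
move=> hJ Jf.
have [|||P [hP JP PS]] := @prime_disjoint J [set x | exists k, x = f ^+ k] _ _ hJ.
- by exists 0%N; rewrite expr0.
- by move=> _ _ [k ->] [l ->]; exists (k + l)%N; rewrite exprD.
- by apply/seteqP; split => // x [Jx [k xk]]; apply: (Jf k); rewrite -xk.
exists P; split => // Pf; have : set0 f by rewrite -PS; split => //; exists 1%N; rewrite expr1.
by [].
Qed.

End Ideals.

(** * Zeros of prime ideals in polynomial rings *)

Section IteratedPoly.

Variable K : numClosedFieldType.

(** Iterated one-variable rings, so that the last variable can be eliminated by pseudo-division over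
    a domain. *)
Fixpoint ipoly (n : nat) : idomainType :=
  if n is m.+1 then {poly ipoly m} else K.

Fixpoint iev (n : nat) (v : nat -> K) : {rmorphism ipoly n -> K} :=
  match n return {rmorphism ipoly n -> K} with
  | 0%N => idfun
  | m.+1 => horner_eval (v m) \o map_poly (iev m v)
  end.

Lemma iev_ext n (v v' : nat -> K) : (forall i, (i < n)%N -> v i = v' i) ->
  iev n v =1 iev n v'.
Proof.
elim: n => [|n IH] h p //=; rewrite /horner_eval h //.
by congr _.[_]; apply: eq_map_poly; apply: IH => i /ltnW/h.
Qed.

(** Leading terms with coefficient in [PB] already lie in [J]; they are subtracted until another
    coefficient leads. *)
Lemma lead_notin (B : idomainType) (J : set {poly B}) (PB : set B) (h : {poly B}) :
  ideal J -> ideal PB -> (forall b, PB b -> J b%:P) -> J h -> (exists i, ~ PB h`_i) ->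
  exists h', [/\ J h', (size h' <= size h)%N & ~ PB (lead_coef h')].
Proof.
move=> hJ hPB PBJ; move: {2}(size h) (leqnn (size h)) => n; elim: n h => [|n IH] h sh Jh [i hi].
  case: hi; have -> : h = 0 by apply/eqP; rewrite -size_poly_leq0.
  by rewrite coef0; case: hPB.
have [hl|] := pselect (~ PB (lead_coef h)); first by exists h.
move=> /contrapT hl.
have h0 : h != 0.
  by apply: contra_notN hi => /eqP ->; rewrite coef0; case: hPB.
pose g := h - (lead_coef h)%:P * 'X^((size h).-1).
have sg : (size g < size h)%N.
  rewrite -[X in (_ < X)%N](prednK (n := size h)) ?size_poly_gt0 // ltnS.
  apply/leq_sizeP => j hj; rewrite coefB coefCM coefXn.
  have [->|nj] := eqVneq j (size h).-1; first by rewrite mulr1 lead_coefE subrr.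
  rewrite mulr0 subr0 nth_default //.
  have : ((size h).-1 < j)%N by rewrite ltn_neqAle eq_sym nj.
  by rewrite prednK // size_poly_gt0.
have Jg : J g.
  apply: idealB => //; case: hJ => _ _ JM; rewrite mulrC; apply: JM; exact: PBJ.
have [||h' [Jh' sh' lh']] := IH g _ Jg.
- by rewrite -ltnS (leq_trans sg).
- exists i; rewrite coefB coefCM coefXn => Pg; apply: hi.
  have -> : h`_i = (h`_i - lead_coef h * (i == (size h).-1)%:R) +
     (i == (size h).-1)%:R * lead_coef h by ring.
  by case: (hPB) => _ PD PM; apply: PD => //; apply: PM.
by exists h'; split => //; apply: leq_trans sh' (ltnW sg).
Qed.

Lemma ex_min_nat (T : Type) (m : T -> nat) (Q : set T) : Q !=set0 ->
  exists2 q, Q q & forall q', Q q' -> (m q <= m q')%N.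
Proof.
move=> [q0 Qq0].
have ex : exists n, `[< exists2 q, Q q & m q = n >].
  by exists (m q0); apply/asboolP; exists q0.
case: (ex_minnP ex) => n /asboolP[q Qq <-] hmin; exists q => // q' Qq'.
by apply: hmin; apply/asboolP; exists q'.
Qed.

Lemma contraction_prime (B : idomainType) (P : set {poly B}) :
  prime_ideal P -> prime_ideal [set b | P b%:P].
Proof.
move=> [[P0 PD PM] P1 PP].
split; [split; [|move=> x y|move=> a x] | | move=> x y]; rewrite /= ?polyCD ?polyCM //.
- exact: PD.
- exact: PM.
- exact: PP.
Qed.

(* Each prime is eliminated through an element [q] of least degree modulo its
   contraction to the coefficient ring: [q] plays the role of the minimal
   polynomial of the last coordinate over the field of fractions. *)
Lemma prime_ideal_zero n (P : set (ipoly n)) (c : ipoly n) : prime_ideal P -> ~ P c ->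
  exists v, (forall p, P p -> iev n v p = 0) /\ iev n v c != 0.
Proof.
elim: n P c => [|m IH] P c hP nPc.
  exists (fun=> 0); case: hP => -[P0 PD PM] P1 PP /=; split.
    move=> p Pp; apply/eqP/negPn/negP => p0; apply: P1.
    by rewrite -[1](mulVf p0); apply: PM.
  by apply: contra_notN nPc => /eqP ->.
pose B := ipoly m; pose PB : set B := [set b | P b%:P].
have hPB : prime_ideal PB := contraction_prime hP.
have [iP nP1 PP] := hP; have [P0 PD PM] := iP.
have [iPB nPB1 PPB] := hPB; have [PB0 PBD PBM] := iPB.
pose ext (v : nat -> K) s i := if i == m then s else v i.
have extE v s (p : {poly B}) : iev m.+1 (ext v s) p = (map_poly (iev m v) p).[s].
  rewrite /= /horner_eval /ext eqxx; congr _.[_]; apply: eq_map_poly.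
  by apply: iev_ext => i im; rewrite ltn_eqF.
have coefP (p : {poly B}) : (forall i, PB p`_i) -> P p.
  move=> hp; rewrite -[p]coefK poly_def; apply: ideal_sum => // i _.
  by rewrite -mul_polyC mulrC; apply: PM; apply: hp.
have evcoef v (p : {poly B}) : (forall b, PB b -> iev m v b = 0) -> (forall i, PB p`_i) ->
    map_poly (iev m v) p = 0.
  by move=> hv hp; apply/polyP => i; rewrite coef_map coef0 /= hv.
have notcoef (p : {poly B}) : ~ (forall i, PB p`_i) -> exists i, ~ PB p`_i.
  by move/existsNP.
(* If all coefficients of elements of [P] lie in [PB], the last coordinate is unconstrained above a
   zero of [PB]: it only has to avoid the roots of [c]. *)
have [hall|hex] := pselect (forall q, P q -> forall i, PB q`_i).
  have [i nPi] : exists i, ~ PB (c : {poly B})`_i by apply: notcoef => /coefP.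
  have [v [hv vc]] := IH _ _ hPB nPi.
  have c0 : map_poly (iev m v) c != 0.
    by apply: contraNneq vc => c0; rewrite -coef_map c0 coef0.
  have [s hs] := horner_neq0 c0.
  exists (ext v s); split => [p Pp|]; rewrite extE //.
  by rewrite evcoef ?horner0 //; apply: hall.
have [q1 [Pq1 [i1 hi1]]] : exists q, P q /\ exists i, ~ PB (q : {poly B})`_i.
  apply: contrapT => H; apply: hex => q Pq i; apply: contrapT => H'; apply: H.
  by exists q; split => //; exists i.
have lead_ex (J : set {poly B}) : ideal J -> (forall b, PB b -> J b%:P) ->
    forall h, J h -> (exists i, ~ PB h`_i) ->
    exists h', [/\ J h', (size h' <= size h)%N & ~ PB (lead_coef h')].
  by move=> hJ hb h; apply: lead_notin.
have min_coef (J : set {poly B}) (d : nat) : ideal J -> (forall b, PB b -> J b%:P) ->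
    (forall h, J h /\ ~ PB (lead_coef h) -> (d <= size h)%N) ->
    forall h, J h -> (size h < d)%N -> forall i, PB h`_i.
  move=> hJ hb hmin h Jh sh; apply: contrapT => /notcoef/(lead_ex J hJ hb h Jh)[h' [Jh' s' l']].
  by have := leq_ltn_trans (leq_trans (hmin h' (conj Jh' l')) s') sh; rewrite ltnn.
have [q [Pq lq] qmin] : exists2 q : {poly B}, P q /\ ~ PB (lead_coef q) &
    forall q', P q' /\ ~ PB (lead_coef q') -> (size q <= size q')%N.
  apply: ex_min_nat; have [h' [? _ ?]] := lead_ex P iP (fun b hb => hb) q1 Pq1 (ex_intro _ i1 hi1).
  by exists h'.
(* An element [e] of least degree in P + (c), modulo [PB], acts as a greatest common divisor of [q]
   and [c]. *)
pose J := ideal_add P c.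
have iJ : ideal J := ideal_addP c iP.
have PJ : P `<=` J := @sub_ideal_add _ P c.
have [e [Je le] emin] : exists2 q : {poly B}, J q /\ ~ PB (lead_coef q) &
    forall q', J q' /\ ~ PB (lead_coef q') -> (size q <= size q')%N.
  by apply: ex_min_nat; exists q; split => //; apply: PJ.
have nz (h : {poly B}) : ~ PB (lead_coef h) -> h != 0.
  by move=> hl; apply: contra_notN hl => /eqP ->; rewrite lead_coef0.
have q0 := nz _ lq; have e0 := nz _ le.
have remJ h : J h -> J (h %% e) .
  move=> Jh; have -> : h %% e = (lead_coef e ^+ scalp h e)%:P * h - (h %/ e) * e.
    by rewrite mul_polyC Pdiv.Idomain.divp_eq addrAC subrr add0r.
  by apply: idealB => //; case: (iJ) => _ _ JM; apply: JM.
have remP h : P h -> P (h %% q).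
  move=> Ph; have -> : h %% q = (lead_coef q ^+ scalp h q)%:P * h - (h %/ q) * q.
    by rewrite mul_polyC Pdiv.Idomain.divp_eq addrAC subrr add0r.
  by apply: idealB => //; apply: PM.
have remJ_P h : J h -> forall i, PB (h %% e)`_i.
  move=> Jh; apply: (min_coef J (size e)) => //; last by rewrite ltn_modp.
  - by move=> b /PJ.
  - exact: remJ.
have remP_P h : P h -> forall i, PB (h %% q)`_i.
  move=> Ph; apply: (min_coef P (size q)) => //; last by rewrite ltn_modp.
  exact: remP.
(* Constant [e]: it is an element [r] of the coefficient ring, outside [PB]. Above a zero of [PB]
   where [r] and the leading coefficient of [q] survive, any root [s] of [q] is a zero of [P], and
   as [r] lies in P + (c), [c] cannot vanish there. *)
have [se|se] := leqP (size e) 1.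
  have [z Pz [a ea]] := Je.
  pose r := (e : {poly B})`_0.
  have er : e = r%:P by apply: size1_polyC.
  have nr : ~ PB r by rewrite er lead_coefC in le.
  have nrl : ~ PB (r * lead_coef q) by move=> /PPB[].
  have [v [hv vr]] := IH _ _ hPB nrl.
  move: vr; rewrite rmorphM mulf_eq0 negb_or => /andP[vr vl].
  pose qv := map_poly (iev m v) q.
  have sq : size qv = size q.
    by rewrite size_map_poly_id0 // -lead_coefE.
  have sq1 : size qv != 1%N.
    rewrite sq; apply: contra_notN lq => /eqP /eqP/size_poly1P[b _ qb].
    by rewrite qb lead_coefC; move: Pq; rewrite qb.
  have [s hs] := closed_rootP _ sq1.
  have Pzero p : P p -> iev m.+1 (ext v s) p = 0.
    move=> Pp; rewrite extE.
    have := congr1 (fun p => (map_poly (iev m v) p).[s]) (Pdiv.Idomain.divp_eq p q).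
    rewrite -mul_polyC !(rmorphM, rmorphD) /= (evcoef v (p %% q)) //; last exact: remP_P.
    rewrite addr0 map_polyC !hornerM hornerC (rootP hs) mulr0 /= => /eqP.
    by rewrite mulf_eq0 rmorphXn expf_eq0 (negbTE vl) andbF orFb => /eqP.
  exists (ext v s); split => //.
  apply: contraNneq vr => c0.
  have : iev m.+1 (ext v s) e = 0 by rewrite ea rmorphD rmorphM c0 mulr0 addr0; apply: Pzero.
  by rewrite extE er map_polyC hornerC => ->.
(* Nonconstant [e]: it divides [q] modulo [PB], and the quotient is too short to lie in [P], so [e]
   does. As [e] also divides [c], up to a power of its leading coefficient, [c] would lie in [P]. *)
exfalso.
have Pe : P e.
  have : P ((q %/ e) * e).
    have -> : (q %/ e) * e = (lead_coef e ^+ scalp q e)%:P * q - q %% e.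
      by rewrite mul_polyC Pdiv.Idomain.divp_eq addrK.
    by apply: idealB => //; [apply: PM | apply: coefP; apply: remJ_P; apply: PJ].
  move=> /PP[|//] Pt.
  have lead : lead_coef (q %/ e) * lead_coef e = lead_coef e ^+ scalp q e * lead_coef q.
    rewrite -lead_coefM -lead_coefZ Pdiv.Idomain.divp_eq lead_coefDl //.
    have le0 : lead_coef e ^+ scalp q e != 0 by rewrite expf_neq0 // lead_coef_eq0.
    have se' : (size e <= size q)%N by apply: emin; split => //; apply: PJ.
    have : size (lead_coef e ^+ scalp q e *: q) = size q by rewrite size_scale.
    rewrite Pdiv.Idomain.divp_eq => sz.
    rewrite ltnNge; apply/negP => hle.
    have h1 : (size (q %% e)%R < size e)%N by rewrite ltn_modp.
    have h2 := leq_ltn_trans (size_polyD (q %/ e * e)%R (q %% e)%R).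
    have : (size q < size q)%N; last by rewrite ltnn.
    rewrite -{1}sz; apply: h2; rewrite gtn_max (leq_ltn_trans hle) /=;
      exact: leq_trans h1 se'.
  have nlt : ~ PB (lead_coef (q %/ e)).
    move=> Pl; have : PB (lead_coef e ^+ scalp q e * lead_coef q).
      by rewrite -lead mulrC; apply: PBM.
    by move=> /PPB[/(prime_idealX hPB)|].
  have := qmin _ (conj Pt nlt).
  rewrite Pdiv.Idomain.size_divp // leqNgt ltn_subrL -subn1 subn_gt0 se /=.
  by rewrite size_poly_gt0 q0.
have Pc' : P ((lead_coef e ^+ scalp c e)%:P * (c : {poly B})).
  rewrite mul_polyC Pdiv.Idomain.divp_eq; apply: PD; first exact: PM.
  by apply: coefP; apply: remJ_P; apply: mem_ideal_add.
by have [/(prime_idealX hPB)|] := PP _ _ Pc'.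
Qed.

End IteratedPoly.

(** * Noetherian rings *)

Section Noetherian.

Definition noetherian (B : comPzRingType) : Prop :=
  forall J : nat -> set B, (forall k, ideal (J k)) -> (forall k, J k `<=` J k.+1) ->
  exists k, forall l, J l `<=` J k.

Lemma chain_le (T : Type) (J : nat -> set T) : (forall k, J k `<=` J k.+1) ->
  forall k l, (k <= l)%N -> J k `<=` J l.
Proof.
move=> h k l /subnK <-; elim: (l - k)%N => [|d IH] x Jx //=.
by rewrite addSn; apply/h/IH.
Qed.

Lemma noetherian_field (K : fieldType) : noetherian K.
Proof.
move=> J hJ hs; have [[k [x Jx x0]]|h] := pselect (exists k, exists2 x, J k x & x != 0).
  exists k => l y _; have [_ _ JM] := hJ k.
  by rewrite -[y](mulfVK x0); apply: JM.
exists 0%N => l x Jx; have [->|x0] := eqVneq x 0; first by case: (hJ 0%N).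
by case: h; exists l, x.
Qed.

Lemma noetherian_poly (B : idomainType) : noetherian B -> noetherian {poly B}.
Proof.
move=> nB J hJ hs.
pose L k d : set B := [set b | exists p : {poly B}, [/\ J k p, (size p <= d.+1)%N & p`_d = b]].
have hL k d : ideal (L k d).
  have [J0 JD JM] := hJ k; split.
  - by exists 0; rewrite size_poly0 coef0.
  - move=> _ _ [p [Jp sp <-]] [q [Jq sq <-]]; exists (p + q); rewrite coefD; split => //.
      exact: JD.
    by rewrite (leq_trans (size_polyD _ _)) // geq_max sp.
  - move=> a _ [p [Jp sp <-]]; exists (a%:P * p); rewrite coefCM; split => //.
      exact: JM.
    by rewrite mul_polyC (leq_trans (size_scale_leq _ _)).
have Lk k d : L k d `<=` L k.+1 d by move=> b [p [Jp sp hp]]; exists p; split => //; apply: hs.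
have Ld k d : L k d `<=` L k d.+1.
  move=> b [p [Jp sp <-]]; exists ('X * p); split => //.
  - by case: (hJ k) => _ _; apply.
  - rewrite mulrC; have [->|p0] := eqVneq p 0; first by rewrite mul0r size_poly0.
    by rewrite size_mulX.
  - by rewrite coefXM.
(* Since [L] grows in both indices, the diagonal chain settles all degrees d >= k0 at once; the
   finitely many smaller degrees are settled one by one. *)
have [k0 hk0] := nB (fun k => L k k) (fun k => hL k k) (fun k => subset_trans (@Lk k k) (@Ld k.+1
  k)).
have [n hn] := choice (fun d => nB (fun k => L k d) (fun k => hL k d) (fun k => @Lk k d)).
pose N := maxn k0 (\max_(d < k0) n d).
have LN l d : L l d `<=` L N d.
  have [dk|kd] := ltnP d k0.
    apply: subset_trans (hn d l) _; apply: (chain_le (J := fun k => L k d)) => //.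
    by rewrite leq_max (leq_bigmax (Ordinal dk)) orbT.
  pose M := maxn l d.
  apply: (@subset_trans _ (L M d)).
    by apply: (chain_le (J := fun k => L k d)) => //; exact: leq_maxl.
  apply: (@subset_trans _ (L M M)).
    by apply: (chain_le (J := fun d => L M d)) => //; exact: leq_maxr.
  apply: subset_trans (hk0 M) _; apply: (@subset_trans _ (L k0 d)).
    exact: (chain_le (J := fun d => L k0 d)).
  by apply: (chain_le (J := fun k => L k d)) => //; exact: leq_maxl.
exists N => l p; move: {2}(size p) (leqnn (size p)) => s; elim: s l p => [|s IH] l p sp Jp.
  have -> : p = 0 by apply/eqP; rewrite -size_poly_leq0.
  by case: (hJ N).
have [g [Jg sg gs]] : L N s p`_s by apply: (LN l); exists p.
rewrite -[p](subrK g); case: (hJ N) => _ JD _; apply: JD => //.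
apply: (IH (maxn N l)); last first.
  apply: idealB => //; first by apply: (chain_le hs) Jp; exact: leq_maxr.
  by apply: (chain_le hs) Jg; exact: leq_maxl.
apply/leq_sizeP => j; rewrite leq_eqVlt coefB => /orP[/eqP <-|sj].
  by rewrite gs subrr.
by rewrite !nth_default ?subrr // (leq_trans _ sj).
Qed.

Section PowerIdeal.

Variables (B : comPzRingType) (A : set B) (M : nat) (s : 'I_M -> B).

(** The k-th power of the ideal generated by the [s i]. The bottom set [A] is a parameter because
    the construction serves both in a whole ring and inside W -> K, where coefficients have to be
    polynomial functions. *)
Fixpoint mpow k : set B :=
  if k is k'.+1 then
    [set x | exists2 q : 'I_M -> B, forall i, mpow k' (q i) & x = \sum_i s i * q i]
  else A.

End PowerIdeal.

Section Krull.

Variables (B : comPzRingType) (M : nat) (s : 'I_M -> B).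
Local Notation mpow := (mpow setT s).

Lemma ideal_mpow k : ideal (mpow k).
Proof.
elim: k => [|k [I0 ID IM]]; first by split.
split.
- exists (fun=> 0) => [i|]; first exact: I0.
  by apply/esym/big1 => i _; rewrite mulr0.
- move=> _ _ [q hq ->] [r hr ->]; exists (fun i => q i + r i) => [i|]; first by apply: ID;
  [apply: hq|apply: hr].
  by rewrite -big_split; apply: eq_bigr => i _; rewrite mulrDr.
- move=> a _ [q hq ->]; exists (fun i => a * q i) => [i|]; first by apply: IM; apply: hq.
  by rewrite mulr_sumr; apply: eq_bigr => i _; rewrite mulrCA.
Qed.

Lemma mem_mpow1 i a : mpow 1 (a * s i).
Proof.
exists (fun j => if j == i then a else 0) => //.
rewrite (bigD1 i) //= eqxx mulrC big1 ?addr0 // => j /negbTE ->.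
by rewrite mulr0.
Qed.

(** Pigeonhole: a monomial of degree above M * j in M generators is divisible by some [s i ^+ j]. *)
Lemma mpow_sub Q j : ideal Q -> (forall i, Q (s i ^+ j)) -> exists k, mpow k `<=` Q.
Proof.
move=> hQ hs; exists (M * j).+1 => x hx.
(* [c] records the exponents already extracted, [k] the number of generators still to be
   expanded. *)
suff H k (c : {ffun 'I_M -> nat}) y : (M * j < \sum_i c i + k)%N -> mpow k y ->
    Q ((\prod_i s i ^+ c i) * y).
  have := H (M * j).+1 [ffun=> 0%N] x; rewrite leq_addl => /(_ isT hx).
  by rewrite big1 ?mul1r // => i _; rewrite ffunE expr0.
move=> {x hx}; have [_ _ QM] := hQ.
elim: k c y => [|k IH] c y hc hy.
  have [/existsP[i hi]|] := boolP [exists i, (j <= c i)%N].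
    rewrite mulrC (bigD1 i) //= -(subnK hi) exprD.
    set a := \prod_(_ < _ | _) _; set b := s i ^+ (_ - _).
    have -> : y * (b * s i ^+ j * a) = (y * b * a) * s i ^+ j by ring.
    exact: QM.
  rewrite negb_exists => /forallP h; exfalso.
  have : (\sum_i c i <= \sum_(i < M) j)%N.
    by apply: leq_sum => i _; rewrite ltnW // ltnNge h.
  by rewrite sum_nat_const card_ord leqNgt -[X in (_ < X)%N]addn0 hc.
case: hy => q hq ->; rewrite mulr_sumr; apply: ideal_sum => // i _.
pose c' := [ffun l => c l + (l == i)]%N.
have -> : (\prod_l s l ^+ c l) * (s i * q i) = (\prod_l s l ^+ c' l) * q i.
  rewrite mulrA; congr (_ * _); rewrite !(bigD1 (P := xpredT) i) //= ffunE eqxx addn1 exprSr.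
  rewrite mulrAC; congr (_ * _); apply: eq_bigr => l /negbTE li.
  by rewrite ffunE li addn0.
apply: (IH c' (q i)); last exact: hq.
apply: leq_trans hc _.
have -> : (\sum_l c' l = \sum_l c l + 1)%N; last by rewrite addn1 addSnnS.
rewrite !(bigD1 (P := xpredT) i) //= ffunE eqxx addnAC; congr (_ + _ + _)%N.
by apply: eq_bigr => l /negbTE li; rewrite ffunE li addn0.
Qed.

Hypothesis nB : noetherian B.

(* [Q] is chosen maximal among the ideals containing [m b + J] that do not
   meet [(b) + J] any further; each generator of [m] is nilpotent modulo [Q]. *)
Lemma krull_intersection J b : ideal J ->
  (forall k, exists2 x, mpow k x & J (b - x)) ->
  exists2 e, mpow 1 e & J ((1 - e) * b).
Proof.
move=> hJ hb; have [J0 JD JM] := hJ.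
pose T : set B := [set y | exists2 e, mpow 1 e & J (y - e * b)].
have [m0 mD mM] := ideal_mpow 1.
have hT : ideal T.
  split; first by exists 0 => //; rewrite mul0r subr0.
    move=> x y [e he hx] [f hf hy]; exists (e + f); first exact: mD.
    have -> : x + y - (e + f) * b = (x - e * b) + (y - f * b) by ring.
    exact: JD.
  move=> a x [e he hx]; exists (a * e); first exact: mM.
  have -> : a * x - a * e * b = a * (x - e * b) by ring.
  exact: JM.
have JT : J `<=` T by move=> x Jx; exists 0 => //; rewrite mul0r subr0.
pose S := ideal_add J b.
have [|Q [hQ TQ QS Qmax]] := @maximal_disjoint_ideal B T (S `\` T) hT.
  by apply/seteqP; split => // x [Tx [_ nTx]].
have [_ QD QM] := hQ.
have QST x : Q x -> S x -> T x.
  move=> Qx Sx; apply: contrapT => nT; suff : set0 x by [].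
  by rewrite -QS.
have sS i y : S y -> T (s i * y).
  move=> [z Jz [a ->]]; exists (a * s i); first exact: mem_mpow1.
  have -> : s i * (z + a * b) - a * s i * b = s i * z by ring.
  exact: JM.
(* The ideals (Q : s_i^j) stabilize at some j; then Q + (s_i^j) still meets (b) + J only inside [T],
   and maximality of [Q] puts s_i^j in [Q]. *)
have pw i : exists j, Q (s i ^+ j).
  have [||j hj] := nB (J := fun j => [set x | Q (s i ^+ j * x)]).
  - move=> j; split => [|x y|a x] /=; first by rewrite mulr0; case: hQ.
      by rewrite mulrDr; exact: QD.
    by rewrite mulrCA; exact: QM.
  - by move=> j x /= hx; rewrite exprS -mulrA; exact: QM.
  exists j; apply: (Qmax (ideal_add Q (s i ^+ j))).
  - exact: ideal_addP.
  - exact: sub_ideal_add.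
  - apply/seteqP; split => // y [[q Qq [r ey]] [Sy nTy]]; apply: nTy; apply: QST => //.
    have : Q (s i ^+ j.+1 * r).
      have -> : s i ^+ j.+1 * r = s i * y - s i * q by rewrite ey exprS; ring.
      by apply: idealB => //; [apply/TQ/sS | apply: QM].
    by move=> /(hj j.+1) /= hr; rewrite ey mulrC; apply: QD; rewrite // mulrC.
  - exact: mem_ideal_add.
have [c hc] := choice pw.
have [i|k hk] := @mpow_sub Q (\max_i c i) hQ.
  by rewrite -(subnK (leq_bigmax i)) exprD; apply: QM.
have [x hx Jx] := hb k.
have : T b.
  apply: QST; last exact: mem_ideal_add.
  rewrite -[b](subrK x); apply: QD; first exact/TQ/JT.
  exact: hk.
by move=> [e he Je]; exists e => //; rewrite mulrBl mul1r.
Qed.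

End Krull.

End Noetherian.

(** * Polynomial functions as evaluations of iterated polynomials *)

Section Charts.

Variables (K : numClosedFieldType) (W : vectType K).

Fixpoint iC (n : nat) (c : K) : ipoly K n :=
  match n return ipoly K n with 0%N => c | m.+1 => (iC m c)%:P end.

Fixpoint iX (n i : nat) : ipoly K n :=
  match n return ipoly K n with
  | 0%N => 0
  | m.+1 => if i == m then 'X else (iX m i)%:P
  end.

Lemma iev_iC n v c : iev n v (iC n c) = c.
Proof. by elim: n => [|n IH] //=; rewrite map_polyC /horner_eval hornerC. Qed.

Lemma iev_iX n v i : (i < n)%N -> iev n v (iX n i) = v i.
Proof.
elim: n => [|n IH] //=; rewrite ltnS leq_eqVlt; have [->|ni] := eqVneq i n.
  by rewrite map_polyX /horner_eval hornerX.
by rewrite /= map_polyC /horner_eval hornerC => /IH.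
Qed.

Lemma noetherian_ipoly n : noetherian (ipoly K n).
Proof. by elim: n => [|n IH]; [exact: noetherian_field | exact: noetherian_poly]. Qed.

Variables (n : nat) (X : n.-tuple W).

Definition chart (x : W) (i : nat) : K :=
  if insub i is Some j then coord X j x else 0.

(** [m] may be smaller than the length of [X]: the result then depends on the first [m] coordinates
    only, which [codim2_direction] exploits. *)
Definition iev_at m (P : ipoly K m) : W -> K := fun x => iev m (chart x) P.

Lemma iev_at_polyfun m P : polyfun (@iev_at m P).
Proof.
elim: m P => [|m IH] P; first exact: polyfun_cst.
have -> : @iev_at m.+1 P =
    \sum_(i < size (P : {poly _})) @iev_at m (P : {poly _})`_i * (chart^~ m) ^+ i.
  apply/funext => x; rewrite fct_sumE /iev_at /= /horner_eval.
  rewrite (horner_coef_wide _ (size_poly _ _)); apply: eq_bigr => i _.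
  by rewrite coef_map exprfctE.
apply: polyfun_sum => i _; apply: polyfunM; first exact: IH.
apply: polyfunX; apply: polyfun_lform => a x y.
by rewrite /chart; case: insubP => [j _ _|_]; rewrite ?linearP // mulr0 addr0.
Qed.

Hypothesis hX : basis_of fullv X.

Lemma polyfun_iev_at p : polyfun p -> exists P, p = @iev_at n P.
Proof.
move: p; apply: polyfun_ind => [c|l hl|p q _ _ [P ->] [Q ->]|p q _ _ [P ->] [Q ->]].
- by exists (iC n c); apply/funext => x; rewrite /iev_at iev_iC.
- exists (\sum_(i < n) iC n (l X`_i) * iX n i); apply/funext => x.
  rewrite {1}(coord_basis hX (memvf x)) lform_sum // /iev_at rmorph_sum.
  apply: eq_bigr => i _; rewrite (lformZ _ _ hl) rmorphM iev_iC iev_iX // mulrC /chart.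
  by case: insubP => [j _ /val_inj ->|] //; rewrite ltn_ord.
- by exists (P + Q); apply/funext => x; rewrite /iev_at rmorphD.
- by exists (P * Q); apply/funext => x; rewrite /iev_at rmorphM.
Qed.

Lemma chart_surj (v : nat -> K) : exists x, forall i, (i < n)%N -> chart x i = v i.
Proof.
exists (\sum_(i < n) v i *: X`_i) => i hi; rewrite /chart insubT /=.
rewrite linear_sum /= (bigD1 (Ordinal hi)) //= big1 ?addr0 => [|j ji].
  by rewrite linearZ /= (coord_free (Ordinal hi)) ?(basis_free hX) // eqxx mulr1.
rewrite linearZ /= (coord_free j) ?(basis_free hX) //.
by rewrite -val_eqE /= in ji *; rewrite (negbTE ji) mulr0.
Qed.

End Charts.

(** * Nullstellensatz, chain condition and Krull intersection for polynomial functions *)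

Section PolyIdeals.

Variables (K : numClosedFieldType) (W : vectType K).
Implicit Types (J : set (W -> K)) (p q f : W -> K).

(** An ideal of the algebra of polynomial functions, kept as a set inside W -> K; [ideal] would let
    arbitrary functions act. *)
Definition pideal J : Prop :=
  [/\ J `<=` @polyfun K W, J 0, forall p q, J p -> J q -> J (p + q)
    & forall a p, polyfun a -> J p -> J (a * p)].

Lemma pidealN J p : pideal J -> J p -> J (- p).
Proof.
move=> [_ _ _ JM] Jp; rewrite -mulN1r; apply: JM => //.
by apply: polyfunN; exact: polyfun1.
Qed.

Lemma pidealB J p q : pideal J -> J p -> J q -> J (p - q).
Proof. by move=> hJ Jp Jq; have [_ _ JD _] := hJ; apply: JD => //; apply: pidealN. Qed.

Lemma pideal_sum J (I : Type) (r : seq I) (P : pred I) (F : I -> W -> K) :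
  pideal J -> (forall i, P i -> J (F i)) -> J (\sum_(i <- r | P i) F i).
Proof.
by move=> [_ J0 JD _] hF; elim/big_rec: _ => // i x Pi hx; apply: JD => //; apply: hF.
Qed.

Definition pideal_add J J' : set (W -> K) :=
  [set p | exists2 q, J q & J' (p - q)].

Lemma pideal_addP J J' : pideal J -> pideal J' -> pideal (pideal_add J J').
Proof.
move=> [Jp J0 JD JM] [Jp' J0' JD' JM']; split.
- move=> p [q Jq Jr]; rewrite -[p](subrK q); apply: polyfunD; [exact: Jp'|exact: Jp].
- by exists 0; rewrite ?subr0.
- move=> p q [r Jr Jpr] [s Js Jqs]; exists (r + s); first exact: JD.
  by rewrite opprD addrACA; apply: JD'.
- move=> a p ha [q Jq Jpq]; exists (a * q); first exact: JM.
  by rewrite -mulrBr; apply: JM'.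
Qed.

Lemma sub_pideal_addl J J' : pideal J' -> J `<=` pideal_add J J'.
Proof. by move=> [_ J0 _ _] p Jp; exists p => //; rewrite subrr. Qed.

Lemma sub_pideal_addr J J' : pideal J -> J' `<=` pideal_add J J'.
Proof. by move=> [_ J0 _ _] p Jp; exists 0 => //; rewrite subr0. Qed.

Definition vanishing (A : set W) : set (W -> K) :=
  [set p | polyfun p /\ forall x, A x -> p x = 0].

Lemma vanishing_pideal A : pideal (vanishing A).
Proof.
split=> [p []//||p q [hp Ap] [hq Aq]|a p ha [hp Ap]]; first by split=> //; exact: polyfun0.
  by split=> [|x Ax]; [exact: polyfunD | rewrite addrfctE Ap // Aq // addr0].
by split=> [|x Ax]; [exact: polyfunM | rewrite mulrfctE Ap // mulr0].
Qed.

Local Notation pev := (@iev_at K W _ (vbasis {:W}) (\dim {:W})).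

Let basisX : basis_of fullv (vbasis {:W}) := vbasisP fullv.

Lemma ievD P Q : pev (P + Q) = pev P + pev Q.
Proof. by apply/funext => x; rewrite /iev_at rmorphD. Qed.

Lemma ievM P Q : pev (P * Q) = pev P * pev Q.
Proof. by apply/funext => x; rewrite /iev_at rmorphM. Qed.

Lemma ievX P k : pev (P ^+ k) = pev P ^+ k.
Proof. by apply/funext => x; rewrite /iev_at rmorphXn exprfctE. Qed.

Definition pull J : set (ipoly K (\dim {:W})) := [set P | J (pev P)].

Lemma pull_ideal J : pideal J -> ideal (pull J).
Proof.
move=> [Jp J0 JD JM]; split; rewrite /pull /=.
- by have -> : pev 0 = 0 by apply/funext => x; rewrite /iev_at rmorph0.
- by move=> P Q; rewrite ievD; apply: JD.
- by move=> P Q; rewrite ievM; apply: JM; exact: iev_at_polyfun.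
Qed.

(** Otherwise a prime ideal above [J] avoids the powers of [f], and it has a zero at which [f]
    survives. *)
Theorem nullstellensatz J f : pideal J -> polyfun f ->
  (forall x, (forall p, J p -> p x = 0) -> f x = 0) -> exists k, J (f ^+ k).
Proof.
move=> hJ hf hz; apply: contrapT => Jf.
have [F eF] := polyfun_iev_at basisX hf.
have [|P [hP JP nPF]] := @prime_avoiding _ (pull J) F (pull_ideal hJ).
  by move=> k hk; apply: Jf; exists k; move: hk; rewrite /pull /= ievX -eF.
have [v [hv vF]] := prime_ideal_zero hP nPF.
have [x hx] := chart_surj basisX v.
have evx Q : pev Q x = iev _ v Q by apply: iev_ext.
have /eqP := vF; apply; rewrite -evx -eF; apply: hz => p Jp.
have [hJp _ _ _] := hJ.
have [Q eQ] := polyfun_iev_at basisX (hJp _ Jp).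
by rewrite eQ evx hv //; apply: JP; rewrite /pull /= -eQ.
Qed.

Corollary weak_nullstellensatz J : pideal J ->
  (forall x, exists2 p, J p & p x != 0) -> J 1.
Proof.
move=> hJ hz; have [|x hx|k] := @nullstellensatz J 1 hJ; first exact: polyfun1.
  by have [p Jp /eqP[]] := hz x; apply: hx.
by rewrite expr1n.
Qed.

Theorem polyfun_acc (J : nat -> set (W -> K)) :
  (forall k, pideal (J k)) -> (forall k, J k `<=` J k.+1) ->
  exists k, forall l, J l `<=` J k.
Proof.
move=> hJ hs.
have [k hk] := noetherian_ipoly (fun k => pull_ideal (hJ k))
  (fun k P => hs k (pev P) : pull (J k) P -> pull (J k.+1) P).
exists k => l p Jp; have [hJl _ _ _] := hJ l.
have [P eP] := polyfun_iev_at basisX (hJl _ Jp).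
by rewrite eP; apply: (hk l); rewrite /pull /= -eP.
Qed.

(** These centred coordinates generate the maximal ideal of [x0], so that [lpow x0 k] is its k-th
    power. *)
Definition loc (x0 : W) (i : 'I_(\dim {:W})) : W -> K :=
  fun x => coord (vbasis {:W}) i (x - x0).

Lemma loc_polyfun x0 i : polyfun (loc x0 i).
Proof.
have -> : loc x0 i = (coord (vbasis {:W}) i : W -> K) - cst (coord (vbasis {:W}) i x0).
  by apply/funext => x; rewrite /loc linearB.
apply: polyfunB; last exact: polyfun_cst.
by apply: polyfun_lform; apply: lform_coord.
Qed.

Notation lpow x0 := (mpow (@polyfun K W) (loc x0)).

Lemma lpow_polyfun x0 k p : lpow x0 k p -> polyfun p.
Proof.
elim: k p => [//|k IH] _ [q hq ->]; apply: polyfun_sum => i _.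
by apply: polyfunM; [exact: loc_polyfun | exact: (IH _ (hq i))].
Qed.

Lemma lpow_pideal x0 k : pideal (lpow x0 k).
Proof.
split; first by move=> p; exact: lpow_polyfun.
- elim: k => [|k IH]; first exact: polyfun0.
  by exists (fun=> 0) => [i|]; [exact: IH | apply/esym/big1 => i _; rewrite mulr0].
- elim: k => [|k IH] p q; first exact: polyfunD.
  move=> [f hf ->] [g hg ->]; exists (fun i => f i + g i) => [i|].
    by apply: IH; [apply: hf | apply: hg].
  by rewrite -big_split; apply: eq_bigr => i _; rewrite mulrDr.
- elim: k => [|k IH] a p ha; first exact: polyfunM.
  move=> [f hf ->]; exists (fun i => a * f i) => [i|]; first by apply: IH => //; apply: hf.
  by rewrite mulr_sumr; apply: eq_bigr => i _; rewrite mulrCA.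
Qed.

Lemma lpow0 x0 k p : lpow x0 k.+1 p -> p x0 = 0.
Proof.
move=> [q _ ->]; rewrite fct_sumE big1 // => i _.
by rewrite mulrfctE /loc subrr linear0 mul0r.
Qed.

Let gen x0 i : ipoly K (\dim {:W}) :=
  iX K _ (val i) - iC _ (coord (vbasis {:W}) i x0).

Let iev_gen x0 i : pev (gen x0 i) = loc x0 i.
Proof.
apply/funext => x; rewrite /loc linearB /iev_at rmorphB iev_iC iev_iX ?ltn_ord // /chart.
by case: insubP => [j _ /val_inj ->|] //; rewrite ltn_ord.
Qed.

Let lpow_pull x0 k p : lpow x0 k p -> exists2 P, mpow setT (gen x0) k P & p = pev P.
Proof.
elim: k p => [|k IH] p; first by move=> /(polyfun_iev_at basisX)[P ->]; exists P.
move=> [q hq ->].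
have [Q hQ] := choice (fun i => (let: ex_intro2 P a b := IH _ (hq i) in ex_intro _ P (conj a b))
   : exists P, mpow setT (gen x0) k P /\ q i = pev P).
exists (\sum_i gen x0 i * Q i); first by exists Q => // i; case: (hQ i).
apply/funext => x; rewrite fct_sumE /iev_at rmorph_sum; apply: eq_bigr => i _.
by rewrite rmorphM mulrfctE (hQ i).2 -iev_gen.
Qed.

Let push_lpow x0 k P : mpow setT (gen x0) k P -> lpow x0 k (pev P).
Proof.
elim: k P => [|k IH] P; first by move=> _; exact: iev_at_polyfun.
move=> [Q hQ ->]; exists (fun i => pev (Q i)) => [i|]; first by apply: IH; apply: hQ.
apply/funext => x; rewrite fct_sumE /iev_at rmorph_sum; apply: eq_bigr => i _.
by rewrite rmorphM mulrfctE -iev_gen.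
Qed.

(** The factor 1 - e, equal to 1 at [x0], stands for a neighbourhood of [x0] and replaces a
    localization. *)
Theorem polyfun_krull x0 J b : pideal J -> polyfun b ->
  (forall k, pideal_add (lpow x0 k) J b) ->
  exists e, [/\ polyfun e, e x0 = 0 & J ((1 - e) * b)].
Proof.
move=> hJ hb hk; have [B eB] := polyfun_iev_at basisX hb.
have [k|e he Je] := krull_intersection (noetherian_ipoly (n := _)) (s := gen x0)
    (b := B) (pull_ideal hJ).
  have [p hp Jp] := hk k; have [P hP eP] := lpow_pull hp; exists P => //.
  rewrite /pull /=; have -> : pev (B - P) = b - p; last exact: Jp.
  by rewrite eB eP; apply/funext => x; rewrite /iev_at rmorphB.
have le := push_lpow he.
exists (pev e); split; [exact: iev_at_polyfun | exact: lpow0 le |].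
move: Je; rewrite /pull /= ievM -eB; congr (J (_ * _)).
by apply/funext => x; rewrite /iev_at rmorphB rmorph1.
Qed.

Lemma pideal_lpow_sub x0 Q j : pideal Q -> (forall i, Q (loc x0 i ^+ j)) ->
  exists k, lpow x0 k `<=` Q.
Proof.
move=> hQ hi; have [i|k hk] := mpow_sub (s := gen x0) (j := j) (pull_ideal hQ).
  by rewrite /pull /= ievX iev_gen.
by exists k => p /lpow_pull[P hP ->]; apply: (hk P).
Qed.

End PolyIdeals.

Notation lpow x0 := (mpow (@polyfun _ _) (loc x0)).

(** * Generalized eigenvectors and replicas *)

Section GeneralizedEigenvectors.

Variables (K : numClosedFieldType) (E : lmodType K).

(** Sets instead of vspaces: the operators below also act on the infinite-dimensional space of
    polynomial functions. *)
Definition subspace (S : set E) : Prop :=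
  S 0 /\ forall a u v, S u -> S v -> S (a *: u + v).

Lemma subspaceZ S a u : subspace S -> S u -> S (a *: u).
Proof. by move=> [S0 SL] Su; rewrite -[_ *: _]addr0; apply: SL. Qed.

Lemma subspaceD S u v : subspace S -> S u -> S v -> S (u + v).
Proof. by move=> [S0 SL] Su Sv; rewrite -[u]scale1r; apply: SL. Qed.

Lemma subspaceB S u v : subspace S -> S u -> S v -> S (u - v).
Proof. by move=> hS Su Sv; rewrite -scaleN1r addrC; apply: hS.2. Qed.

Lemma subspace_sum S (I : Type) (r : seq I) (P : pred I) (F : I -> E) :
  subspace S -> (forall i, P i -> S (F i)) -> S (\sum_(i <- r | P i) F i).
Proof.
by move=> hS hF; elim/big_rec: _ => [|i x Pi hx]; [case: hS | apply: subspaceD; auto].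
Qed.

Section Operator.

Variables (E' : lmodType K) (D : E -> E').
Hypothesis hD : linear D.

Lemma op0 : D 0 = 0.
Proof. by have := hD (-1) 0 0; rewrite scaler0 addr0 scaleN1r addNr. Qed.
Lemma opZ a u : D (a *: u) = a *: D u.
Proof. by have := hD a u 0; rewrite addr0 op0 addr0. Qed.
Lemma opD u v : D (u + v) = D u + D v.
Proof. by have := hD 1 u v; rewrite !scale1r. Qed.
Lemma opB u v : D (u - v) = D u - D v.
Proof. by rewrite opD -scaleN1r opZ scaleN1r. Qed.
Lemma op_sum (I : Type) (r : seq I) (P : pred I) (F : I -> E) :
  D (\sum_(i <- r | P i) F i) = \sum_(i <- r | P i) D (F i).
Proof. by elim/big_rec2: _ => [|i x y _ <-]; [exact: op0 | exact: opD]. Qed.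

End Operator.

Definition shift (D : E -> E) mu u := D u - mu *: u.

Lemma iter_linear k (T : E -> E) : linear T -> linear (iter k T).
Proof. by move=> hT; elim: k => [|k IH] // a u v; rewrite !iterS IH hT. Qed.

Definition gen (D : E -> E) mu u := exists k, iter k (shift D mu) u = 0.

Section Decomposition.

Variable D : E -> E.
Hypothesis hD : linear D.
Local Notation shift := (shift D).
Local Notation gen := (gen D).

Lemma shift_linear mu : linear (shift mu).
Proof.
move=> a u v; rewrite /shift hD scalerBr scalerDr !scalerA mulrC.
by rewrite opprD addrACA.
Qed.

Lemma shiftC a b u : shift a (shift b u) = shift b (shift a u).
Proof.
rewrite /shift !(opB hD) !(opZ hD) !scalerBr !scalerA [b * a]mulrC.
by rewrite !opprB !addrA [LHS]addrAC [RHS]addrAC; congr (_ + _); exact: addrAC.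
Qed.

Lemma shift_iterC a b k u : shift a (iter k (shift b) u) = iter k (shift b) (shift a u).
Proof. by elim: k => //= k <-; rewrite shiftC. Qed.

Lemma gen_subspace mu : subspace (gen mu).
Proof.
split; first by exists 0%N.
move=> a u v [k hk] [l hl]; exists (k + l)%N.
have hL j := iter_linear j (shift_linear mu).
by rewrite hL {1}addnC !iterD hk hl (op0 (hL l)) (op0 (hL k)) scaler0 addr0.
Qed.

Lemma gen_shift mu a u : gen mu u -> gen mu (shift a u).
Proof. by move=> [k hk]; exists k; rewrite -shift_iterC hk (op0 (shift_linear a)). Qed.

(** On generalized eigenvectors for [mu], D - a is the nonzero scalar mu - a plus a locally
    nilpotent operator, hence invertible. *)
Lemma gen_shift_solve mu a h' : gen mu h' -> a != mu ->
  exists2 h, shift a h = h' & gen mu h.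
Proof.
move=> [k]; elim: k h' => [|k IH] h' hk ne.
  by move: hk => /= ->; exists 0; [exact: (op0 (shift_linear a)) | exists 0%N].
have [|h1 e1 g1] := IH (shift mu h') _ ne; first by rewrite -iterSr.
have ne' : mu - a != 0 by rewrite subr_eq0 eq_sym.
have Sl := shift_linear a.
exists ((mu - a)^-1 *: (h' - h1)); last first.
  apply: subspaceZ; first exact: gen_subspace.
  apply: subspaceB => //; first exact: gen_subspace.
  by exists k.+1.
rewrite (opZ Sl) (opB Sl) e1; apply: (scalerI ne'); rewrite scalerA divff // scale1r.
by rewrite /shift opprB [LHS]addrC addrA subrK scalerBl.
Qed.

Variable S : set E.
Hypotheses (hS : subspace S) (DS : forall u, S u -> S (D u)).

Lemma stable_shift a u : S u -> S (shift a u).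
Proof. by move=> Su; apply: subspaceB => //; [apply: DS | apply: subspaceZ]. Qed.

(** The nonzero multiple (mu - nu) h is the difference of two shifts of [h], and the shift by [mu]
    is in [S] by induction on the nilpotency order. *)
Lemma mem_of_shift mu nu h : gen mu h -> mu != nu -> S (shift nu h) -> S h.
Proof.
move=> [k]; elim: k h => [|k IH] h hk ne Sh; first by move: hk => /= ->; case: hS.
have Sh' : S (shift mu h).
  apply: IH => //; first by rewrite -iterSr.
  by rewrite shiftC; apply: stable_shift.
have ne' : mu - nu != 0 by rewrite subr_eq0.
rewrite -[h]scale1r -(mulVf ne') -scalerA; apply: subspaceZ => //.
have -> : (mu - nu) *: h = shift nu h - shift mu h.
  by rewrite /shift opprB [RHS]addrC addrA subrK scalerBl.
exact: subspaceB.
Qed.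

Lemma mem_of_iter_shift mu nu h k : gen mu h -> mu != nu ->
  S (iter k (shift nu) h) -> S h.
Proof.
move=> hg ne; elim: k => //= k IH Sk; apply: IH.
apply: (@mem_of_shift mu nu) => //.
by elim: k {Sk} => //= k IH; apply: gen_shift.
Qed.

(** A power of D - nu removes the component at [nu], and [mem_of_iter_shift] undoes its effect on
    the others. *)
Lemma mem_component (s : seq K) (h : K -> E) :
  uniq s -> (forall mu, mu \in s -> gen mu (h mu)) -> S (\sum_(mu <- s) h mu) ->
  forall mu, mu \in s -> S (h mu).
Proof.
elim: s h => [|nu s IH] h //= /andP[nus us] hg; rewrite big_cons => Su.
have [k hk] := hg nu (mem_head _ _).
have hsl := iter_linear k (shift_linear nu).
have Ss mu : mu \in s -> S (h mu).
  move=> mus; apply: (@mem_of_iter_shift mu nu _ k).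
  - by apply: hg; rewrite inE mus orbT.
  - by apply: contraNneq nus => <-.
  apply: (IH (fun mu => iter k (shift nu) (h mu))) => //.
    move=> la las; elim: k {hk hsl} => [|k IHk] /=; last exact: gen_shift.
    by apply: hg; rewrite inE las orbT.
  have -> : \sum_(la <- s) iter k (shift nu) (h la) =
      iter k (shift nu) (h nu + \sum_(la <- s) h la).
    by rewrite (opD hsl) hk add0r (op_sum hsl).
  by elim: k {hk hsl} => //= k IHk; apply: stable_shift.
move=> mu; rewrite inE => /orP[/eqP ->|]; last exact: Ss.
have -> : h nu = (h nu + \sum_(j <- s) h j) - \sum_(j <- s) h j by rewrite addrK.
apply: subspaceB => //.
by rewrite big_seq; apply: subspace_sum.
Qed.

End Decomposition.

Lemma gen_decomposition (D : E -> E) (l : seq K) u : linear D ->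
  foldr (shift D) u l = 0 ->
  exists (s : seq K) (h : K -> E), [/\ uniq s, forall mu, gen D mu (h mu)
    & u = \sum_(mu <- s) h mu].
Proof.
move=> hD; elim: l u => [|a l IH] u /=.
  by move=> ->; exists [::], (fun=> 0); split => // [mu|]; [exists 0%N | rewrite big_nil].
have -> : shift D a (foldr (shift D) u l) = foldr (shift D) (shift D a u) l.
  by elim: l {IH} => //= b l <-; rewrite (shiftC hD).
move=> /IH[s [h' [us hg eu]]].
(* The components of (D - a) u other than that at [a] are divided by D - a; what remains of [u] is a
   generalized eigenvector for [a]. *)
have hex mu : exists h, gen D mu h /\ (mu != a -> shift D a h = h' mu).
  have [->|ne] := eqVneq mu a; first by exists 0; split => //; exists 0%N.
  by have [|h] := gen_shift_solve hD (a := a) (hg mu); [rewrite eq_sym | exists h].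
have [h hh] := choice hex.
pose s' := [seq mu <- s | mu != a].
pose ha := u - \sum_(mu <- s') h mu.
have ea : gen D a (shift D a ha).
  have al := shift_linear hD a; rewrite /ha (opB al) (op_sum al).
  rewrite eu; have -> : \sum_(mu <- s') shift D a (h mu) = \sum_(mu <- s | mu != a) h' mu.
    by rewrite big_filter; apply: eq_bigr => mu ne; rewrite (hh mu).2.
  rewrite (bigID (fun mu => mu != a)) /= [X in gen D a X]addrC addKr.
  apply: (@subspace_sum (gen D a)) => [|mu]; first exact: gen_subspace.
  rewrite negbK => /eqP ->; exact: hg.
exists (a :: s'), (fun mu => if mu == a then ha else h mu); split.
- by rewrite /= filter_uniq // mem_filter eqxx.
- move=> mu; case: eqP => [->|_]; last exact: (hh mu).1.
  by have [k hk] := ea; exists k.+1; rewrite iterSr.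
- rewrite big_cons eqxx /s' big_filter (eq_bigr h) => [|mu /negbTE -> //].
  by rewrite /ha /s' big_filter subrK.
Qed.

Section ConjugateReplica.

(* [B] acts on each generalized eigenspace of [D] by the conjugate eigenvalue:
   a replica of [D] in the sense of Chevalley. *)
Variables (D B : E -> E).
Hypotheses (hD : linear D) (hB : linear B).

Definition pure mu u : Prop := gen D mu u /\ B u = mu^* *: u.

Lemma pure_subspace mu : subspace (pure mu).
Proof.
split; first by split; [case: (gen_subspace hD mu) | rewrite (op0 hB) scaler0].
move=> a u v [gu bu] [gv bv]; split; first by apply: (gen_subspace hD mu).2.
by rewrite hB bu bv scalerDr !scalerA mulrC.
Qed.

Definition replicated u : Prop := exists (s : seq K) (h : K -> E),
  [/\ uniq s, forall mu, pure mu (h mu) & u = \sum_(mu <- s) h mu].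

Lemma replicated_pure mu u : pure mu u -> replicated u.
Proof.
move=> pu; exists [:: mu], (fun nu => if nu == mu then u else 0).
split => // [nu|]; last by rewrite big_seq1 eqxx.
by case: eqP => [->//|_]; case: (pure_subspace nu).
Qed.

Lemma replicatedD u v : replicated u -> replicated v -> replicated (u + v).
Proof.
move=> [s [h [us hp ->]]] [t [h' [ut hp' ->]]].
exists (undup (s ++ t)), (fun mu => (if mu \in s then h mu else 0) + (if mu \in t then h' mu else
  0)).
split; first exact: undup_uniq.
  move=> mu; have hs := pure_subspace mu.
  by apply: subspaceD => //; case: ifP => // _; case: hs.
rewrite big_split /=; congr (_ + _).
  rewrite -big_mkcond /= -[RHS]big_filter; apply: perm_big; apply: uniq_perm => //.
    by rewrite filter_uniq // undup_uniq.
  by move=> mu; rewrite mem_filter mem_undup mem_cat; case: (mu \in s).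
rewrite -big_mkcond /= -[RHS]big_filter; apply: perm_big; apply: uniq_perm => //.
  by rewrite filter_uniq // undup_uniq.
by move=> mu; rewrite mem_filter mem_undup mem_cat; case: (mu \in t); rewrite ?orbT.
Qed.

Lemma replicated_subspace : subspace replicated.
Proof.
have R0 : replicated 0.
  by exists [::], (fun=> 0); split => // [mu|]; [case: (pure_subspace mu) | rewrite big_nil].
split => // a u v [s [h [us hp ->]]]; apply: replicatedD.
exists s, (fun mu => a *: h mu); split => // [mu|]; last by rewrite scaler_sumr.
exact: subspaceZ (pure_subspace mu) (hp mu).
Qed.

(** On the components of [u], which lie in [S] by [mem_component], the replica is a scalar. This
    replaces the argument that a replica is a polynomial in [D]. *)
Lemma replicated_stable (S : set E) u : subspace S -> (forall v, S v -> S (D v)) ->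
  replicated u -> S u -> S (B u).
Proof.
move=> hS DS [s [h [us hp ->]]] Su; rewrite (op_sum hB) big_seq; apply: subspace_sum => // mu mus.
rewrite (hp mu).2; apply: subspaceZ => //.
by apply: (mem_component hD hS DS us) Su _ mus => nu _; case: (hp nu).
Qed.

Lemma replicated_nilpotent k u : replicated u -> iter k D u = 0 -> B u = 0.
Proof.
move=> [s [h [us hp ->]]] hk; rewrite (op_sum hB) big_seq big1 // => mu mus.
have [->|mu0] := eqVneq mu 0; first by rewrite (hp 0).2 conjC0 scale0r.
suff -> : h mu = 0 by rewrite (op0 hB).
have hDk := iter_linear k hD.
have S0 : subspace [set u : E | u = 0] by split => // a v w -> ->; rewrite scaler0 addr0.
have D0 v : v = 0 -> D v = 0 by move=> ->; exact: (op0 hD).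
have hk' : iter k D (h mu) = 0.
  have hS : subspace [set v | iter k D v = 0].
    by split => [|a v w /= hv hw]; [exact: (op0 hDk) | rewrite hDk hv hw scaler0 addr0].
  apply: (mem_component hD hS _ us) hk _ mus => [v /= hv|nu _]; last by case: (hp nu).
  by rewrite -iterSr iterS hv (op0 hD).
apply: (mem_of_iter_shift hD S0 D0 (hp mu).1 mu0 (k := k)) => /=.
rewrite -[RHS]hk'; apply: eq_iter => v; by rewrite /shift scale0r subr0.
Qed.

Variable mul : E -> E -> E.
Hypotheses (mull : forall v, linear (mul^~ v)) (mulr : forall u, linear (mul u)).
Hypotheses (derD : forall u v, D (mul u v) = mul (D u) v + mul u (D v)).
Hypotheses (derB : forall u v, B (mul u v) = mul (B u) v + mul u (B v)).

Lemma gen_mul mu nu u v : gen D mu u -> gen D nu v -> gen D (mu + nu) (mul u v).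
Proof.
move=> [k hk] [l hl]; have [n] : exists n, (k + l <= n)%N by exists (k + l)%N.
have GS := gen_subspace hD (mu + nu).
elim: n k l u v hk hl => [|n IH] k l u v hk hl.
  rewrite leqn0 addn_eq0 => /andP[/eqP k0 _].
  by rewrite k0 /= in hk; rewrite hk (op0 (mull v)); case: GS.
have : shift D (mu + nu) (mul u v) = mul (shift D mu u) v + mul u (shift D nu v).
  rewrite /shift derD (opB (mull v)) (opB (mulr u)) (opZ (mull v)) (opZ (mulr u)).
  by rewrite scalerDl opprD addrACA.
case: k hk => [|k] hk; first by move: hk => /= -> _ _; rewrite (op0 (mull v)); case: GS.
case: l hl => [|l] hl; first by move: hl => /= -> _ _; rewrite (op0 (mulr u)); case: GS.
move=> es; rewrite addSn ltnS => kl.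
have [j hj] : gen D (mu + nu) (shift D (mu + nu) (mul u v)).
  rewrite es; apply: subspaceD => //.
    by apply: (IH k l.+1) => //; rewrite -iterSr.
  by apply: (IH k.+1 l) => //; [rewrite -iterSr | rewrite addSnnS].
by exists j.+1; rewrite iterSr.
Qed.

(** Eigenvalues add under products and conjugation is additive, so the condition passes from
    generators to an algebra on which both operators are derivations. *)
Lemma replicatedM u v : replicated u -> replicated v -> replicated (mul u v).
Proof.
move=> [s [h [us hp ->]]] [t [h' [ut hp' ->]]]; have RS := replicated_subspace.
rewrite (op_sum (mull _)); apply: subspace_sum => // mu _.
rewrite (op_sum (mulr _)); apply: subspace_sum => // nu _.
apply: (@replicated_pure (mu + nu)); have [gu bu] := hp mu; have [gv bv] := hp' nu.
split; first exact: gen_mul.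
by rewrite derB bu bv (opZ (mull _)) (opZ (mulr _)) rmorphD scalerDl.
Qed.

End ConjugateReplica.

End GeneralizedEigenvectors.

Section SubspaceToVspace.

Variables (K : fieldType) (W : vectType K).

Lemma subspace_vspace (S : set W) : S 0 -> (forall a u v, S u -> S v -> S (a *: u + v)) ->
  exists U : {vspace W}, forall x, S x <-> x \in U.
Proof.
move=> S0 SL.
have Sadd (U : {vspace W}) v : (forall x, x \in U -> S x) -> S v -> forall x,
  x \in (U + <[v]>)%VS -> S x.
  move=> hU Sv x /memv_addP[y yU [z /vlineP[a ->] ->]].
  by rewrite addrC; apply: SL => //; apply: hU.
pose Q (d : nat) := `[< exists2 U : {vspace W}, forall x, x \in U -> S x & \dim U = d >].
have Q0 : exists d, Q d.
  exists 0%N; apply/asboolP; exists 0%VS; last exact: dimv0.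
  by move=> x; rewrite memv0 => /eqP ->.
have Qb d : Q d -> (d <= \dim {:W})%N.
  by move=> /asboolP[U _ <-]; apply: dimvS; exact: subvf.
case: (ex_maxnP Q0 Qb) => d /asboolP[U hU dU] hmax.
exists U => x; split=> [Sx|]; last exact: hU.
apply: contrapT => /negP nx.
have : (\dim (U + <[x]>)%VS <= d)%N.
  by apply: hmax; apply/asboolP; exists (U + <[x]>)%VS => //; apply: Sadd.
rewrite -dU => hle; move/negP: nx; apply.
have : (U == U + <[x]>)%VS by rewrite eqEdim addvSl.
by move/eqP => ->; apply: (subvP (addvSr U <[x]>)); exact: memv_line.
Qed.

End SubspaceToVspace.

(** * Conjugate replicas of matrices and nilpotency by traces *)

Section Matrices.

Variable K : numClosedFieldType.

Definition rmul m (A : 'M[K]_m) (v : 'rV[K]_m) : 'rV[K]_m := v *m A.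

Lemma rmul_linear m (A : 'M[K]_m) : linear (rmul A).
Proof. by move=> a u v; rewrite /rmul mulmxDl -scalemxAl. Qed.

(** The labels [d] will be eigenvalues or, in [independent_points], scalar factors of evaluation
    vectors. *)
Lemma pick_basis m (Q : K -> 'rV[K]_m -> Prop) :
  (forall v, exists s : seq (K * 'rV[K]_m), (forall x, x \in s -> Q x.1 x.2) /\
     v = \sum_(x <- s) x.2) ->
  exists (P : 'M[K]_m) (d : 'I_m -> K), P \in unitmx /\ forall i, Q (d i) (row i P).
Proof.
move=> h; have [s hs] := choice h.
pose t := flatten [seq s (delta_mx 0 i) | i <- enum 'I_m].
have ht x : x \in t -> Q x.1 x.2.
  by move=> /flatten_mapP[i _ xi]; apply: (hs _).1 xi.
pose H : 'M_(size t, m) := \matrix_i (tnth (in_tuple t) i).2.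
have Hfull : row_full H.
  rewrite -sub1mx; apply/row_subP => i; rewrite rowE mulmx1 (hs (delta_mx 0 i)).2.
  rewrite big_seq; apply: summx_sub => x xi.
  have xt : x \in t by apply/flatten_mapP; exists i => //; rewrite mem_enum.
  have it : (index x t < size t)%N by rewrite index_mem.
  suff -> : x.2 = row (Ordinal it) H by exact: row_sub.
  by rewrite rowK (tnth_nth x) /= nth_index.
exists (rowsub (fullrankfun Hfull) H), (fun i => (tnth (in_tuple t) (fullrankfun Hfull i)).1).
split.
  by rewrite -row_full_unit; exact: fullrowsub_full.
move=> i; have -> : row i (rowsub (fullrankfun Hfull) H) =
    (tnth (in_tuple t) (fullrankfun Hfull i)).2.
  by rewrite row_rowsub rowK.
by apply: ht; apply: mem_tnth.
Qed.

Lemma row_decomposition m (X : 'M[K]_m) v :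
  exists (s : seq K) (h : K -> 'rV[K]_m), [/\ uniq s, forall mu, gen (rmul X) mu (h mu)
    & v = \sum_(mu <- s) h mu].
Proof.
case: m X v => [|m] X v.
  exists [::], (fun=> 0); split => // [mu|]; first by exists 0%N.
  by rewrite big_nil thinmx0.
have [r hr] := closed_field_poly_normal (char_poly X).
apply: (gen_decomposition (l := r) (rmul_linear X)).
have E (l : seq K) : foldr (shift (rmul X)) v l =
    v *m horner_mx X (\prod_(z <- l) ('X - z%:P)).
  elim: l => [|a l IH] /=; first by rewrite big_nil rmorph1 mulmx1.
  rewrite big_cons mulrC rmorphM IH rmorphB /= horner_mx_X horner_mx_C.
  by rewrite /shift /rmul mulmxA mulmxBr mul_mx_scalar.
rewrite E; move: (Cayley_Hamilton X); rewrite hr.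
by rewrite (monicP (char_poly_monic X)) scale1r => ->; rewrite mulmx0.
Qed.

Lemma unit_row_expand m (P : 'M[K]_m) (v : 'rV_m) : P \in unitmx ->
  v = \sum_i (v *m invmx P) 0 i *: row i P.
Proof. by move=> uP; rewrite -mulmx_sum_row mulmxKV. Qed.

(** [B] is diagonal, with conjugate eigenvalues, in a basis of generalized eigenvectors of [X]. *)
Lemma conj_replica m (X : 'M[K]_m) :
  exists B : 'M[K]_m, forall v, replicated (rmul X) (rmul B) v.
Proof.
have [|P [d [uP hP]]] := @pick_basis m (gen (rmul X)).
  move=> v; have [s [h [us hg ->]]] := row_decomposition X v.
  exists [seq (mu, h mu) | mu <- s]; rewrite big_map; split => //.
  by move=> _ /mapP[mu _ ->] /=.
pose B := invmx P *m diag_mx (\row_i (d i)^*) *m P; exists B => v.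
have RS := replicated_subspace (rmul_linear X) (rmul_linear B).
rewrite (unit_row_expand v uP); apply: subspace_sum => // i _.
apply: subspaceZ => //; apply: (replicated_pure (rmul_linear X) (rmul_linear B) (mu := d i)).
split; first exact: hP.
rewrite /rmul /B rowE !mulmxA mulmxK // -rowE row_diag_mx mxE -scalemxAl.
by rewrite -rowE.
Qed.

Definition mxnil m (A : 'M[K]_m) := exists k, forall v, iter k (rmul A) v = 0.

Lemma mxnil_rows m (P A : 'M[K]_m) : P \in unitmx ->
  (forall i, exists k, iter k (rmul A) (row i P) = 0) -> mxnil A.
Proof.
move=> uP /choice[k hk]; exists (\max_i k i) => v.
have lA j := iter_linear j (rmul_linear A).
rewrite (unit_row_expand v uP) (op_sum (lA _)) big1 // => i _.
rewrite (opZ (lA _)) -(subnK (leq_bigmax i)) iterD hk (op0 (lA _)) scaler0 //.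
Qed.

Lemma iter_rmul m (A : 'M[K]_m.+1) k v : iter k (rmul A) v = v *m A ^+ k.
Proof.
by elim: k => [|k IH]; rewrite ?mulmx1 //= IH exprSr mulmxA.
Qed.

Lemma mxnil_trace m (A : 'M[K]_m) : mxnil A -> \tr A = 0.
Proof.
case: m A => [|m] A [k hk]; first by rewrite /mxtrace big_ord0.
have [r hr] := closed_field_poly_normal (char_poly A).
rewrite (monicP (char_poly_monic A)) scale1r in hr.
have r0 z : z \in r -> z = 0.
  move=> zr; have : root (char_poly A) z by rewrite hr root_prod_XsubC.
  rewrite -eigenvalue_root_char => /eigenvalueP[v vA v0].
  have := hk v; have -> : iter k (rmul A) v = z ^+ k *: v.
    by elim: k {hk} => [|k IH]; rewrite ?scale1r //= IH /rmul -scalemxAl vA scalerA exprSr.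
  by move/eqP; rewrite scaler_eq0 (negbTE v0) orbF expf_eq0 => /andP[_ /eqP].
have : char_poly A = 'X^(size r).
  rewrite hr (eq_big_seq (fun=> 'X)) => [|z zr]; last by rewrite (r0 z zr) polyC0 subr0.
  by rewrite big_const_seq count_predT iter_mulr_1.
move=> cA; have := char_poly_trace A (ltn0Sn m).
have : size (char_poly A) = m.+2 by rewrite size_char_poly.
rewrite cA size_polyXn => -[->]; rewrite coefXn /= ltn_eqF // => h.
by apply: oppr_inj; rewrite -h oppr0.
Qed.

Section Replica.

Variables (m : nat) (A B : 'M[K]_m).
Hypothesis hAB : forall v, replicated (rmul A) (rmul B) v.
Let lA := rmul_linear A.
Let lB := rmul_linear B.

Lemma replicated_gen mu v : gen (rmul A) mu v -> pure (rmul A) (rmul B) mu v.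
Proof.
move=> gv; split => //; have [s [h [us hp ev]]] := hAB v.
have gS := gen_subspace lA mu.
have S0 : subspace [set u : 'rV[K]_m | u = 0] by split => // a x y -> ->; rewrite scaler0 addr0.
have D0 u : u = 0 -> rmul A u = 0 by move=> ->; exact: op0.
have hmu nu : nu \in s -> h nu = 0 \/ nu = mu.
  move=> nus; have [->|ne] := eqVneq nu mu; [by right | left].
  have [k hk] : gen (rmul A) mu (h nu).
    apply: (mem_component lA gS _ us) nus => [u [k hk]|la _|]; last by rewrite -ev.
      exists k; have l' := iter_linear k (shift_linear lA mu).
      have -> : rmul A u = shift (rmul A) mu u + mu *: u by rewrite subrK.
      by rewrite (opD l') (opZ l') hk scaler0 addr0 -iterSr iterS hk (op0 (shift_linear lA mu)).
    by case: (hp la).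
  exact: (mem_of_iter_shift lA S0 D0 (hp nu).1 ne hk).
rewrite {2}ev scaler_sumr ev (op_sum lB) !big_seq; apply: eq_bigr => nu nus.
by case: (hmu nu nus) => [->|->]; rewrite ?(op0 lB) ?scaler0 // (hp mu).2.
Qed.

(** [S] is the semisimple part of [A]. On each generalized eigenspace [B] is a scalar, so (A - S) B
    is nilpotent, and tr(A B) = tr(S B) is the sum of the squared moduli of the eigenvalues. If it
    vanishes, so does [S]. *)
Lemma replicated_trace : \tr (A *m B) = 0 -> mxnil A.
Proof.
have [|P [d [uP hP]]] := @pick_basis m (pure (rmul A) (rmul B)).
  move=> v; have [s [h [us hg ->]]] := hAB v.
  exists [seq (mu, h mu) | mu <- s]; rewrite big_map; split => //.
  by move=> _ /mapP[mu _ ->] /=.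
pose D := diag_mx (\row_i d i); pose D' := diag_mx (\row_i (d i)^*).
pose S := invmx P *m D *m P.
have hB : B = invmx P *m D' *m P.
  apply: (can_inj (mulKmx uP)); rewrite !mulmxA mulmxV // mul1mx.
  apply/row_matrixP => i; rewrite !row_mul row_diag_mx mxE -scalemxAl -rowE.
  exact: (hP i).2.
(* Conjugation is injective: an eigenvector of [B] for the conjugate of [d i] is an eigenvector of
   [S] for [d i]. *)
have hS i (v : 'rV_m) : pure (rmul A) (rmul B) (d i) v -> v *m S = d i *: v.
  move=> [_]; rewrite /rmul hB /S !mulmxA => e.
  pose c := v *m invmx P; have vE : v = c *m P by rewrite mulmxKV.
  have : c *m D' = (d i)^* *: c.
    by apply: (can_inj (mulmxK uP)); rewrite -/c in e *; rewrite e {1}vE scalemxAl.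
  move=> /rowP cD; rewrite -/c [in RHS]vE scalemxAl; congr (_ *m _).
  clearbody c; apply/rowP => j; have := cD j; rewrite !mul_mx_diag !mxE => /eqP.
  rewrite mulrC -subr_eq0 -mulrBl -rmorphB mulf_eq0 conjC_eq0 subr_eq0.
  by case/orP => /eqP ->; [rewrite mulrC | rewrite mul0r mulr0].
have genS i v : gen (rmul A) (d i) v -> rmul (A - S) v = shift (rmul A) (d i) v.
  by move=> gv; rewrite /rmul mulmxBr (hS i) //; exact: replicated_gen.
have itS i k v : gen (rmul A) (d i) v ->
    iter k (rmul (A - S)) v = iter k (shift (rmul A) (d i)) v.
  by elim: k v => // k IH v gv; rewrite !iterSr (genS i) // IH //; apply: gen_shift.
have itSB i k v : gen (rmul A) (d i) v -> iter k (rmul ((A - S) *m B)) v =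
    (d i)^* ^+ k *: iter k (shift (rmul A) (d i)) v.
  have ls j := iter_linear j (shift_linear lA (d i)).
  elim: k v => [|k IH] v gv; first by rewrite scale1r.
  have gv' : gen (rmul A) (d i) (shift (rmul A) (d i) v) by apply: gen_shift.
  have e : rmul ((A - S) *m B) v = (d i)^* *: shift (rmul A) (d i) v.
    rewrite -(genS i v gv) in gv' *; rewrite {1}/rmul mulmxA.
    exact: (replicated_gen gv').2.
  rewrite !iterSr e IH; last by apply: subspaceZ => //; apply: gen_subspace.
  by rewrite (opZ (ls k)) scalerA exprSr.
have nilS : mxnil (A - S).
  apply: (mxnil_rows uP) => i; have [[k hk] _] := hP i; exists k.
  by rewrite (itS i) //; exists k.
have nilSB : mxnil ((A - S) *m B).
  apply: (mxnil_rows uP) => i; have [[k hk] _] := hP i; exists k.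
  by rewrite (itSB i) ?hk ?scaler0 //; exists k.
have -> : A *m B = (A - S) *m B + S *m B by rewrite -mulmxDl subrK.
rewrite mxtraceD (mxnil_trace nilSB) add0r.
have -> : S *m B = invmx P *m (D *m D' *m P) by rewrite hB /S !mulmxA mulmxK.
rewrite mxtrace_mulC mulmxK // mulmx_diag mxtrace_diag => h0.
have d0 i : d i = 0.
  have : \sum_i `|d i| ^+ 2 = 0.
    by rewrite -[RHS]h0; apply: eq_bigr => j _; rewrite !mxE normCK.
  move/eqP; rewrite psumr_eq0 => [|j _]; last by rewrite exprn_ge0.
  by move=> /allP/(_ i (mem_index_enum _)); rewrite expf_eq0 normr_eq0 => /eqP.
suff S0 : S = 0 by move: nilS; rewrite S0 subr0.
have -> : S = invmx P *m 0 *m P by congr (_ *m _ *m _); apply/matrixP => i j;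
  rewrite !mxE d0 mul0rn.
by rewrite mulmx0 mul0mx.
Qed.

End Replica.

End Matrices.

(** * Casimir elements and Engel's theorem *)

Section TraceForm.

Variables (K : numClosedFieldType) (m : nat) (U : {vspace 'M[K]_m}).

Hypothesis nondeg : forall x, x \in U -> (forall y, y \in U -> \tr (x *m y) = 0) -> x = 0.

Let d := \dim U.
Let e : 'I_d -> 'M[K]_m := fun i => (vbasis U)`_i.
Let Q : 'M[K]_d := \matrix_(i, j) \tr (e i *m e j).

Let e_in i : e i \in U. Proof. by apply: vbasis_mem; apply: mem_nth; rewrite size_tuple. Qed.

Let Q_unit : Q \in unitmx.
Proof.
rewrite -row_free_unit -kermx_eq0; apply/eqP/row_matrixP => r; rewrite row0.
set v := row r _; have vQ : v *m Q = 0 by apply/sub_kermxP; exact: row_sub.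
clearbody v; pose x := \sum_i v 0 i *: e i.
have x0 : x = 0.
  apply: nondeg; first by apply: memv_suml => i _; apply: memvZ.
  move=> y yU; rewrite (coord_vbasis yU) mulmx_sumr raddf_sum big1 //= => j _.
  rewrite -scalemxAr mxtraceZ mulmx_suml raddf_sum /=.
  have /rowP/(_ j) := vQ; rewrite !mxE => h.
  rewrite (eq_bigr (fun i => v 0 i * Q i j)) ?h ?mulr0 // => i _.
  by rewrite -scalemxAl mxtraceZ mxE.
apply/rowP => i; rewrite mxE.
have /freeP fr := basis_free (vbasisP U).
exact: (fr (fun i => v 0 i) x0 i).
Qed.

Lemma trace_dual_basis : exists d (e f : 'I_d -> 'M[K]_m),
  [/\ forall i, e i \in U /\ f i \in U,
      forall x, x \in U -> x = \sum_i \tr (x *m f i) *: e i,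
      forall x, x \in U -> x = \sum_i \tr (x *m e i) *: f i
    & forall i j, \tr (e i *m f j) = (i == j)%:R].
Proof.
pose f j := \sum_k (invmx Q) k j *: e k.
have ef i j : \tr (e i *m f j) = (i == j)%:R.
  rewrite mulmx_sumr raddf_sum /=; have /matrixP/(_ i j) := mulmxV Q_unit.
  rewrite !mxE => <-; apply: eq_bigr => k _.
  by rewrite -scalemxAr mxtraceZ mxE mulrC.
have fU i : f i \in U by apply: memv_suml => k _; apply: memvZ.
have eE x : x \in U -> x = \sum_i \tr (x *m f i) *: e i.
  move=> xU; rewrite {1}(coord_vbasis xU); apply: eq_bigr => j _; congr (_ *: _).
  rewrite {2}(coord_vbasis xU) mulmx_suml raddf_sum /= (bigD1 j) //= big1 => [|i ij].
    by rewrite -scalemxAl mxtraceZ ef eqxx mulr1 addr0.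
  by rewrite -scalemxAl mxtraceZ ef (negbTE ij) mulr0.
exists d, e, f; split => // x xU.
apply/eqP; rewrite -subr_eq0; apply/eqP/nondeg.
  by apply: memvB => //; apply: memv_suml => i _; apply: memvZ.
move=> w wU; rewrite (eE w wU) mulmx_sumr raddf_sum big1 //= => j _.
rewrite -scalemxAr mxtraceZ mulmxBl (raddfB (@mxtrace K m)) mulmx_suml (raddf_sum (@mxtrace K m))
  /=.
rewrite (bigD1 j) //= big1 => [|i ij].
  by rewrite -scalemxAl mxtraceZ (mxtrace_mulC (f j)) ef eqxx mulr1 addr0 subrr mulr0.
by rewrite -scalemxAl mxtraceZ (mxtrace_mulC (f i)) ef eq_sym (negbTE ij) mulr0.
Qed.

(* The Casimir element of the trace form on [U]. *)
Lemma casimir : exists d (e : 'M[K]_m) , [/\ \tr e = d%:R,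
    exists (x y : 'I_d -> 'M[K]_m), (forall i, x i \in U /\ y i \in U) /\ e = \sum_i x i *m y i,
    d = 0%N -> U = 0%VS
  & forall g h, g *m h = 1%:M -> h *m g = 1%:M ->
      (forall x, x \in U -> g *m x *m h \in U) -> g *m e = e *m g].
Proof.
have [n [x [y [xyU xE yE xy]]]] := trace_dual_basis.
exists n, (\sum_i x i *m y i); split.
- rewrite raddf_sum (eq_bigr (fun=> 1)) /= => [|i _]; last by rewrite xy eqxx.
  by rewrite sumr_const card_ord.
- by exists x, y.
- move=> n0; apply/eqP; rewrite -subv0; apply/subvP => z /xE ->.
  by rewrite big1 ?mem0v // => -[i hi]; exfalso; rewrite n0 in hi.
move=> g h gh hg gU.
pose c z := g *m z *m h.
have cM z w : c z *m c w = c (z *m w).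
  by rewrite /c !mulmxA -[_ *m h *m g]mulmxA hg mulmx1.
have trc z : \tr (c z) = \tr z by rewrite /c -mulmxA mxtrace_mulC -mulmxA hg mulmx1.
have cU z : z \in U -> c z \in U by apply: gU.
(* [a] and [b] describe conjugation by [g] on dual bases; invariance of the trace form makes b^T
   inverse to [a], which cancels in the Casimir sum. *)
pose a := \matrix_(i, j) \tr (c (x i) *m y j).
pose b := \matrix_(i, j) \tr (c (y i) *m x j).
have cx i : c (x i) = \sum_j a i j *: x j.
  rewrite {1}(xE (c (x i))); last by apply: cU; case: (xyU i).
  by apply: eq_bigr => j _; rewrite mxE.
have cy i : c (y i) = \sum_j b i j *: y j.
  rewrite {1}(yE (c (y i))); last by apply: cU; case: (xyU i).
  by apply: eq_bigr => j _; rewrite mxE.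
have abT : a *m b^T = 1%:M.
  apply/matrixP => i k; rewrite !mxE -xy -trc -cM cy mulmx_sumr raddf_sum /=.
  by apply: eq_bigr => j _; rewrite -scalemxAr mxtraceZ !mxE mulrC.
have baT : b^T *m a = 1%:M by apply: mulmx1C.
have ce : c (\sum_i x i *m y i) = \sum_i x i *m y i.
  have -> : c (\sum_i x i *m y i) = \sum_i \sum_j \sum_k (a i j * b i k) *: (x j *m y k).
    rewrite /c mulmx_sumr mulmx_suml; apply: eq_bigr => i _; rewrite -/(c _) -cM cx cy.
    rewrite mulmx_suml; apply: eq_bigr => j _; rewrite mulmx_sumr; apply: eq_bigr => k _.
    by rewrite -scalemxAl -scalemxAr scalerA.
  rewrite exchange_big /=; apply: eq_bigr => j _; rewrite exchange_big /=.
  rewrite (bigD1 j) //= [X in _ + X]big1 => [|k kj]; rewrite -scaler_suml.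
    have /matrixP/(_ j j) := baT; rewrite !mxE eqxx => e1.
    rewrite (_ : \sum_i _ = 1) ?scale1r ?addr0 // -[RHS]e1.
    by apply: eq_bigr => i _; rewrite [b^T _ _]mxE mulrC.
  have /matrixP/(_ k j) := baT; rewrite !mxE (negbTE kj) => e1.
  rewrite (_ : \sum_i _ = 0) ?scale0r // -[RHS]e1.
  by apply: eq_bigr => i _; rewrite [b^T _ _]mxE mulrC.
by rewrite -{2}ce /c -!mulmxA hg mulmx1.
Qed.

End TraceForm.

(** * Engel's theorem for Lie algebras of nilpotent matrices *)

Section Engel.

Variables (K : numClosedFieldType) (m : nat).
Implicit Types (N M : set 'M[K]_m) (A : set 'rV[K]_m).

Definition bracket_closed N : Prop := forall X Y, N X -> N Y -> N (X *m Y - Y *m X).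

Fixpoint engel_chain N (i : nat) : set 'rV[K]_m :=
  if i is j.+1 then [set v | forall Y, N Y -> engel_chain N j (v *m Y)]
  else [set v | v = 0].

Lemma engel_chain_subspace N i : subspace (engel_chain N i).
Proof.
elim: i => [|i [A0 AL]] /=; first by split => // a u v -> ->; rewrite scaler0 addr0.
split=> [Y _|a u v hu hv Y NY]; first by rewrite mul0mx.
by rewrite mulmxDl -scalemxAl; apply: AL; [apply: hu | apply: hv].
Qed.

Lemma engel_chain_stable N i v Y : N Y -> engel_chain N i v -> engel_chain N i.-1 (v *m Y).
Proof. by move=> NY; case: i => [/= ->|i /= h]; [rewrite mul0mx | apply: h]. Qed.

Lemma engel_chain_leS N i : engel_chain N i `<=` engel_chain N i.+1.
Proof.
elim: i => [|i IH] v /=; first by move=> -> Y _; rewrite mul0mx.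
by move=> h Y NY; apply: IH; apply: h.
Qed.

(** A common null vector in the quotient of A' by A, phrased without the quotient. *)
Definition strictly_lowering M : Prop := forall A A' : set 'rV[K]_m,
  subspace A -> subspace A' -> A `<=` A' -> ~ (A' `<=` A) ->
  (forall Y v, M Y -> A v -> A (v *m Y)) -> (forall Y v, M Y -> A' v -> A' (v *m Y)) ->
  exists v, [/\ A' v, ~ A v & forall Y, M Y -> A (v *m Y)].

(** A term of largest dimension equals the next one; if it were proper, a vector outside it that [M]
    sends into it would belong to the next term. *)
Lemma strictly_lowering_chain M : strictly_lowering M ->
  exists L, forall v, engel_chain M L v.
Proof.
move=> hM.
have [U hU] := choice (fun i => subspace_vspace (engel_chain_subspace M i).1
  (engel_chain_subspace M i).2).
have Ub i : (\dim (U i) <= \dim {:'rV[K]_m})%N by apply: dimvS; exact: subvf.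
pose Q d := `[< exists i, \dim (U i) = d >].
have Q0 : exists d, Q d by exists (\dim (U 0%N)); apply/asboolP; exists 0%N.
have Qb d : Q d -> (d <= \dim {:'rV[K]_m})%N by move=> /asboolP[i <-].
case: (ex_maxnP Q0 Qb) => d /asboolP[L dL] hmax.
exists L => v; apply: contrapT => nv.
have [||||||w [_ nw hw]] := hM (engel_chain M L) setT.
- exact: engel_chain_subspace.
- by split.
- by [].
- by move=> /(_ v I).
- move=> Y u MY hu; case: L dL {nv} hu => [|L] dL hu; first by move: hu => /= ->; rewrite mul0mx.
  by apply: engel_chain_leS; apply: (engel_chain_stable (i := L.+1)).
- by [].
have : (U L <= U L.+1)%VS.
  by apply/subvP => u /hU hu; apply/hU/engel_chain_leS.
move=> hs; have : (U L == U L.+1)%VS.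
  by rewrite eqEdim hs dL hmax //; apply/asboolP; exists L.+1.
move=> /eqP e; apply: nw; apply/hU; rewrite e; apply/hU => Y MY; exact: hw.
Qed.

(** [M] is a strictly lowering subalgebra of largest dimension inside [N]; if it were smaller than
    [N], an element of [N] outside it that normalizes it could be adjoined. *)
Lemma engel N : N 0 -> (forall a X Y, N X -> N Y -> N (a *: X + Y)) ->
  bracket_closed N -> (forall X, N X -> mxnil X) ->
  exists L, forall v, engel_chain N L v.
Proof.
move=> N0 NL NB Nnil; apply: strictly_lowering_chain.
have [U hU] := subspace_vspace N0 NL.
pose good (M : {vspace 'M[K]_m}) := [/\ forall X, X \in M -> N X,
  bracket_closed [set X | X \in M] & strictly_lowering [set X | X \in M]].
pose Q d := `[< exists2 M, good M & \dim M = d >].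
have Q0 : exists d, Q d.
  exists 0%N; apply/asboolP; exists 0%VS; last exact: dimv0.
  split; first by move=> X; rewrite memv0 => /eqP ->.
    by move=> X Y; rewrite /= !memv0 => /eqP -> /eqP ->; rewrite mul0mx subrr.
  move=> A A' hA hA' AA' nA'A _ _.
  have [v A'v nAv] : exists2 v, A' v & ~ A v.
    by apply: contrapT => H; apply: nA'A => v A'v; apply: contrapT => nAv; apply: H; exists v.
  exists v; split => // Y; rewrite /= memv0 => /eqP ->.
  by rewrite mulmx0; case: hA.
have Qb d : Q d -> (d <= \dim {:'M[K]_m})%N by move=> /asboolP[M _ <-]; apply: dimvS; exact: subvf.
case: (ex_maxnP Q0 Qb) => d /asboolP[M [MN MB MS] dM] hmax.
have [NM|nNM] := pselect (forall X, N X -> X \in M).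
  move=> A A' hA hA' AA' nA'A sA sA'.
  have [||v [? ? hv]] := MS A A' hA hA' AA' nA'A.
  - by move=> Y v /MN; apply: sA.
  - by move=> Y v /MN; apply: sA'.
  by exists v; split => // Y /NM; apply: hv.
exfalso.
have [L hL] := strictly_lowering_chain MS.
pose C := engel_chain [set X | X \in M].
(* Otherwise iterated brackets with [M] never enter [M], although they
   eventually vanish. *)
have [X [NX nMX MX]] : exists X, [/\ N X, X \notin M & forall Y, Y \in M -> Y *m X - X *m Y \in M].
  apply: contrapT => H.
  have step X : N X /\ X \notin M -> exists X', (N X' /\ X' \notin M) /\
      exists2 Y, Y \in M & X' = Y *m X - X *m Y.
    move=> [NX nMX]; apply: contrapT => H'; apply: H; exists X; split => // Y YM.
    apply: contrapT => /negP nm; apply: H'; exists (Y *m X - X *m Y); split; last by exists Y.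
    by split => //; apply: NB => //; apply: MN.
  have [X0 [NX0 nMX0]] : exists X, N X /\ X \notin M.
    by apply: contrapT => H'; apply: nNM => X NX; apply: contrapT => /negP nm; apply: H'; exists X.
  (* Each bracket with [M] costs one step of the chain. After 2 L brackets the whole space, which is
     the term L, is sent to the term 0, so the matrix is zero and lies in [M] after all. *)
  suff key j : exists X, (N X /\ X \notin M) /\ forall i v, C i v -> C (L + i - j)%N (v *m X).
    have [X [[NX nMX] hX]] := key (L + L)%N.
    move: nMX; have -> : X = 0; last by rewrite mem0v.
    apply/row_matrixP => r; rewrite row0 rowE.
    by have := hX L (delta_mx 0 r) (hL _); rewrite subnn.
  elim: j => [|j [X [hX CX]]].
    exists X0; split => // i v _; rewrite subn0.
    elim: i => [|i IH]; first by rewrite addn0; exact: hL.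
    by rewrite addnS; apply: engel_chain_leS.
  have [X' [hX' [Y YM eX']]] := step X hX; exists X'; split => // i v Cv.
  case: i Cv => [|i] Cv.
    move: Cv => /= ->; rewrite mul0mx; exact: (engel_chain_subspace _ _).1.
  rewrite eX' mulmxBr !mulmxA; apply: (subspaceB (engel_chain_subspace _ _)).
    have := CX i (v *m Y) (engel_chain_stable (i := i.+1) YM Cv).
    by rewrite addnS subSS.
  have := engel_chain_stable YM (CX i.+1 v Cv).
  by rewrite subnS.
have : (\dim (M + <[X]>)%VS <= d)%N.
  apply: hmax; apply/asboolP; exists (M + <[X]>)%VS => //; split.
  - move=> Z /memv_addP[Y YM [T /vlineP[a ->] ->]].
    by rewrite addrC; apply: NL => //; apply: MN.
  - move=> Z Z' /= /memv_addP[Y YM [_ /vlineP[a ->] ->]] /memv_addP[Y' YM' [_ /vlineP[a' ->] ->]].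
    have -> : (Y + a *: X) *m (Y' + a' *: X) - (Y' + a' *: X) *m (Y + a *: X) =
        (Y *m Y' - Y' *m Y) + (a' *: (Y *m X - X *m Y) - a *: (Y' *m X - X *m Y')).
      rewrite !(mulmxDl, mulmxDr) -!(scalemxAl, scalemxAr) !scalerBr !scalerA [a * a']mulrC.
      set p := Y *m Y'; set q := Y' *m Y; set r := _ *: (Y *m X); set s := _ *: (X *m Y).
      set t := _ *: (Y' *m X); set u := _ *: (X *m Y'); set w := _ *: (X *m X).
      by apply/matrixP => i j; rewrite !mxE; ring.
    by apply: (subvP (addvSl M _)); apply: memvD; [apply: MB | apply: memvB; apply: memvZ;
      apply: MX].
  - move=> A A' hA hA' AA' nA'A sA sA'.
    have MMX Y : Y \in M -> Y \in (M + <[X]>)%VS by apply/subvP/addvSl.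
    have XMX : X \in (M + <[X]>)%VS by apply: (subvP (addvSr M _)); exact: memv_line.
    (* This set is stable under [X] because [X] normalizes [M]. As [X] is nilpotent, the iterates of
       [v0] finally enter [A]; the one just before is sent into [A] by both [M] and [X]. *)
    pose C' : set 'rV_m := [set v | A' v /\ forall Y, Y \in M -> A (v *m Y)].
    have [||v0 [A'v0 nAv0 hv0]] := MS A A' hA hA' AA' nA'A.
    - by move=> Y v /MMX; apply: sA.
    - by move=> Y v /MMX; apply: sA'.
    have C'X v : C' v -> C' (v *m X).
      move=> [A'v hv]; split; first exact: sA'.
      move=> Y YM; have -> : v *m X *m Y = v *m Y *m X - v *m (Y *m X - X *m Y).
        by rewrite mulmxBr !mulmxA opprB addrC subrK.
      by apply: subspaceB => //; [apply: sA => //; apply: hv | apply: hv; apply: MX].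
    have [k hk] := Nnil X NX.
    have [j [nj hj]] : exists j, ~ A (iter j (rmul X) v0) /\ A (iter j.+1 (rmul X) v0).
      apply: contrapT => H.
      have : forall j, ~ A (iter j (rmul X) v0).
        by elim => [|j IH] // h; apply: H; exists j.
      by move=> /(_ k); rewrite hk; apply; case: hA.
    have C'j : C' (iter j (rmul X) v0) by elim: j {nj hj} => //= j IH; apply: C'X.
    exists (iter j (rmul X) v0); split => //; first by case: C'j.
    move=> Z /= /memv_addP[Y YM [_ /vlineP[a ->] ->]].
    rewrite mulmxDr -scalemxAr; apply: subspaceD => //; first by apply: C'j.2.
    by apply: subspaceZ.
rewrite -dM => hle.
have : (M == M + <[X]>)%VS by rewrite eqEdim addvSl.
move=> /eqP e; move/negP: nMX; apply; rewrite e.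
by apply: (subvP (addvSr M _)); exact: memv_line.
Qed.

End Engel.

(** * Derivations and Lie algebras of matrix groups *)

Section Derivative.

Variable K : numClosedFieldType.

(** The linear coefficient of a one-variable polynomial function; 0 is a default for all other
    functions. *)
Definition deriv0 (f : K -> K) : K := (xget 0 [set q : {poly K} | f = horner q])`_1.

Lemma deriv0E f (q : {poly K}) : f = horner q -> deriv0 f = q`_1.
Proof.
move=> hq; rewrite /deriv0; case: xgetP => [p _ hp|/(_ q)//].
have -> // : p = q by apply: horner_eq_inj => t; rewrite -hq [f]hp.
Qed.

Lemma deriv0_ext f g : f =1 g -> deriv0 f = deriv0 g.
Proof. by move=> /funext ->. Qed.

Section Directional.

Variable W : vectType K.
Implicit Types (A B : W -> W) (f g p q : W -> K).

(** The derivative of [f] along the vector field [A]: a constant field gives the differential in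
    [taylor2], the field y |-> X y the action of a Lie algebra element. *)
Definition dirD A f : W -> K := fun y => deriv0 (fun t => f (y + t *: A y)).

Lemma dirD_cst A c : dirD A (fun=> c) = 0.
Proof.
apply/funext => y; rewrite /dirD (deriv0E (q := c%:P)) ?coefC //.
by apply/funext => t; rewrite hornerC.
Qed.

Lemma dirD0 A : dirD A 0 = 0.
Proof. exact: dirD_cst. Qed.

Lemma dirD_lform A l : lform l -> dirD A l = l \o A.
Proof.
move=> hl; apply/funext => y; rewrite /dirD (deriv0E (q := (l y)%:P + (l (A y)) *: 'X)).
  by rewrite coefD coefC coefZ coefX mulr1 add0r.
apply/funext => t; rewrite !hornerE lformD // lformZ // mulrC.
by [].
Qed.

Lemma dirDD A p q : polyfun p -> polyfun q -> dirD A (p + q) = dirD A p + dirD A q.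
Proof.
move=> hp hq; apply/funext => y; rewrite !addrfctE /dirD.
have [P hP] := polyfun_line y (A y) hp; have [Q hQ] := polyfun_line y (A y) hq.
rewrite (deriv0E (funext hP)) (deriv0E (funext hQ)) -coefD; apply: deriv0E.
by apply/funext => t; rewrite hornerD -hP -hQ.
Qed.

Lemma dirDM A p q : polyfun p -> polyfun q -> dirD A (p * q) = dirD A p * q + p * dirD A q.
Proof.
move=> hp hq; apply/funext => y; rewrite addrfctE !mulrfctE /dirD.
have [P hP] := polyfun_line y (A y) hp; have [Q hQ] := polyfun_line y (A y) hq.
rewrite (deriv0E (funext hP)) (deriv0E (funext hQ)) (deriv0E (q := P * Q)); last first.
  by apply/funext => t; rewrite hornerM -hP -hQ.
have := hP 0; have := hQ 0; rewrite !scale0r !addr0 !horner_coef0 => -> ->.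
by rewrite coefM !big_ord_recl big_ord0 /= addr0 addrC.
Qed.

Lemma dirD_polyfun A p : linear A -> polyfun p -> polyfun (dirD A p).
Proof.
move=> hA; move: p; apply: polyfun_ind => [c|l hl|p q hp hq hDp hDq|p q hp hq hDp hDq].
- by rewrite dirD_cst; exact: polyfun0.
- by rewrite dirD_lform //; apply: polyfun_lform; apply: lform_comp.
- by rewrite dirDD //; apply: polyfunD.
- by rewrite dirDM //; apply: polyfunD; apply: polyfunM.
Qed.

Lemma dirD_linear A a p q : polyfun p -> polyfun q ->
  dirD A (cst a * p + q) = cst a * dirD A p + dirD A q.
Proof.
move=> hp hq; rewrite dirDD //; last exact: polyfunM (polyfun_cst _ a) hp.
by rewrite (dirDM _ (polyfun_cst _ a) hp) dirD_cst mul0r add0r.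
Qed.

Lemma dirDB A p q : polyfun p -> polyfun q -> dirD A (p - q) = dirD A p - dirD A q.
Proof.
move=> hp hq; have := dirD_linear A (-1) hq hp.
by rewrite !mulN1r [- q + p]addrC [- _ + _ in RHS]addrC.
Qed.

Lemma dirD_sum A (I : Type) (r : seq I) (F : I -> W -> K) :
  (forall i, polyfun (F i)) -> dirD A (\sum_(i <- r) F i) = \sum_(i <- r) dirD A (F i).
Proof.
move=> hF; elim: r => [|i r IH]; first by rewrite !big_nil; exact: dirD_cst.
rewrite !big_cons dirDD ?IH //; by apply: polyfun_sum.
Qed.

Lemma derivation_ext (D D' : (W -> K) -> W -> K) p :
  (forall c, D (fun=> c) = D' (fun=> c)) -> (forall l, lform l -> D l = D' l) ->
  (forall p q, polyfun p -> polyfun q -> D (p + q) = D p + D q) ->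
  (forall p q, polyfun p -> polyfun q -> D' (p + q) = D' p + D' q) ->
  (forall p q, polyfun p -> polyfun q -> D (p * q) = D p * q + p * D q) ->
  (forall p q, polyfun p -> polyfun q -> D' (p * q) = D' p * q + p * D' q) ->
  polyfun p -> D p = D' p.
Proof.
move=> hc hl hD hD' hM hM'; move: p; apply: polyfun_ind => //.
  by move=> p q hp hq e e'; rewrite hD // hD' // e e'.
by move=> p q hp hq e e'; rewrite hM // hM' // e e'.
Qed.

Lemma dirD_linear_field A B a p : linear A -> linear B -> polyfun p ->
  dirD (fun y => a *: A y + B y) p = cst a * dirD A p + dirD B p.
Proof.
move=> hA hB; apply: (derivation_ext (D' := fun p => cst a * dirD A p + dirD B p)).
- by move=> c; rewrite !dirD_cst mulr0 addr0.
- move=> l hl; rewrite !dirD_lform //; apply/funext => y /=.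
  by rewrite hl.
- by move=> *; rewrite dirDD.
- by move=> f g hf hg; rewrite !dirDD // mulrDr addrACA.
- by move=> *; rewrite dirDM.
- by move=> f g hf hg; rewrite !dirDM //; ring.
Qed.

Lemma dirD_bracket A B p : linear A -> linear B -> polyfun p ->
  dirD A (dirD B p) - dirD B (dirD A p) = dirD (fun y => B (A y) - A (B y)) p.
Proof.
move=> hA hB; apply: (derivation_ext (D := fun p => dirD A (dirD B p) - dirD B (dirD A p))).
- by move=> c; rewrite !dirD_cst ?dirD0 subrr.
- move=> l hl; rewrite !dirD_lform //; [|exact: lform_comp..].
  by apply/funext => y /=; rewrite lformB.
- move=> f g hf hg; have [? ? ? ?] := And4 (dirD_polyfun hA hf) (dirD_polyfun hA hg)
    (dirD_polyfun hB hf) (dirD_polyfun hB hg).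
  by rewrite !dirDD //; ring.
- by move=> *; rewrite dirDD.
- move=> f g hf hg; have [? ? ? ?] := And4 (dirD_polyfun hA hf) (dirD_polyfun hA hg)
    (dirD_polyfun hB hf) (dirD_polyfun hB hg).
  by rewrite !dirDM // !dirDD ?dirDM //; [ring|exact: polyfunM..].
- by move=> *; rewrite dirDM.
Qed.

(* Chain rule along an integral curve of the vector field [A]. *)
Lemma dirD_curve A (c : K -> W) p : linear A -> polycurve c ->
  (forall l, lform l -> forall q : {poly K}, l \o c = horner q -> l \o A \o c = horner q^`()) ->
  polyfun p -> exists2 q : {poly K}, p \o c = horner q & dirD A p \o c = horner q^`().
Proof.
move=> hA hc hd; move: p; apply: polyfun_ind => [a|l hl|p q hp hq [P eP dP] [Q eQ dQ]|p q hp hq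
  [P eP dP] [Q eQ dQ]].
- exists a%:P; first by apply/funext => t; rewrite hornerC.
  by rewrite dirD_cst; apply/funext => t; rewrite derivC horner0.
- have [q hq] := hc l hl; exists q => //.
  by rewrite dirD_lform //; exact: hd.
- exists (P + Q); first by apply/funext => t; rewrite hornerD -eP -eQ.
  by rewrite dirDD //; apply/funext => t; rewrite derivD hornerD -dP -dQ.
- exists (P * Q); first by apply/funext => t; rewrite hornerM -eP -eQ.
  by rewrite dirDM //; apply/funext => t; rewrite derivM hornerD !hornerM -dP -dQ -eP -eQ.
Qed.

End Directional.

Lemma dirD_comp (W W' : vectType K) (A : W -> W) (A' : W' -> W') (g : W -> W') (f : W' -> K) :
  linear g -> (forall y, g (A y) = A' (g y)) -> dirD A (f \o g) = dirD A' f \o g.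
Proof.
move=> hg hA; apply/funext => y; rewrite /dirD /=; apply: deriv0_ext => t.
by rewrite addrC hg hA addrC.
Qed.

(** * The module of polynomial functions and replicas acting on it *)

Section PolyfunType.

Variable W : vectType K.

Definition pf_pred : {pred W -> K^o} := fun f => `[< polyfun f >].

Fact pf_submod_closed : submod_closed pf_pred.
Proof.
split; first by apply/asboolP; exact: polyfun0.
move=> a f g /asboolP hf /asboolP hg; apply/asboolP.
by apply: polyfunD => //; exact: polyfunM (polyfun_cst _ a) hf.
Qed.

HB.instance Definition _ := GRing.isSubmodClosed.Build K (W -> K^o) pf_pred pf_submod_closed.

Record pf := Pf { pf_val :> W -> K^o; _ : pf_val \in pf_pred }.

HB.instance Definition _ := [isSub for pf_val].
HB.instance Definition _ := [Choice of pf by <:].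
HB.instance Definition _ := [SubChoice_isSubLmodule of pf by <:].

Lemma pf_polyfun (u : pf) : polyfun u.
Proof. by case: u => f /= /asboolP. Qed.

Definition mkpf (f : W -> K) (hf : polyfun f) : pf := Pf (asboolT hf).

End PolyfunType.

End Derivative.

Section ReplicatedMaps.

Variables (K : numClosedFieldType) (E E' : lmodType K).
Variables (D B : E -> E) (D' B' : E' -> E') (T : E -> E').
Hypotheses (hD : linear D) (hB : linear B) (hD' : linear D') (hB' : linear B').
Hypotheses (hT : linear T) (TD : forall u, T (D u) = D' (T u)) (TB : forall u, T (B u) = B' (T u)).

Let T_iter k mu u : T (iter k (shift D mu) u) = iter k (shift D' mu) (T u).
Proof. by elim: k => //= k IH; rewrite /shift (opB hT) (opZ hT) TD IH. Qed.

Lemma replicated_map u : replicated D B u -> replicated D' B' (T u).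
Proof.
move=> [s [h [us hp ->]]]; rewrite (op_sum hT); apply: subspace_sum => [|mu _].
  exact: replicated_subspace.
apply: (replicated_pure hD' hB' (mu := mu)); have [[k hk] bk] := hp mu; split.
  by exists k; rewrite -T_iter hk (op0 hT).
by rewrite -TB bk (opZ hT).
Qed.

(** The image of [T] is stable under D', so it contains the components of [T u], and these are
    pulled back one by one. *)
Lemma replicated_pull u : injective T -> replicated D' B' (T u) -> replicated D B u.
Proof.
move=> Tinj [s [h [us hp eu]]].
have hS : subspace (range T).
  split; first by exists 0 => //; exact: op0.
  by move=> a _ _ [x _ <-] [y _ <-]; exists (a *: x + y) => //; exact: hT.
have SD v : range T v -> range T (D' v) by move=> [x _ <-]; exists (D x).
have Sh mu : mu \in s -> range T (h mu).
  apply: (mem_component hD' hS SD us) => [nu _|]; first by case: (hp nu).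
  by exists u.
have hex mu : exists x, mu \in s -> T x = h mu.
  by have [/Sh[x _ <-]|nmu] := boolP (mu \in s); [exists x | exists 0].
have [h' hh'] := choice hex.
have -> : u = \sum_(mu <- s) h' mu.
  by apply: Tinj; rewrite (op_sum hT) eu; apply: eq_big_seq => mu /hh'.
rewrite big_seq; apply: subspace_sum => [|mu mus]; first exact: replicated_subspace.
apply: (replicated_pure hD hB (mu := mu)); have [[k hk] bk] := hp mu; split.
  by exists k; apply: Tinj; rewrite T_iter (op0 hT) hh' // hk.
by apply: Tinj; rewrite TB (opZ hT) hh' // bk.
Qed.

End ReplicatedMaps.

Section PolyfunReplica.

Variables (K : numClosedFieldType) (m k : nat).
Local Notation W := 'M[K]_(m, k).

Lemma mulmx_linear (X : 'M[K]_m) : linear (mulmx X : W -> W).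
Proof. by move=> a u v; rewrite mulmxDr -scalemxAr. Qed.

Definition pfD (X : 'M[K]_m) (u : pf W) : pf W :=
  mkpf (dirD_polyfun (mulmx_linear X) (pf_polyfun u)).

Lemma pf_ext (u v : pf W) : (u : W -> K) = v -> u = v.
Proof. by move=> h; apply: val_inj. Qed.

Lemma pfD_linear X : linear (pfD X).
Proof. by move=> a u v; apply: pf_ext; apply: dirD_linear; exact: pf_polyfun. Qed.

Definition pfM (u v : pf W) : pf W := mkpf (polyfunM (pf_polyfun u) (pf_polyfun v)).

(** Only linear forms need an argument: both operators are derivations, so [replicatedM] handles
    products. *)
Lemma pf_replicated (X B : 'M[K]_m) :
  (forall v, replicated (rmul X) (rmul B) v) ->
  forall u : pf W, replicated (pfD X) (pfD B) u.
Proof.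
move=> hXB u; have lX := pfD_linear X; have lB := pfD_linear B.
have RS := replicated_subspace lX lB.
suff H : forall f : W -> K, polyfun f -> forall u : pf W, (u : W -> K) = f ->
    replicated (pfD X) (pfD B) u by apply: (H u) => //; exact: pf_polyfun.
apply: polyfun_ind => [c|l hl|p q hp hq Hp Hq|p q hp hq Hp Hq] {}u eu.
- apply: (replicated_pure lX lB (mu := 0)); split.
    exists 1%N; apply: pf_ext; rewrite /= /shift scale0r subr0 /= eu; exact: dirD_cst.
  rewrite conjC0 scale0r; apply: pf_ext; rewrite /= eu; exact: dirD_cst.
(* The space of linear forms is a sum of copies of the row space; [T j] embeds the copy that reads
   column [j]. *)
- have pT j (v : 'rV[K]_m) : polyfun (fun y : W => (v *m y) 0 j).
    apply: polyfun_lform => a x y; by rewrite mulmxDr -scalemxAr !mxE.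
  pose T j v := mkpf (pT j v).
  have lT j : linear (T j).
    by move=> a v w; apply: pf_ext; apply/funext => y /=;
      rewrite mulmxDl -scalemxAl [LHS]mxE [X in X + _]mxE.
  have TX j Y v : T j (rmul Y v) = pfD Y (T j v).
    apply: pf_ext; rewrite /= dirD_lform //; last by move=> a x y; rewrite mulmxDr -scalemxAr !mxE.
    by apply/funext => y /=; rewrite mulmxA.
  have -> : u = \sum_j T j (\row_i l (delta_mx i j)).
    apply: pf_ext; rewrite eu; apply/funext => y; rewrite lform_mxE //.
    have -> : pf_val (\sum_j T j (\row_i l (delta_mx i j))) y =
        \sum_j (pf_val (T j (\row_i l (delta_mx i j))) y).
      by elim/big_rec2: _ => //= j a b _ <-.
    rewrite exchange_big /=; apply: eq_bigr => j _; rewrite mxE.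
    by apply: eq_bigr => i _; rewrite mxE mulrC.
  apply: subspace_sum => // j _.
  apply: (replicated_map (D := rmul X) (B := rmul B) lX lB (lT j) (TX j X) (TX j B)).
  exact: hXB.
- have -> : u = mkpf hp + mkpf hq by apply: pf_ext.
  by apply: subspaceD => //; [apply: Hp | apply: Hq].
- have -> : u = pfM (mkpf hp) (mkpf hq) by apply: pf_ext.
  apply: (replicatedM lX lB (mul := pfM)).
  + move=> v a x y; apply: pf_ext; apply/funext => z.
    by change ((a * x z + y z) * v z = a * (x z * v z) + y z * v z); ring.
  + move=> x a v y; apply: pf_ext; apply/funext => z.
    by change (x z * (a * v z + y z) = a * (x z * v z) + x z * y z); ring.
  + by move=> x y; apply: pf_ext; apply: dirDM; exact: pf_polyfun.
  + by move=> x y; apply: pf_ext; apply: dirDM; exact: pf_polyfun.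
  + exact: Hp.
  + exact: Hq.
Qed.

Lemma polyfun_replica_stable (X B : 'M[K]_m) (S : set (W -> K)) :
  (forall v, replicated (rmul X) (rmul B) v) ->
  S 0 -> (forall a p q, S p -> S q -> S (cst a * p + q)) ->
  (forall p, S p -> polyfun p) -> (forall p, S p -> S (dirD (mulmx X) p)) ->
  forall p, S p -> S (dirD (mulmx B) p).
Proof.
move=> hXB S0 SL Sp SD p Spp.
have SS : subspace [set u : pf W | S u].
  by split => // a u v; apply: SL.
have SDu (u : pf W) : S u -> S (pfD X u) by move=> /SD.
exact: (replicated_stable (pfD_linear X) (pfD_linear B) SS SDu
  (pf_replicated hXB (mkpf (Sp _ Spp))) Spp).
Qed.

End PolyfunReplica.

(** * Lie algebras of matrix groups, replicas and exponentials *)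

Section LieAlgebra.

Variables (K : numClosedFieldType) (m : nat) (G : set 'M[K]_m).

Definition mxgroup : Prop :=
  [/\ G 1%:M, forall g h, G g -> G h -> G (g *m h)
    & forall g, G g -> exists h, [/\ G h, g *m h = 1%:M & h *m g = 1%:M]].

(** The tangent space at the identity, through the vector fields t |-> X t, which commute with right
    translations. *)
Definition lie : set 'M[K]_m :=
  [set X | forall p, vanishing G p -> dirD (mulmx X) p 1%:M = 0].

Lemma lie0 : lie 0.
Proof.
move=> p hp; rewrite /dirD (deriv0E (q := (p 1%:M)%:P)) ?coefC //.
by apply/funext => t; rewrite hornerC mul0mx scaler0 addr0.
Qed.

Lemma dirD_mulmxL k a (X Y : 'M[K]_m) (p : 'M[K]_(m, k) -> K) : polyfun p ->
  dirD (mulmx (a *: X + Y)) p = cst a * dirD (mulmx X) p + dirD (mulmx Y) p.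
Proof.
move=> hp; rewrite -dirD_linear_field //; try exact: mulmx_linear.
by congr (dirD _ p); apply/funext => y; rewrite mulmxDl -scalemxAl.
Qed.

Lemma dirD_mulmx_bracket k (X Y : 'M[K]_m) (p : 'M[K]_(m, k) -> K) : polyfun p ->
  dirD (mulmx (X *m Y - Y *m X)) p =
  dirD (mulmx Y) (dirD (mulmx X) p) - dirD (mulmx X) (dirD (mulmx Y) p).
Proof.
move=> hp; rewrite dirD_bracket //; try exact: mulmx_linear.
by congr (dirD _ p); apply/funext => y; rewrite mulmxBl !mulmxA.
Qed.

Lemma lieL a X Y : lie X -> lie Y -> lie (a *: X + Y).
Proof.
move=> hX hY p hp; rewrite dirD_mulmxL; last by case: hp.
by rewrite addrfctE mulrfctE hX // hY // mulr0 addr0.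
Qed.

Hypothesis hG : mxgroup.

Lemma lie_dirD X p : lie X -> vanishing G p -> vanishing G (dirD (mulmx X) p).
Proof.
move=> hX [hp Gp]; split; first exact: dirD_polyfun (mulmx_linear X) hp.
have [_ GM _] := hG => g Gg.
have lg : linear (fun t : 'M[K]_m => t *m g) by move=> a u v; rewrite mulmxDl -scalemxAl.
have := hX (p \o (fun t => t *m g)); rewrite (dirD_comp (A' := mulmx X)) //=.
  rewrite mul1mx; apply; split; first by apply: polyfun_comp => //; apply: polymap_linear.
  by move=> h Gh; apply/Gp/GM.
by move=> y; rewrite mulmxA.
Qed.

Lemma lie_bracket : bracket_closed lie.
Proof.
move=> X Y hX hY p hp; rewrite dirD_mulmx_bracket; last by case: hp.
have [G1 _ _] := hG; have hXp := lie_dirD hX hp; have hYp := lie_dirD hY hp.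
have [_ h1] := lie_dirD hY hXp; have [_ h2] := lie_dirD hX hYp.
by rewrite addrfctE opprfctE h1 // h2 // subrr.
Qed.

Lemma lie_conj g h X : G g -> G h -> g *m h = 1%:M -> h *m g = 1%:M -> lie X ->
  lie (g *m X *m h).
Proof.
move=> Gg Gh gh hg hX p [hp Gp]; have [_ GM _] := hG.
have lc : linear (fun t : 'M[K]_m => g *m t *m h).
  by move=> a u v; rewrite mulmxDr mulmxDl -scalemxAr -scalemxAl.
have := hX (p \o (fun t => g *m t *m h)).
rewrite (dirD_comp (A' := mulmx (g *m X *m h))) //=.
  rewrite mulmx1 gh; apply; split.
    by apply: polyfun_comp => //; apply: polymap_linear.
  by move=> t Gt; apply: Gp; apply: (GM) => //; apply: GM.
by move=> y; rewrite !mulmxA -[_ *m h *m g]mulmxA hg mulmx1.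
Qed.

(** The ideal of [G] is a subspace stable under the derivation of [X], hence under that of its
    replica. *)
Lemma lie_replica X B : (forall v, replicated (rmul X) (rmul B) v) -> lie X -> lie B.
Proof.
move=> hXB hX p hp; have [G1 _ _] := hG.
have [_ I0 ID IM] := vanishing_pideal G.
have [|||_ h] := @polyfun_replica_stable _ _ _ X B (vanishing G) hXB I0 _ _ _ _ hp; last exact: h.
- by move=> a q r hq hr; apply: (ID) => //; apply: IM => //; exact: polyfun_cst.
- by move=> q [].
- by move=> q; apply: lie_dirD.
Qed.

Hypothesis Gclosed : forall x, (forall p, vanishing G p -> p x = 0) -> G x.

Definition mxexp L (X : 'M[K]_m) (t : K) : 'M[K]_m :=
  \sum_(j < L) (t ^+ j / j`!%:R) *: iter j (mulmx X) 1%:M.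

Lemma lie_exp X L t : lie X -> iter L (mulmx X) 1%:M = 0 -> G (mxexp L X t).
Proof.
move=> hX XL; apply: Gclosed => p hp; have [G1 _ _] := hG.
pose cl (l : 'M[K]_m -> K) : {poly K} := \sum_(j < L) (l (iter j (mulmx X) 1%:M) / j`!%:R) *: 'X^j.
have clE l : lform l -> l \o mxexp L X = horner (cl l).
  move=> hl; apply/funext => s; rewrite /= /mxexp lform_sum // /cl horner_sum.
  by apply: eq_bigr => j _; rewrite lformZ // hornerZ hornerXn mulrAC [RHS]mulrC mulrA.
have curve : polycurve (mxexp L X) by move=> l hl; exists (cl l); exact: clE.
have E0 : mxexp L X 0 = 1%:M.
  rewrite /mxexp; case: L XL {cl clE curve} => [|L] XL.
    by rewrite big_ord0; exact: esym XL.
  rewrite big_ord_recl /= expr0 fact0 divr1 scale1r big1 ?addr0 // => j _.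
  by rewrite /bump /= expr0n /= mul0r scale0r.
have dcurve (l : 'M[K]_m -> K) : lform l -> forall q : {poly K}, l \o mxexp L X = horner q ->
    l \o mulmx X \o mxexp L X = horner q^`().
  move=> hl q; rewrite clE // => eq.
  have <- : cl l = q by apply: horner_eq_inj => s; rewrite eq.
  have hlX : lform (l \o mulmx X) by apply: lform_comp => //; exact: mulmx_linear.
  rewrite (clE _ hlX); apply/funext => s; congr (_.[s]).
  rewrite /cl (eq_bigr (fun j : 'I_L => (l (iter j.+1 (mulmx X) 1%:M) / j`!%:R) *: 'X^j)) //.
  rewrite (raddf_sum (@deriv K)) /=; case: L XL {cl clE curve E0 eq} => [|L] XL;
    first by rewrite !big_ord0.
  rewrite big_ord_recr [RHS]big_ord_recl /= -iterS XL lform0 // mul0r scale0r addr0.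
  rewrite derivZ expr0 derivC scaler0 add0r; apply: eq_bigr => j _.
  rewrite derivZ derivXn /bump /= add1n -scaler_nat scalerA; congr (_ *: _).
  by rewrite factS natrM invfM [_^-1 * _]mulrC mulrA mulfVK // pnatr_eq0.
have main n p' : vanishing G p' -> forall q : {poly K},
  p' \o mxexp L X = horner q -> q^`(n).[0] = 0.
  elim: n p' => [|n IH] p' hp' q eq.
    by rewrite derivn0 -eq /= E0; case: hp' => _; apply.
  have [q' e' d'] := dirD_curve (mulmx_linear X) curve dcurve (proj1 hp').
  have <- : q' = q by apply: horner_eq_inj => s; rewrite -e' eq.
  by rewrite derivSn; apply: (IH _ (lie_dirD hX hp')).
have [q eq] := polycurve_comp curve (proj1 hp).
suff -> : p (mxexp L X t) = 0 by [].
have -> : p (mxexp L X t) = q.[t] by rewrite -eq.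
suff -> : q = 0 by rewrite horner0.
apply/polyP => n; have := main n p hp q eq; rewrite coef0 horner_coef0 coef_derivn addn0 ffactnn.
by move/eqP; rewrite mulrn_eq0 => /orP[|/eqP//]; rewrite eqn0Ngt fact_gt0.
Qed.

End LieAlgebra.

(** * Functions killed by the Lie algebra *)

Section LformDuality.

Variables (K : numClosedFieldType) (W : vectType K).

(** Biduality in finite dimension. Applied to differentials of equations, it shows that a form
    vanishing on a tangent space is such a differential. *)
Lemma lform_duality (D : set (W -> K)) (l : W -> K) :
  (forall d, D d -> lform d) -> D 0 ->
  (forall a d d', D d -> D d' -> D (cst a * d + d')) ->
  lform l -> (forall x, (forall d, D d -> d x = 0) -> l x = 0) -> D l.
Proof.
move=> Dl D0 DL hl hx; pose n := \dim {:W}; pose b (i : 'I_n) := (vbasis {:W})`_i.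
have lE (d d' : W -> K) : lform d -> lform d' -> (forall i, d (b i) = d' (b i)) -> d = d'.
  move=> hd hd' e; apply/funext => x; rewrite (lform_expand x hd) (lform_expand x hd').
  by apply: eq_bigr => i _; rewrite -/(b i) e.
pose S : set 'rV[K]_n := [set r | exists2 d, D d & forall i, r 0 i = d (b i)].
have [|a u v [d Dd ud] [d' Dd' vd']|U hU] := @subspace_vspace K _ S.
- by exists 0 => // i; rewrite mxE.
- by exists (cst a * d + d') => [|i]; [exact: DL | rewrite !mxE ud vd'].
pose B : 'M_(\dim U, n) := \matrix_i (vbasis U)`_i.
pose r : 'rV[K]_n := \row_i l (b i).
have pairE (r' : 'rV[K]_n) d (x : 'cV[K]_n) : (forall i, r' 0 i = d (b i)) -> lform d ->
    (r' *m x) 0 0 = d (\sum_i x i 0 *: b i).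
  move=> hr hd; rewrite mxE lform_sum //; apply: eq_bigr => i _.
  by rewrite hr lformZ // mulrC.
have rB : (r <= B)%MS.
  rewrite submxE; move: (cokermx B) (mulmx_coker B) => C BC.
  apply/eqP/matrixP => i j; rewrite ord1 [RHS]mxE.
  have -> : (r *m C) 0 j = (r *m col j C) 0 0.
    by rewrite colE mulmxA -colE [RHS]mxE.
  rewrite (pairE r l) //; last by move=> k; rewrite mxE.
  apply: hx => d Dd; pose rd : 'rV[K]_n := \row_i d (b i).
  have hrd k : rd 0 k = d (b k) by rewrite mxE.
  have -> := esym (pairE rd d (col j C) hrd (Dl _ Dd)).
  have : rd \in U by apply/hU; exists d => // k; rewrite mxE.
  move=> /coord_vbasis ->; rewrite mulmx_suml summxE big1 // => k _.
  have -> : (vbasis U)`_k = row k B by rewrite rowK.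
  by rewrite -scalemxAl mxE -row_mul colE mulmxA BC mul0mx row0 mxE mulr0.
have : r \in U.
  have /submxP[c ->] := rB; rewrite mulmx_sum_row; apply: memv_suml => k _.
  by apply: memvZ; rewrite rowK; apply: vbasis_mem; apply: mem_nth; rewrite size_tuple.
move=> /hU[d Dd rd]; suff -> : l = d by [].
by apply: lE => // [|i]; [exact: Dl | rewrite -rd mxE].
Qed.

End LformDuality.

Section Taylor.

Variables (K : numClosedFieldType) (W : vectType K) (x0 : W).
Local Notation lp := (lpow x0).

Lemma lform_loc (l : W -> K) : lform l ->
  (fun x => l (x - x0)) = \sum_i loc x0 i * cst (l (vbasis {:W})`_i).
Proof.
move=> hl; apply/funext => x; rewrite fct_sumE lform_expand //.
Qed.

Lemma lpow1_lform (l : W -> K) : lform l -> lp 1 (fun x => l (x - x0)).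
Proof.
move=> hl; rewrite lform_loc //; exists (fun i => cst (l (vbasis {:W})`_i)) => // i.
exact: polyfun_cst.
Qed.

Lemma lpow1 p : polyfun p -> lp 1 (p - cst (p x0)).
Proof.
have [_ L0 LD LM] := lpow_pideal x0 1.
move: p; apply: polyfun_ind => [c|l hl|p q hp hq Hp Hq|p q hp hq Hp Hq].
- by have -> : (fun=> c) - cst c = 0 :> (W -> K) by apply/funext => x; exact: subrr.
- have -> : l - cst (l x0) = fun x => l (x - x0) by apply/funext => x; rewrite lformB.
  exact: lpow1_lform.
- have -> : p + q - cst ((p + q) x0) = (p - cst (p x0)) + (q - cst (q x0)).
    by apply/funext => x; rewrite !fctE; ring.
  exact: LD.
- have -> : p * q - cst ((p * q) x0) = q * (p - cst (p x0)) + cst (p x0) * (q - cst (q x0)).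
    by apply/funext => x; rewrite !fctE; ring.
  by apply: (LD); apply: LM => //; exact: polyfun_cst.
Qed.

Lemma lpowM a b p q : lp a p -> lp b q -> lp (a + b) (p * q).
Proof.
elim: a p => [|a IH] p hp hq; first by have [_ _ _ M] := lpow_pideal x0 b; apply: M.
case: hp => f hf ->; rewrite addSn mulr_suml; exists (fun i => f i * q) => [i|].
  by apply: IH => //; apply: hf.
by apply: eq_bigr => i _; rewrite mulrA.
Qed.

Lemma taylor2 p : polyfun p -> lp 2 (p - cst (p x0) - (fun x => dirD (fun=> x - x0) p x0)).
Proof.
have [_ L0 LD LM] := lpow_pideal x0 2.
move: p; apply: polyfun_ind => [c|l hl|p q hp hq Hp Hq|p q hp hq Hp Hq].
- have -> // : (fun=> c) - cst c - (fun x => dirD (fun=> x - x0) (fun=> c) x0) = 0.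
  by apply/funext => x; rewrite !fctE dirD_cst subrr subr0.
- have -> // : l - cst (l x0) - (fun x => dirD (fun=> x - x0) l x0) = 0.
  by apply/funext => x; rewrite !fctE dirD_lform //= lformB // subrr.
- have -> : p + q - cst ((p + q) x0) - (fun x => dirD (fun=> x - x0) (p + q) x0) =
     (p - cst (p x0) - (fun x => dirD (fun=> x - x0) p x0)) +
     (q - cst (q x0) - (fun x => dirD (fun=> x - x0) q x0)).
    by apply/funext => x; rewrite !fctE dirDD // !fctE; ring.
  exact: LD.
- have -> : p * q - cst ((p * q) x0) - (fun x => dirD (fun=> x - x0) (p * q) x0) =
     cst (q x0) * (p - cst (p x0) - (fun x => dirD (fun=> x - x0) p x0)) +
     cst (p x0) * (q - cst (q x0) - (fun x => dirD (fun=> x - x0) q x0)) +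
     (p - cst (p x0)) * (q - cst (q x0)).
    by apply/funext => x; rewrite !fctE dirDM // !fctE; ring.
  apply: (LD); first by apply: (LD); apply: LM => //; exact: polyfun_cst.
  by apply: (lpowM (a := 1) (b := 1)); exact: lpow1.
Qed.

End Taylor.

Section LocallyConstant.

Variables (K : numClosedFieldType) (m : nat) (G : set 'M[K]_m).
Hypothesis hG : mxgroup G.
Local Notation W := 'M[K]_m.
Local Notation lp := (lpow (1%:M : W)).
Local Notation I := (vanishing G).
Local Notation D := (fun X : W => dirD (mulmx X : W -> W)).

Let G1 : G 1%:M. Proof. by case: hG. Qed.
Let hI : pideal I := vanishing_pideal G.

Lemma lpow_dirD X k p : lp k.+1 p -> lp k (D X p).
Proof.
have lX := mulmx_linear (k := m) X.
elim: k p => [|k IH] p hp.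
  apply: dirD_polyfun => //; exact: lpow_polyfun hp.
have [_ _ LD LM] := lpow_pideal (1%:M : W) k.+1.
case: hp => q hq' ->; have hq i : lp k.+1 (q i) := hq' i.
rewrite dirD_sum => [|i]; last first.
  by apply: polyfunM; [exact: loc_polyfun | exact: lpow_polyfun (hq i)].
apply: pideal_sum => [|i _]; first exact: lpow_pideal.
have pl := loc_polyfun (1%:M : W) i; have pq := lpow_polyfun (hq i).
rewrite dirDM //; apply: (LD); first by apply: (LM); [exact: dirD_polyfun | exact: hq].
have := lpowM (a := 1) (b := k) _ (IH _ (hq i)); apply.
exact: lpow1_lform (lform_coord i).
Qed.

Lemma iter_dirD_polyfun X k p : polyfun p -> polyfun (iter k (D X) p).
Proof. by move=> hp; elim: k => //= k IH; apply: dirD_polyfun => //; exact: mulmx_linear. Qed.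

Lemma iter_dirD_linear X k a p q : polyfun p -> polyfun q ->
  iter k (D X) (cst a * p + q) = cst a * iter k (D X) p + iter k (D X) q.
Proof.
by move=> hp hq; elim: k => //= k ->; rewrite dirD_linear //; exact: iter_dirD_polyfun.
Qed.

Lemma iter_dirDD X k p q : polyfun p -> polyfun q ->
  iter k (D X) (p + q) = iter k (D X) p + iter k (D X) q.
Proof. by move=> hp hq; have := iter_dirD_linear X k 1 hp hq; rewrite !mul1r. Qed.

Lemma iter_dirD_sum X k (J : Type) (r : seq J) (F : J -> W -> K) :
  (forall i, polyfun (F i)) -> iter k (D X) (\sum_(i <- r) F i) = \sum_(i <- r) iter k (D X) (F i).
Proof.
move=> hF; elim: r => [|i r IH].
  rewrite !big_nil; elim: k => //= k ->; exact: dirD0.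
by rewrite !big_cons iter_dirDD ?IH //; apply: polyfun_sum.
Qed.

Lemma iter_dirD_lpow X k p : lp k.+1 p -> iter k (D X) p 1%:M = 0.
Proof.
elim: k p => [|k IH] p hp; first exact: lpow0 hp.
by rewrite iterSr; apply: IH; apply: lpow_dirD.
Qed.

(** Leibniz: exactly one of the k + 1 derivatives has to hit the linear form for a term not to
    vanish at the identity. *)
Lemma iter_dirD_leading X k (l : W -> K) r : lform l -> lp k r ->
  iter k.+1 (D X) ((fun t => l (t - 1%:M)) * r) 1%:M = k.+1%:R * l X * iter k (D X) r 1%:M.
Proof.
move=> hl; have lX := mulmx_linear (k := m) X.
have hlX : lform (l \o mulmx X) by apply: lform_comp.
have l1 := lpow1_lform (1%:M : W) hl; have pl := lpow_polyfun l1.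
have l1X := lpow1_lform (1%:M : W) hlX; have plX := lpow_polyfun l1X.
have eD : D X (fun t => l (t - 1%:M)) = cst (l X) + (fun t => (l \o mulmx X) (t - 1%:M)).
  have -> : (fun t => l (t - 1%:M)) = l + cst (- l 1%:M).
    by apply/funext => t; rewrite lformB.
  rewrite (dirDD _ (polyfun_lform hl) (polyfun_cst _ _)) (dirD_lform _ hl) dirD_cst addr0.
  apply/funext => t; change (l (X *m t) = l X + l (X *m (t - 1%:M))).
  by rewrite mulmxBr mulmx1 lformB // addrC subrK.
have e q : polyfun q -> D X ((fun t => l (t - 1%:M)) * q) = cst (l X) * q +
    ((fun t => (l \o mulmx X) (t - 1%:M)) * q + (fun t => l (t - 1%:M)) * D X q).
  by move=> hq; rewrite dirDM // eD mulrDl addrA.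
elim: k r => [|k IH] r hr; have pr := lpow_polyfun hr; have pDr := dirD_polyfun lX pr.
  by rewrite /= e // !fctE /= subrr mulmx0 (lform0 hl) !mul0r !addr0 mul1r.
rewrite iterSr e // iter_dirD_linear //; last by apply: polyfunD; apply: polyfunM.
rewrite iter_dirDD ?addrfctE ?mulrfctE; try exact: polyfunM.
rewrite (iter_dirD_lpow X (p := _ * r)); last exact: (lpowM (a := 1) (b := k.+1) l1X hr).
rewrite (IH _ (lpow_dirD X hr)) -iterSr add0r.
set a := iter _ _ _ _; rewrite -[k.+2%:R]natr1 /cst; ring.
Qed.

(** By duality [l] is the differential at the identity of an equation of [G], and differs from it by
    a second order term. *)
Lemma annihilator_lie (l : W -> K) : lform l -> (forall X, lie G X -> l X = 0) ->
  pideal_add (lp 2) I (fun t => l (t - 1%:M)).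
Proof.
move=> hl hL.
have [p [hp e]] : exists p, I p /\ l = fun X => D X p 1%:M.
  apply: (lform_duality (D := [set d | exists p, I p /\ d = fun X => D X p 1%:M])) => //.
  - move=> _ [p [[hp _] ->]] a X Y.
    by rewrite dirD_mulmxL.
  - have [_ I0 _ _] := hI; exists 0; split => //; apply/funext => X; by rewrite dirD0.
  - move=> a _ _ [p [hp ->]] [q [hq ->]]; have [_ _ ID IM] := hI.
    exists (cst a * p + q); split; first by apply: (ID) => //; apply: (IM) => //;
      exact: polyfun_cst.
    by apply/funext => X; rewrite dirD_linear //; [case: hp|case: hq].
  - move=> X hX; apply: hL => p hp; exact: (hX _ (ex_intro _ p (conj hp erefl))).
have [pp Gp] := hp.
exists (- (p - cst (p 1%:M) - (fun x => dirD (fun=> x - 1%:M) p 1%:M))).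
  by apply: pidealN; [exact: lpow_pideal | exact: taylor2].
suff -> : (fun t => l (t - 1%:M)) - - (p - cst (p 1%:M) - (fun x => dirD (fun=> x - 1%:M) p
  1%:M)) = p by [].
apply/funext => t; rewrite !fctE (Gp _ G1) subr0 opprK e.
by rewrite [X in _ + (_ - X)]/dirD {1}/dirD mulmx1 addrC subrK.
Qed.

(** q' is the homogeneous leading form of [q], recovered up to k! from repeated derivatives. Modulo
    the ideal of [G], coordinates transverse to the Lie algebra are of second order, so only the
    composite of q' with the projection [pi] remains. *)
Lemma leading_form (pi : W -> W) k q : linear pi -> (forall X, lie G (pi X)) ->
  (forall X, lie G X -> pi X = X) -> lp k q ->
  exists q' : W -> K, (forall X, iter k (D X) q 1%:M = k`!%:R * q' X) /\
    pideal_add (lp k.+1) I (q - (fun t => q' (pi (t - 1%:M)))).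
Proof.
move=> lpi piL piI; have [_ _ ID IM] := hI.
elim: k q => [|k IH] q hq.
  exists (fun=> q 1%:M); split; first by move=> X; rewrite fact0 mul1r.
  by apply: sub_pideal_addl => //; exact: lpow1.
case: hq => f hf ->.
have [f' hf'] := choice (fun i => IH _ (hf i)).
pose c i : W -> K := coord (vbasis {:W}) i.
have lc i : lform (c i) := lform_coord i.
exists (fun X => \sum_i c i X * f' i X); split.
  move=> X; rewrite iter_dirD_sum => [|i]; last first.
    by apply: polyfunM; [exact: loc_polyfun | exact: lpow_polyfun (hf i)].
  rewrite fct_sumE mulr_sumr; apply: eq_bigr => i _.
  have -> : loc 1%:M i = (fun t => c i (t - 1%:M)) by [].
  by rewrite (iter_dirD_leading _ (lc i) (hf i)) (hf' i).1 factS natrM; ring.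
have hA2 := pideal_addP (lpow_pideal (1%:M : W) k.+2) hI.
have [_ _ AD AM] := hA2.
have -> : \sum_i loc 1%:M i * f i - (fun t => \sum_i c i (pi (t - 1%:M)) * f' i (pi (t - 1%:M))) =
   \sum_i ((fun t => (fun X => c i X - c i (pi X)) (t - 1%:M)) * f i +
     (fun t => (c i \o pi) (t - 1%:M)) * (f i - (fun t => f' i (pi (t - 1%:M))))).
  apply/funext => t; rewrite !fctE !fct_sumE -sumrB; apply: eq_bigr => i _.
  by rewrite !fctE /loc -/(c i) /=; ring.
apply: pideal_sum => // i _; apply: (AD).
  have ld : lform (fun X => c i X - c i (pi X)).
    by move=> a X Y; rewrite lpi !(lc i); ring.
  have [|r hr Ir] := annihilator_lie ld; first by move=> X /piI ->; rewrite subrr.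
  exists (r * f i); first exact: (lpowM (a := 2) (b := k) hr (hf i)).
  by rewrite -mulrBl mulrC; apply: (IM) => //; exact: lpow_polyfun (hf i).
have [r hr Ir] := (hf' i).2.
have l1 : lp 1 (fun t => (c i \o pi) (t - 1%:M)).
  by apply: lpow1_lform; apply: lform_comp.
exists ((fun t => (c i \o pi) (t - 1%:M)) * r); first exact: (lpowM (a := 1) (b := k.+1) l1 hr).
by rewrite -mulrBr; apply: (IM) => //; exact: lpow_polyfun l1.
Qed.

(* All derivatives of [f - f(1)] along the Lie algebra vanish at the identity,
   hence [f - f(1)] lies in every power of the maximal ideal there, modulo the
   ideal of [G]. *)
Lemma locally_constant f : polyfun f -> (forall X, lie G X -> I (D X f)) ->
  exists e, [/\ polyfun e, e 1%:M = 0 & I ((1 - e) * (f - cst (f 1%:M)))].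
Proof.
move=> hf hD; pose b := f - cst (f 1%:M).
have pb : polyfun b by apply: polyfunB => //; exact: polyfun_cst.
apply: polyfun_krull => //.
have [L hL] := subspace_vspace (lie0 (G := G)) (lieL (G := G)).
(* If b lies in m^k modulo the ideal of [G], its leading form vanishes on the Lie algebra together
   with its k-fold derivatives, so b lies in m^(k+1) modulo that ideal. *)
elim=> [|k [q hq Iq]]; first by apply: sub_pideal_addl.
have [|||q' [eq hq']] := leading_form (pi := projv L) _ _ _ hq.
- by move=> a u v; rewrite linearP.
- by move=> X; apply/hL; exact: memv_proj.
- by move=> X /hL; exact: projv_id.
have pq := lpow_polyfun hq.
have q0 X : lie G X -> q' X = 0.
  move=> hX; apply/eqP; have : k`!%:R * q' X == 0.
    rewrite -eq; have -> : q = b - (b - q) by rewrite opprB addrC subrK.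
    have pbq : polyfun (b - q) by apply: polyfunB.
    have iI j p : I p -> I (iter j (D X) p) by move=> hp; elim: j => //= j IHj; apply: lie_dirD.
    have [_ z1] := iI k _ Iq.
    have -> : b - (b - q) = cst (-1) * (b - q) + b by apply/funext => t; rewrite !fctE; ring.
    rewrite iter_dirD_linear // !fctE z1 // mulr0 add0r; apply/eqP.
    case: k {hq eq hq' iI z1} => [|k]; first by rewrite /= /b !fctE subrr.
    have ib : I (D X b) by rewrite dirDB ?dirD_cst ?subr0 //; [exact: hD | exact: polyfun_cst].
    rewrite iterSr; have : I (iter k (D X) (D X b)) by elim: k => //= k IHk; apply: lie_dirD.
    by case=> _; apply.
  by rewrite mulf_eq0 pnatr_eq0 eqn0Ngt fact_gt0 /=.
rewrite -/b; have -> : b = (q - (fun t => q' (projv L (t - 1%:M)))) + (b - q).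
  have -> : (fun t => q' (projv L (t - 1%:M))) = 0.
    by apply/funext => t; rewrite q0 //; apply/hL; exact: memv_proj.
  by rewrite subr0 addrC subrK.
have [_ _ AD _] := pideal_addP (lpow_pideal (1%:M : W) k.+1) hI.
apply: AD; first exact: hq'.
by apply: sub_pideal_addr => //; exact: lpow_pideal.
Qed.

(** Otherwise the ideals of the parts of [G] where [f] avoids its first n chosen values would grow
    forever: local constancy at a point with a new value gives a function that is nonzero there and
    vanishes wherever [f] takes another value. *)
Lemma finitely_many_values f : polyfun f -> (forall X, lie G X -> I (D X f)) ->
  exists s : seq K, forall g, G g -> f g \in s.
Proof.
move=> hf hD; apply: contrapT => H; have [_ GM GV] := hG.
have hc (s : seq K) : exists g, G g /\ f g \notin s.
  apply: contrapT => H'; apply: H; exists s => g Gg; apply: contrapT => /negP ng.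
  by apply: H'; exists g.
have [c hc'] := choice hc.
pose s n := iter n (fun s => f (c s) :: s) [::].
have [n|n p [hp vp]|n hn] := @polyfun_acc K W (fun n => vanishing [set g | G g /\ f g \notin s n]).
- exact: vanishing_pideal.
- by split => // g [Gg ng]; apply: vp; split => //; apply: contraNN ng; rewrite inE orbC => ->.
pose g := c (s n); have [Gg ng] := hc' (s n).
have [h [Gh gh hg]] := GV g Gg.
have rl (t : W) : linear (fun y : W => y *m t) by move=> a u v; rewrite mulmxDl -scalemxAl.
pose f' := f \o (fun t => t *m g).
have hf' : polyfun f' by apply: polyfun_comp => //; apply: polymap_linear.
have [|e [he e1 [_ Ge]]] := locally_constant hf'.
  move=> X /hD[pX GX]; rewrite (dirD_comp (A' := mulmx X)) //; last by move=> y; rewrite mulmxA.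
  split; first by apply: polyfun_comp => //; apply: polymap_linear.
  by move=> t Gt; apply: GX; apply: GM.
pose u := (1 - e) \o (fun t => t *m h).
have pu : polyfun u.
  by apply: polyfun_comp; [exact: polymap_linear | apply: polyfunB => //; exact: polyfun1].
have [|_ vu] := hn n.+1 u.
  split => // t [Gt]; rewrite inE negb_or => /andP[nt _].
  have := Ge (t *m h) (GM _ _ Gt Gh); rewrite mulrfctE => /eqP.
  rewrite mulf_eq0 => /orP[/eqP //|]; rewrite !fctE /f' /= mul1mx -mulmxA hg mulmx1.
  by rewrite subr_eq0 (negbTE nt).
have := vu g (conj Gg ng); rewrite /u /= gh !fctE e1 subr0 => /eqP.
by rewrite oner_eq0.
Qed.

End LocallyConstant.

(** * Linear reductivity *)

Section LinearReductivity.

Variables (K : numClosedFieldType) (m k : nat) (G : set 'M[K]_m).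
Local Notation W := 'M[K]_m.
Local Notation Y := 'M[K]_(m, k).
Hypothesis hG : mxgroup G.

(** The Lie algebra form of reductivity; [reductive_no_nil_ideal] derives it from the triviality of
    the unipotent radical. *)
Definition no_nil_ideal : Prop := forall N : set W,
  N `<=` lie G -> N 0 -> (forall a X Z, N X -> N Z -> N (a *: X + Z)) ->
  bracket_closed N ->
  (forall g h X, G g -> G h -> g *m h = 1%:M -> h *m g = 1%:M -> N X -> N (g *m X *m h)) ->
  (forall X, N X -> mxnil X) -> forall X, N X -> X = 0.

Hypothesis hN : no_nil_ideal.

Definition independent d (w : 'I_d -> Y -> K) : Prop :=
  forall v : 'rV[K]_d, (forall y, \sum_i v 0 i * w i y = 0) -> v = 0.

(** The evaluation vectors of an independent family span, by duality, so a basis can be chosen among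
    them. *)
Lemma independent_points d (w : 'I_d -> Y -> K) : independent w ->
  exists y : 'I_d -> Y, \matrix_(l, i) w i (y l) \in unitmx.
Proof.
move=> iw; pose row_at y : 'rV[K]_d := \row_i w i y.
have [|P [c [uP hP]]] := @pick_basis K d (fun c r => exists y, r = c *: row_at y).
  move=> v; pose D : set ('rV[K]_d -> K) := [set f | exists s : seq (K * Y),
    forall u : 'rV[K]_d, f u = \sum_(x <- s) x.1 * \sum_i u 0 i * w i x.2].
  have [|||||s hs] := @lform_duality K 'rV[K]_d D (fun u : 'rV[K]_d => \sum_i u 0 i * v 0 i).
  - move=> f [s hs] a x z; rewrite !hs [in RHS]mulr_sumr -big_split /=;
    apply: eq_bigr => -[b y] _ /=.
    rewrite [in RHS]mulrCA -mulrDr [in RHS]mulr_sumr -big_split /=; congr (_ * _);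
      apply: eq_bigr => i _.
    by rewrite !mxE mulrDl mulrA.
  - by exists [::] => u; rewrite big_nil.
  - move=> a f f' [s hs] [s' hs']; exists ([seq (a * x.1, x.2) | x <- s] ++ s') => u.
    rewrite big_cat big_map /= addrfctE mulrfctE hs hs' mulr_sumr; congr (_ + _).
    by apply: eq_bigr => x _; rewrite mulrA.
  - move=> a x z; rewrite mulr_sumr -big_split; apply: eq_bigr => i _.
    by rewrite !mxE mulrDl mulrA.
  - move=> u hu; rewrite (iw u); first by rewrite big1 // => i _; rewrite mxE mul0r.
    move=> y; apply: (hu (fun u : 'rV[K]_d => \sum_i u 0 i * w i y)); exists [:: (1, y)] => u'.
    by rewrite big_seq1 mul1r.
  exists [seq (x.1, x.1 *: row_at x.2) | x <- s]; split.
    by move=> _ /mapP[x _ ->] /=; exists x.2.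
  rewrite big_map; apply/rowP => j; rewrite summxE.
  have := hs (delta_mx 0 j); rewrite (bigD1 j) //= big1 => [|i /negbTE ij]; last first.
    by rewrite mxE eqxx ij mul0r.
  rewrite mxE !eqxx mul1r addr0 => ->; apply: eq_bigr => x _; rewrite !mxE.
  rewrite (bigD1 j) //= big1 => [|i /negbTE ij]; last by rewrite mxE eqxx ij mul0r.
  by rewrite mxE !eqxx mul1r addr0.
have [y hy] := choice hP; exists y; move: uP.
have -> : P = diag_mx (\row_l c l) *m \matrix_(l, i) w i (y l).
  apply/row_matrixP => l; rewrite row_mul row_diag_mx -scalemxAl -rowE mxE hy; congr (_ *: _).
  by apply/rowP => i; rewrite !mxE.
by rewrite unitmx_mul => /andP[].
Qed.

Section Module.

Variables (d : nat) (w : 'I_d -> Y -> K).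
Hypothesis wp : forall i, polyfun (w i).
Hypothesis iw : independent w.

Lemma independent_mx (A B : 'M[K]_d) :
  (forall i y, \sum_j A i j * w j y = \sum_j B i j * w j y) -> A = B.
Proof.
move=> h; apply/row_matrixP => i; apply/eqP; rewrite -subr_eq0; apply/eqP/iw => y.
rewrite -[RHS](subrr (\sum_j B i j * w j y)) -{1}h -sumrB.
by apply: eq_bigr => j _; rewrite !mxE mulrBl.
Qed.

Variable rho : W -> 'M[K]_d.
Hypothesis rhop : polymap rho.
Hypothesis rhoE : forall g i y, G g -> w i (g *m y) = \sum_j rho g i j * w j y.

Let G1 : G 1%:M. Proof. by case: hG. Qed.

Lemma rho1 : rho 1%:M = 1%:M.
Proof.
apply: independent_mx => i y; rewrite -rhoE // mul1mx (bigD1 i) //= big1.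
  by rewrite mxE eqxx mul1r addr0.
by move=> j ji; rewrite mxE eq_sym (negbTE ji) mul0r.
Qed.

Lemma rhoM g h : G g -> G h -> rho (g *m h) = rho g *m rho h.
Proof.
have [_ GM _] := hG => Gg Gh; apply: independent_mx => i y.
rewrite -(rhoE _ _ (GM _ _ Gg Gh)) -mulmxA rhoE //.
rewrite (eq_bigr (fun j => \sum_l rho g i j * (rho h j l * w l y))) => [|j _]; last first.
  by rewrite rhoE // mulr_sumr.
rewrite exchange_big /=; apply: eq_bigr => l _; rewrite mxE mulr_suml.
by apply: eq_bigr => j _; rewrite mulrA.
Qed.

(** [rho] is polynomial on all matrices but multiplicative only on [G]; accordingly its derivative
    represents only the Lie algebra. *)
Definition drho (X : W) : 'M[K]_d :=
  \matrix_(i, j) dirD (mulmx X) (fun t => rho t i j) 1%:M.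

Lemma drho_linear : linear drho.
Proof.
move=> a X Z; apply/matrixP => i j; rewrite !mxE dirD_mulmxL //.
exact: polyfun_entry.
Qed.

Lemma orbit_deriv (f : Y -> K) X y : dirD (mulmx X) (fun t => f (t *m y)) 1%:M = dirD (mulmx X) f y.
Proof. by apply: deriv0_ext => t; rewrite mulmx1 mulmxDl mul1mx -scalemxAl. Qed.

Lemma orbit_polyfun (f : Y -> K) y : polyfun f -> polyfun (fun t : W => f (t *m y)).
Proof.
move=> hf; apply: (polyfun_comp (h := fun t : W => t *m y)) => //.
by apply: polymap_linear => a u v; rewrite mulmxDl -scalemxAl.
Qed.

Lemma drhoE X i y : lie G X -> dirD (mulmx X) (w i) y = \sum_j drho X i j * w j y.
Proof.
move=> hX.
have pr j : polyfun ((fun t => rho t i j) * cst (w j y)).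
  by apply: polyfunM; [exact: polyfun_entry | exact: polyfun_cst].
pose p := (fun t : W => w i (t *m y)) - \sum_j (fun t => rho t i j) * cst (w j y).
have Ip : vanishing G p.
  split; first by apply: polyfunB; [exact: orbit_polyfun | exact: polyfun_sum].
  move=> g Gg; rewrite /p !fctE fct_sumE rhoE //.
  by apply/eqP; rewrite subr_eq0; apply/eqP/eq_bigr.
have := hX p Ip; rewrite /p dirDB ?dirD_sum //; [|exact: orbit_polyfun|exact: polyfun_sum].
rewrite !fctE fct_sumE orbit_deriv => /eqP; rewrite subr_eq0 => /eqP ->.
apply: eq_bigr => j _; rewrite dirDM ?dirD_cst; [|exact: polyfun_entry|exact: polyfun_cst].
by rewrite mulr0 addr0 mulrfctE mxE.
Qed.

Let dirD_comb X (c : 'I_d -> K) y :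
  dirD (mulmx X) (\sum_j cst (c j) * w j) y = \sum_j c j * dirD (mulmx X) (w j) y.
Proof.
rewrite dirD_sum => [|j]; last by apply: polyfunM => //; exact: polyfun_cst.
rewrite fct_sumE; apply: eq_bigr => j _.
by rewrite dirDM // ?dirD_cst ?mul0r ?add0r //; exact: polyfun_cst.
Qed.

Let drho_fun X i : lie G X -> dirD (mulmx X) (w i) = \sum_j cst (drho X i j) * w j.
Proof. by move=> hX; apply/funext => y; rewrite drhoE // fct_sumE. Qed.

Lemma drho_bracket X Z : lie G X -> lie G Z ->
  drho (X *m Z - Z *m X) = drho X *m drho Z - drho Z *m drho X.
Proof.
move=> hX hZ; apply: independent_mx => i y.
rewrite -drhoE; last exact: lie_bracket.
rewrite dirD_mulmx_bracket // addrfctE opprfctE !drho_fun // !dirD_comb.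
under eq_bigr do rewrite drhoE // mulr_sumr.
under [X in _ - X]eq_bigr do rewrite drhoE // mulr_sumr.
rewrite exchange_big /= [X in _ - X]exchange_big /= -sumrB; apply: eq_bigr => l _.
rewrite !mxE mulrBl !mulr_suml; congr (_ - _); by apply: eq_bigr => j _; rewrite mulrA.
Qed.

Lemma drho_conj g h X : G g -> G h -> g *m h = 1%:M -> h *m g = 1%:M -> lie G X ->
  drho (g *m X *m h) = rho g *m drho X *m rho h.
Proof.
move=> Gg Gh gh hg hX; apply: independent_mx => i y.
rewrite -drhoE; last exact: lie_conj.
have -> : dirD (mulmx (g *m X *m h)) (w i) y = dirD (mulmx X) (w i \o mulmx g) (h *m y).
  have hc (z : Y) : g *m (X *m z) = (g *m X *m h) *m (g *m z).
    by rewrite !mulmxA -[_ *m h *m g]mulmxA hg mulmx1.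
  by rewrite (dirD_comp (w i) (mulmx_linear g) hc) /= mulmxA gh mul1mx.
have -> : w i \o mulmx g = \sum_j cst (rho g i j) * w j.
  by apply/funext => z; rewrite fct_sumE /= rhoE.
rewrite dirD_comb.
under eq_bigr do rewrite drhoE // mulr_sumr.
rewrite exchange_big /=.
have -> : \sum_l (\sum_j rho g i j * (drho X j l * w l (h *m y))) =
    \sum_l (rho g *m drho X) i l * w l (h *m y).
  by apply: eq_bigr => l _; rewrite mxE mulr_suml; apply: eq_bigr => j _; rewrite mulrA.
rewrite (eq_bigr (fun l => \sum_j (rho g *m drho X) i l * (rho h l j * w j y))) => [|l _];
  last first.
  by rewrite (rhoE l y Gh) mulr_sumr.
rewrite exchange_big /=; apply: eq_bigr => l _; rewrite [in RHS]mxE mulr_suml.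
by apply: eq_bigr => j _; rewrite mulrA.
Qed.

(** The row space embeds into polynomial functions as combinations of the [w i]; there the
    derivations are replicated, and the condition is pulled back. *)
Lemma drho_replicated X B : lie G X -> lie G B ->
  (forall v, replicated (rmul X) (rmul B) v) ->
  forall v, replicated (rmul (drho X)) (rmul (drho B)) v.
Proof.
move=> hX hB hXB v.
have pT (u : 'rV[K]_d) : polyfun (\sum_i cst (u 0 i) * w i).
  by apply: polyfun_sum => i _; apply: polyfunM => //; exact: polyfun_cst.
pose T u := mkpf (pT u).
have TE u y : pf_val (T u) y = \sum_i u 0 i * w i y by rewrite /= fct_sumE.
have lT : linear T.
  move=> a u u'; apply: pf_ext; apply/funext => y.
  change (pf_val (T (a *: u + u')) y = a * pf_val (T u) y + pf_val (T u') y).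
  rewrite !TE mulr_sumr -big_split; apply: eq_bigr => i _.
  by rewrite !mxE mulrDl mulrA.
have Tinj : injective T.
  move=> u u' e; apply/eqP; rewrite -subr_eq0; apply/eqP/iw => y.
  rewrite -[RHS](subrr (pf_val (T u') y)) -{1}e !TE -sumrB.
  by apply: eq_bigr => i _; rewrite !mxE mulrBl.
have TD Z u : lie G Z -> T (rmul (drho Z) u) = pfD Z (T u).
  move=> hZ; apply: pf_ext; apply/funext => y; rewrite TE /= dirD_comb.
  under [RHS]eq_bigr do rewrite drhoE // mulr_sumr.
  rewrite [RHS]exchange_big /=; apply: eq_bigr => j _; rewrite mxE mulr_suml.
  by apply: eq_bigr => i _; rewrite mulrA.
apply: (replicated_pull (D := rmul (drho X)) (B := rmul (drho B)) (D' := pfD X) (B' := pfD B)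
  (rmul_linear _) (rmul_linear _) (pfD_linear X) lT) => //.
- by move=> u; exact: TD.
- by move=> u; exact: TD.
- exact: pf_replicated.
Qed.

(* The radical of the trace form of the module acts nilpotently; its part
   orthogonal to the kernel of the action is an ideal of nilpotent elements. *)
Lemma trace_form_nondegenerate X : lie G X ->
  (forall Z, lie G Z -> \tr (drho X *m drho Z) = 0) -> drho X = 0.
Proof.
have ldr := drho_linear.
pose z : set W := [set Z | lie G Z /\ drho Z = 0].
pose rad : set W := [set Z | lie G Z /\ forall T, lie G T -> \tr (drho Z *m drho T) = 0].
pose N : set W := [set Z | rad Z /\ forall T, z T -> \tr (Z *m T) = 0].
have lieB A B : lie G A -> lie G B -> lie G (A - B).
  by move=> hA hB; rewrite addrC -scaleN1r; apply: lieL.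
have N0 Z : N Z -> Z = 0.
  apply: (hN (N := N)) => {Z}.
  - by move=> Z [[]].
  - split; first by split; [exact: lie0 | move=> T _; rewrite (op0 ldr) mul0mx mxtrace0].
    by move=> T _; rewrite mul0mx mxtrace0.
  - move=> a A B [[lA rA] oA] [[lB rB] oB]; split; first split; first exact: lieL.
      by move=> T hT; rewrite ldr mulmxDl -scalemxAl mxtraceD mxtraceZ rA // rB // mulr0 addr0.
    by move=> T hT; rewrite mulmxDl -scalemxAl mxtraceD mxtraceZ oA // oB // mulr0 addr0.
  - have trb n (A B C : 'M[K]_n) : \tr ((A *m B - B *m A) *m C) = \tr (A *m (B *m C - C *m B)).
      by rewrite mulmxBl mulmxBr !mxtraceD !raddfN /= -!mulmxA [in X in _ - X]mxtrace_mulC -mulmxA.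
    move=> A B [[lA rA] oA] [[lB rB] oB]; split; first split; first exact: lie_bracket.
      move=> T hT; rewrite drho_bracket // trb -drho_bracket //; apply: rA.
      exact: lie_bracket.
    move=> T [lT T0]; rewrite trb; apply: oA; split; first exact: lie_bracket.
    by rewrite drho_bracket // T0 mulmx0 mul0mx subrr.
  - move=> g h A Gg Gh gh hg [[lA rA] oA]; split; first split; first exact: lie_conj.
      move=> T hT; rewrite drho_conj // -!mulmxA mxtrace_mulC -!mulmxA.
      rewrite [rho h *m (_ *m _)]mulmxA -drho_conj //; apply: rA.
      exact: lie_conj.
    move=> T [lT T0]; rewrite -!mulmxA mxtrace_mulC -!mulmxA [h *m (_ *m _)]mulmxA.
    apply: oA; split; first exact: lie_conj.
    by rewrite drho_conj // T0 mulmx0 mul0mx.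
  (* The replica [B] of [A] lies in the Lie algebra. Orthogonality in the module makes [drho A]
     nilpotent, hence its replica [drho B] zero; so [B] is in [z], and orthogonality to [z] makes
     [A] itself nilpotent. *)
  - move=> A [[lA rA] oA]; have [B hAB] := conj_replica A.
    have lB := lie_replica hG hAB lA.
    have rAB := drho_replicated lA lB hAB.
    have [n hn] := replicated_trace rAB (rA B lB).
    apply: (replicated_trace hAB); apply: oA; split => //.
    apply/row_matrixP => i; rewrite row0 rowE.
    exact: (replicated_nilpotent (rmul_linear _) (rmul_linear _) (rAB _) (hn _)).
have zL a A B : z A -> z B -> z (a *: A + B).
  move=> [lA A0] [lB B0]; split; first exact: lieL.
  by rewrite ldr A0 B0 scaler0 addr0.
have [|U hU] := subspace_vspace _ zL; first by split; [exact: lie0 | exact: op0].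
have [|n [e [f [efU eE fE ef]]]] := @trace_dual_basis K m U.
  move=> Z /hU[lZ Z0] hZ; apply: N0; split; first split => //.
    by move=> T _; rewrite Z0 mul0mx mxtrace0.
  by move=> T /hU; apply: hZ.
(* Since [N] is zero, the plain trace form is nondegenerate on the kernel [z] of the action;
   subtracting [Xz] makes [X] orthogonal to [z] and puts it in [N]. *)
move=> hX rX; pose Xz := \sum_i \tr (X *m f i) *: e i.
have zXz : z Xz by apply/hU; apply: memv_suml => i _; apply: memvZ; case: (efU i).
suff : X - Xz = 0.
  by move/eqP; rewrite subr_eq0 => /eqP ->; case: zXz.
have dXz : drho (X - Xz) = drho X by rewrite (opB ldr) zXz.2 subr0.
apply: N0; split; first by split; [apply: lieB => //; case: zXz | rewrite dXz].
move=> T /hU /fE ->; rewrite mulmx_sumr (raddf_sum (@mxtrace K m)) big1 //= => j _.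
rewrite -scalemxAr mxtraceZ mulmxBl (raddfB (@mxtrace K m)) mulmx_suml (raddf_sum (@mxtrace K m))
  /=.
rewrite (bigD1 j) //= big1 => [|i ij]; rewrite -scalemxAl mxtraceZ ef.
  by rewrite eqxx mulr1 addr0 subrr mulr0.
by rewrite (negbTE ij) mulr0.
Qed.

End Module.

End LinearReductivity.

Section BilinearSplitting.

Variables (K : numClosedFieldType) (m k : nat).

(** Separating the variables shows that the translates of [f] lie in the finite-dimensional span of
    the [b i]. *)
Lemma polyfun_mulmx_split (f : 'M[K]_(m, k) -> K) : polyfun f ->
  exists (I : finType) (c : I -> 'M[K]_m -> K) (b : I -> 'M[K]_(m, k) -> K),
  [/\ forall i, polyfun (c i), forall i, polyfun (b i)
    & forall t y, f (t *m y) = \sum_i c i t * b i y].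
Proof.
move: f; apply: polyfun_ind => [a|l hl|p q _ _ [I [c [b [hc hb e]]]] [I' [c' [b' [hc' hb' e']]]]
  |p q _ _ [I [c [b [hc hb e]]]] [I' [c' [b' [hc' hb' e']]]]].
- exists unit, (fun _ _ => a), (fun _ _ => 1); split => [_|_|t y]; try exact: polyfun_cst.
  by rewrite big_const card_unit /= addr0 mulr1.
- exists ('I_m * 'I_m * 'I_k)%type, (fun x t => t x.1.1 x.1.2),
  (fun x y => y x.1.2 x.2 * l (delta_mx x.1.1 x.2)).
  split => [x|x|t y]; first exact: polyfun_mxentry.
    by apply: polyfunM; [exact: polyfun_mxentry | exact: polyfun_cst].
  rewrite lform_mxE //.
  transitivity (\sum_i \sum_j \sum_r t i j * (y j r * l (delta_mx i r))).
    apply: eq_bigr => i _; rewrite exchange_big /=; apply: eq_bigr => r _.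
    by rewrite mxE mulr_suml; apply: eq_bigr => j _; rewrite mulrA.
  by rewrite pair_big pair_big.
- exists (I + I')%type, (fun x => match x with inl i => c i | inr i => c' i end),
    (fun x => match x with inl i => b i | inr i => b' i end).
  by split => [[]|[]|t y] //; rewrite big_sumType /= addrfctE e e'.
- exists (I * I')%type, (fun x => c x.1 * c' x.2), (fun x => b x.1 * b' x.2).
  split => [x|x|t y]; [exact: polyfunM|exact: polyfunM|].
  rewrite mulrfctE e e' big_distrlr pair_big /=; apply: eq_bigr => x _.
  by rewrite !mulrfctE; ring.
Qed.

End BilinearSplitting.

(** [P] projects onto the generalized kernel of [O]. It is a polynomial in [O], from a Bezout
    identity between X^a and its cofactor in the characteristic polynomial. *)
Lemma fitting_projector (K : numClosedFieldType) d (O : 'M[K]_d) (l : 'cV[K]_d) :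
  l != 0 -> O *m l = 0 ->
  exists a (P : 'M[K]_d), (forall v, iter a (rmul O) (v *m P) = 0) /\ P *m l = l.
Proof.
case: d O l => [|d] O l l0 Ol; first by rewrite flatmx0 eqxx in l0.
have [a [q nq ep]] := multiplicity_XsubC (char_poly O) 0.
rewrite monic_neq0 ?char_poly_monic //= subr0 in nq ep.
have evl (p : {poly K}) : horner_mx O p *m l = p.[0] *: l.
  elim/poly_ind: p => [|p c IH]; first by rewrite rmorph0 mul0mx horner0 scale0r.
  rewrite rmorphD rmorphM /= horner_mx_X horner_mx_C mulmxDl -mulmxA Ol mulmx0 add0r.
  by rewrite !hornerE mul_scalar_mx.
have cop : coprimep q ('X^a).
  by rewrite coprimep_expr // -['X]subr0 -(polyC0 K) coprimep_XsubC.
move/Bezout_coprimepP: cop => [[u v] /= /eqpP[[c1 c2] /= /andP[c10 c20] eu]].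
have a0 : (0 < a)%N.
  rewrite lt0n; apply/negP => /eqP a0; have := evl (char_poly O).
  rewrite Cayley_Hamilton mul0mx ep a0 expr0 mulr1 => /esym/eqP.
  by rewrite scaler_eq0 (negbTE l0) orbF -/(root q 0) (negbTE nq).
exists a, (horner_mx O ((c1 / c2) *: (u * q))); split.
  move=> w; rewrite iter_rmul -mulmxA.
  suff -> : horner_mx O (c1 / c2 *: (u * q)) *m O ^+ a = 0 by rewrite mulmx0.
  have -> : O ^+ a = horner_mx O ('X^a) by rewrite rmorphXn /= horner_mx_X.
  rewrite -[_ *m _]rmorphM /= -scalerAl -mulrA -ep -mul_polyC !rmorphM /=.
  by rewrite Cayley_Hamilton !mulr0.
rewrite evl hornerZ.
have := congr1 (fun p => p.[0]) eu.
rewrite !hornerZ hornerD [(v * _).[0]]hornerM hornerXn expr0n gtn_eqF // mulr0 addr0 hornerC mulr1.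
by move=> e; rewrite mulrAC e divff // scale1r.
Qed.

(** * Existence of invariants *)

Section Reynolds.

Variables (K : numClosedFieldType) (m k : nat) (G : set 'M[K]_m).
Local Notation W := 'M[K]_m.
Local Notation Y := 'M[K]_(m, k).
Hypothesis hG : mxgroup G.
Hypothesis hN : no_nil_ideal G.

(** Evaluation at [z0] is an invariant linear form on the stable space [A], to be turned into an
    invariant element of [A]. Each application chooses its own [A], whose defining conditions the
    invariant inherits. *)
Variable A : set (Y -> K).
Hypothesis Ap : forall f, A f -> polyfun f.
Hypothesis A0 : A 0.
Hypothesis AL : forall a f g, A f -> A g -> A (cst a * f + g).
Hypothesis AG : forall g f, G g -> A f -> A (f \o mulmx g).
Variable z0 : Y.
Hypothesis Az0 : forall g f, G g -> A f -> f (g *m z0) = f z0.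

Let comb d (w : 'I_d -> Y -> K) (v : 'rV[K]_d) : Y -> K := fun y => \sum_i v 0 i * w i y.

Let comb_linear d (w : 'I_d -> Y -> K) a u v :
  comb w (a *: u + v) = cst a * comb w u + comb w v.
Proof.
apply/funext => y; rewrite /comb !fctE mulr_sumr -big_split; apply: eq_bigr => i _.
by rewrite !mxE mulrDl mulrA.
Qed.

Let comb0 d (w : 'I_d -> Y -> K) : comb w 0 = 0.
Proof. by apply/funext => y; rewrite /comb big1 // => i _; rewrite mxE mul0r. Qed.

Let combS d (w : 'I_d -> Y -> K) (I : Type) (r : seq I) (c : I -> K) (F : I -> 'rV[K]_d) y :
  comb w (\sum_(i <- r) c i *: F i) y = \sum_(i <- r) c i * comb w (F i) y.
Proof.
elim: r => [|i r IH]; first by rewrite !big_nil comb0.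
by rewrite !big_cons comb_linear !fctE IH.
Qed.

Let A_comb d (w : 'I_d -> Y -> K) v : (forall i, A (w i)) -> A (comb w v).
Proof.
move=> hw; have -> : comb w v = \sum_i cst (v 0 i) * w i.
  by apply/funext => y; rewrite fct_sumE.
elim/big_rec: _ => // i f _ hf; exact: AL.
Qed.

Let module d (w : 'I_d -> Y -> K) : Prop :=
  [/\ forall i, A (w i), independent w,
      forall g, G g -> exists M : 'M[K]_d, forall i y, w i (g *m y) = \sum_j M i j * w j y
    & exists v, comb w v z0 != 0].

Let module_of_subspace d (w : 'I_d -> Y -> K) (U : {vspace 'rV[K]_d}) :
  (forall v, v \in U -> A (comb w v)) ->
  (forall v, v \in U -> comb w v = 0 -> v = 0) ->
  (forall g v, G g -> v \in U -> exists2 v', v' \in U & comb w v \o mulmx g = comb w v') ->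
  (exists2 v, v \in U & comb w v z0 != 0) ->
  module (fun i : 'I_(\dim U) => comb w (vbasis U)`_i).
Proof.
move=> UA U0 UG [v0 v0U hv0].
have bU (i : 'I_(\dim U)) : (vbasis U)`_i \in U.
  by apply: vbasis_mem; apply: mem_nth; rewrite size_tuple.
have combE c y : comb (fun i : 'I_(\dim U) => comb w (vbasis U)`_i) c y =
    comb w (\sum_(i < \dim U) c 0 i *: (vbasis U)`_i) y by rewrite combS.
split.
- by move=> i; apply: UA.
- move=> c hc; have c0 : \sum_(i < \dim U) c 0 i *: (vbasis U)`_i = 0.
    apply: U0; first by apply: memv_suml => i _; apply: memvZ.
    by apply/funext => y; rewrite -combE; exact: hc.
  apply/rowP => i; rewrite mxE; have /freeP fr := basis_free (vbasisP U).
  exact: (fr (fun i => c 0 i) c0 i).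
- move=> g Gg; have [v' hv'] : exists v' : 'I_(\dim U) -> 'rV[K]_d, forall i, v' i \in U /\
      comb w (vbasis U)`_i \o mulmx g = comb w (v' i).
    have [v' hv'] := choice (fun i : 'I_(\dim U) =>
      let: ex_intro2 v a b := UG g _ Gg (bU i) in ex_intro (fun v => v \in U /\ _ = comb w v) v
        (conj a b)).
    by exists v'.
  exists (\matrix_(i, j) coord (vbasis U) j (v' i)) => i y.
  have [v'U e] := hv' i; rewrite -[LHS]/((comb w _ \o mulmx g) y) e {1}(coord_vbasis v'U) combS.
  by apply: eq_bigr => j _; rewrite mxE.
exists (\row_i coord (vbasis U) i v0); rewrite combE.
rewrite (_ : \sum_(i < _) _ = v0) // [RHS](coord_vbasis v0U).
by apply: eq_bigr => i _; rewrite mxE.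
Qed.

(** The span of the translates of one function; a complement [C] of the combinations that vanish
    identically restores independence. *)
Let module_exists : (exists2 f, A f & f z0 != 0) -> exists d w, @module d w.
Proof.
move=> [f0 Af0 f00]; have [G1 GM _] := hG.
have [I [c [b [hc hb e]]]] := polyfun_mulmx_split (Ap Af0).
pose b' (i : 'I_#|I|) := b (enum_val i).
pose S : set (Y -> K) := [set f | exists s : seq (K * W), (forall i, (i < size s)%N -> G (nth (0,
  0) s i).2) /\
   f = \sum_(x <- s) cst x.1 * (f0 \o mulmx x.2)].
have SA f : S f -> A f.
  move=> [s [hs ->]]; elim: s hs => [|x s IH] hs; first by rewrite big_nil.
  rewrite big_cons; apply: AL; first by apply: AG => //; exact: (hs 0%N).
  by apply: IH => i hi; exact: (hs i.+1).
have S0 : S 0 by exists [::]; rewrite big_nil.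
have SL a f g : S f -> S g -> S (cst a * f + g).
  move=> [s [hs ->]] [s' [hs' ->]]; exists ([seq (a * x.1, x.2) | x <- s] ++ s'); split.
    move=> i; rewrite size_cat size_map => hi; rewrite nth_cat size_map; case: ltnP => his.
      by rewrite (nth_map (0, 0)) //=; exact: hs.
    by apply: hs'; rewrite -(ltn_add2l (size s)) subnKC.
  rewrite big_cat big_map mulr_sumr; congr (_ + _); apply: eq_bigr => x _.
  by apply/funext => y; rewrite !fctE mulrA.
have SG g f : G g -> S f -> S (f \o mulmx g).
  move=> Gg [s [hs ->]]; exists [seq (x.1, x.2 *m g) | x <- s]; split.
    by move=> i; rewrite size_map => his; rewrite (nth_map (0, 0)) //=; apply: GM => //; apply: hs.
  rewrite big_map; apply/funext => y; rewrite /= !fct_sumE; apply: eq_bigr => x _.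
  by rewrite !fctE /= mulmxA.
have Sb f : S f -> exists v, f = comb b' v.
  move=> [s [_ ->]]; elim: s => [|x s [v IH]]; first by exists 0; rewrite big_nil comb0.
  exists (x.1 *: (\row_i c (enum_val i) x.2) + v); rewrite big_cons IH comb_linear.
  congr (_ * _ + _); apply/funext => y; rewrite /= e /comb (reindex_onto enum_val enum_rank) /=.
    rewrite (eq_bigl xpredT) => [|i]; last by rewrite enum_valK eqxx.
    by apply: eq_bigr => i _; rewrite mxE.
  by move=> i _; exact: enum_rankK.
have [|a u v|U hU] := @subspace_vspace K 'rV[K]_#|I| [set v | S (comb b' v)].
- by rewrite /= comb0.
- by rewrite /= comb_linear; exact: SL.
have [|a u v|N0 hN0] := @subspace_vspace K 'rV[K]_#|I| [set v | comb b' v = 0].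
- by rewrite /= comb0.
- rewrite /= comb_linear => -> ->; by rewrite mulr0 addr0.
pose C := (U :\: N0)%VS.
have CU v : v \in C -> v \in U by apply/subvP/diffvSl.
have UC v : v \in U -> exists2 v', v' \in C & comb b' v = comb b' v'.
  rewrite -(addv_diff_cap U N0) => /memv_addP[v' v'C [n]].
  rewrite memv_cap => /andP[_ /hN0 n0] ->; exists v' => //.
  by have := comb_linear b' 1 v' n; rewrite scale1r mul1r => ->; rewrite n0 addr0.
exists (\dim C), (fun i => comb b' (vbasis C)`_i); apply: module_of_subspace.
- by move=> v /CU/hU; exact: SA.
- move=> v vC /hN0 vN; apply/eqP; rewrite -memv0 -(capv_diff U N0) memv_cap vN.
  by rewrite andbT.
- move=> g v Gg /CU/hU/(SG g _ Gg) hS; have [v' ev'] := Sb _ hS.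
  have /hU/UC[v'' ? ?] : S (comb b' v') by rewrite -ev'.
  by exists v'' => //; rewrite ev'.
have Sf0 : S f0.
  exists [:: (1, 1%:M)]; split => [[]//|]; rewrite big_seq1; apply/funext => y.
  by rewrite !fctE /= mul1mx mul1r.
have [v ev] := Sb _ Sf0; have /hU/UC[v' v'C ev'] : S (comb b' v) by rewrite -ev.
by exists v' => //; rewrite -ev' -ev.
Qed.

(* In a module of least dimension on which the evaluation at [z0] is nonzero,
   an operator that commutes with [G] and kills this evaluation is nilpotent.
   This makes the trace of the Casimir element vanish, so the Lie algebra acts
   by zero and [G] through finitely many operators, which are averaged. *)
Theorem invariant_exists : (exists2 f, A f & f z0 != 0) ->
  exists f, [/\ A f, forall g y, G g -> f (g *m y) = f y & f z0 != 0].
Proof.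
move=> /module_exists hex; have [G1 GM GV] := hG.
have [d [w hw] dmin] : exists2 d, exists w, @module d w &
    forall d', (exists w, @module d' w) -> (d <= d')%N.
  by have [d0 hd0] := hex; apply: (@ex_min_nat nat id); exists d0.
have [wA iw wG [v0 hv0]] := hw.
have wp i : polyfun (w i) by apply: Ap.
have [y hy] := independent_points iw.
pose E := (\matrix_(l, i) w i (y l))^T.
have uE : E \in unitmx by rewrite unitmx_tr.
(* The action is recovered from values at the points [y], which makes it polynomial in the group
   element. *)
pose rho (t : W) : 'M[K]_d := (\matrix_(i, l) w i (t *m y l)) *m invmx E.
have rhop : polymap rho.
  apply: polymap_mulmx; last exact: polymap_cst.
  apply: polymap_mx => i l; have -> : (fun t : W => (\matrix_(i, l) w i (t *m y l)) i l) =
    (fun t => w i (t *m y l)) by apply/funext => t; rewrite mxE.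
  exact: orbit_polyfun.
have rhoE g i z : G g -> w i (g *m z) = \sum_j rho g i j * w j z.
  move=> Gg; have [M hM] := wG g Gg; rewrite hM; apply: eq_bigr => j _; congr (_ * _).
  suff -> : rho g = M by [].
  apply: (canLR (mulmxK uE)); apply/matrixP => a l; rewrite !mxE hM.
  by apply: eq_bigr => r _; rewrite !mxE.
have rho_entry t i j : rho t i j = \sum_r w i (t *m y r) * invmx E r j.
  by rewrite mxE; apply: eq_bigr => r _; rewrite mxE.
clearbody rho; pose l : 'cV[K]_d := \col_i w i z0.
have combl v : comb w v z0 = (v *m l) 0 0.
  by rewrite mxE; apply: eq_bigr => i _; rewrite mxE.
have l0 : l != 0 by apply: contraNneq hv0 => l0; rewrite combl l0 mulmx0 mxE.
have rhol g : G g -> rho g *m l = l.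
  move=> Gg; apply/colP => i; rewrite mxE [RHS]mxE -[RHS](Az0 Gg (wA i)) rhoE //.
  by apply: eq_bigr => j _; congr (_ * _); rewrite mxE.
have comb_rho g v : G g -> comb w v \o mulmx g = comb w (v *m rho g).
  move=> Gg; apply/funext => z; rewrite /comb /=.
  under eq_bigr do rewrite rhoE // mulr_sumr.
  rewrite exchange_big /=; apply: eq_bigr => j _; rewrite mxE mulr_suml.
  by apply: eq_bigr => i _; rewrite mulrA.
(* Minimality of [d]: a stable subspace on which the evaluation is not zero is everything. *)
have full (U : {vspace 'rV[K]_d}) : (forall g v, G g -> v \in U -> v *m rho g \in U) ->
    (exists2 v, v \in U & (v *m l) 0 0 != 0) -> forall v, v \in U.
  move=> UG [v vU hv] u.
  suff : (fullv <= U)%VS by move/subvP; apply; exact: memvf.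
  have [_] := dimv_leqif_eq (subvf U); rewrite eqEsubv subvf /= => <-.
  rewrite dimvf /dim /= mul1n eqn_leq (leq_trans (dimvS (subvf U))) ?dimvf ?/dim /= ?mul1n //.
  apply: dmin; exists (fun i : 'I_(\dim U) => comb w (vbasis U)`_i).
  apply: module_of_subspace => [x _|x _ hx|g x Gg xU|]; first exact: A_comb.
  - by apply: iw => z; have := congr1 (fun f => f z) hx.
  - by exists (x *m rho g); [exact: UG | exact: comb_rho].
  - by exists v => //; rewrite combl.
(* The kernel of [O ^+ a] is stable, and contains [v0 *m P], where the evaluation agrees with that
   of [v0] because P l = l. *)
have nilO (O : 'M[K]_d) : (forall g, G g -> rho g *m O = O *m rho g) -> O *m l = 0 -> mxnil O.
  move=> OG Ol; have [a [P [hP Pl]]] := fitting_projector l0 Ol.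
  have la := iter_linear a (rmul_linear O).
  have [|c u v|U hU] := @subspace_vspace K 'rV[K]_d [set v | iter a (rmul O) v = 0].
  - exact: op0 la.
  - by rewrite /= la => -> ->; rewrite scaler0 addr0.
  exists a => v; apply/hU/full.
    move=> g u Gg /hU hu; apply/hU => /=.
    have -> : iter a (rmul O) (u *m rho g) = iter a (rmul O) u *m rho g.
      by elim: a {hP la hU hu} => [|a IH] //=; rewrite IH /rmul -mulmxA OG // mulmxA.
    by rewrite hu mul0mx.
  exists (v0 *m P); first exact/hU.
  by rewrite -mulmxA Pl -combl.
pose dr := drho rho; have ldr : linear dr := drho_linear rhop.
have drl X : lie G X -> dr X *m l = 0.
  move=> hX; apply/colP => i; rewrite mxE [RHS]mxE.
  rewrite (eq_bigr (fun j => dr X i j * w j z0)) => [|j _]; last by rewrite [l _ _]mxE.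
  rewrite -(drhoE wp rhop rhoE) // -orbit_deriv.
  have := hX ((fun t : W => w i (t *m z0)) - cst (w i z0)).
  rewrite dirDB ?dirD_cst ?subr0; [|exact: orbit_polyfun|exact: polyfun_cst].
  apply; split; first by apply: polyfunB; [exact: orbit_polyfun | exact: polyfun_cst].
  by move=> g Gg; rewrite !fctE Az0 // subrr.
have [|a u v|U hU] := @subspace_vspace K 'M[K]_d [set x | exists2 X, lie G X & x = dr X].
- by exists 0; [exact: lie0 | rewrite (op0 ldr)].
- by move=> [X hX ->] [Z hZ ->]; exists (a *: X + Z); [exact: lieL | rewrite ldr].
have [|n [e [tre [x [z [xz ee]]] n0 ecomm]]] := @casimir K d U.
  move=> _ /hU[X hX ->] h.
  apply: (trace_form_nondegenerate hG hN wp iw rhop rhoE) => // Z hZ.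
  by apply: h; apply/hU; exists Z.
have ne : mxnil e.
  apply: nilO => [g Gg|]; last first.
    rewrite ee mulmx_suml big1 // => i _; have [_ /hU[Z hZ ->]] := xz i.
    by rewrite -mulmxA drl // mulmx0.
  have [h [Gh gh hg]] := GV g Gg.
  have r1 := rho1 hG iw rhoE; have rM := rhoM hG iw rhoE.
  apply: (ecomm _ (rho h)); rewrite -?rM ?gh ?hg ?r1 //.
  move=> _ /hU[X hX ->]; apply/hU; exists (g *m X *m h); first exact: lie_conj.
  by rewrite /dr (drho_conj hG wp iw rhop rhoE).
(* The trace [n] of the nilpotent Casimir element is 0, and this forces the image [U] of the Lie
   algebra to be zero. *)
have dr0 X : lie G X -> dr X = 0.
  move=> hX; apply/eqP; rewrite -memv0 -n0; first by apply/hU; exists X.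
  by apply/eqP; rewrite -(pnatr_eq0 K) -tre (mxnil_trace ne).
have fin i j : exists s : seq K, forall g, G g -> rho g i j \in s.
  apply: (finitely_many_values hG (f := fun t => rho t i j)) => [|X hX].
    exact: polyfun_entry.
  suff -> : dirD (mulmx X) (fun t => rho t i j) = 0.
    by have [_ ? _ _] := vanishing_pideal G.
  have -> : (fun t => rho t i j) = \sum_r (fun t : W => w i (t *m y r)) * cst (invmx E r j).
    by apply/funext => t; rewrite fct_sumE rho_entry.
  rewrite dirD_sum => [|r]; last first.
    by apply: polyfunM; [exact: orbit_polyfun | exact: polyfun_cst].
  rewrite big1 // => r _; rewrite dirDM ?dirD_cst ?mulr0 ?addr0;
    [|exact: orbit_polyfun|exact: polyfun_cst].
  suff -> : dirD (mulmx X) (fun t : W => w i (t *m y r)) = 0 by rewrite mul0r.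
  apply/funext => t.
  have lt : linear (fun t : W => t *m y r) by move=> a u v; rewrite mulmxDl -scalemxAl.
  have -> : (fun t : W => w i (t *m y r)) = w i \o (fun t : W => t *m y r) by [].
  rewrite (dirD_comp (A' := mulmx X)) //= ?(drhoE wp rhop rhoE) //; last by move=> u;
    rewrite mulmxA.
  by rewrite -/dr dr0 // big1 // => j' _; rewrite mxE mul0r.
(* Finitely many values of each entry leave finitely many matrices; [R] enumerates the image of [G],
   and right multiplication by [rho g] permutes it. *)
have [s hs] := choice (fun x : 'I_d * 'I_d => fin x.1 x.2).
pose s' := flatten [seq s x | x <- enum {: 'I_d * 'I_d}].
pose R := [seq r <- undup [seq map_mx val (M : 'M[seq_sub s']_d) | M <- enum 'M[seq_sub s']_d]
  | `[< exists2 g, G g & r = rho g >]].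
have inR g : G g -> rho g \in R.
  move=> Gg; rewrite mem_filter mem_undup; apply/andP; split.
    by apply/asboolP; exists g.
  have hin i j : rho g i j \in s'.
    by apply/flatten_mapP; exists (i, j); [rewrite mem_enum | exact: hs].
  apply/mapP; exists (\matrix_(i, j) SeqSub (hin i j)); first by rewrite mem_enum.
  apply/matrixP => i j; rewrite [RHS]mxE; set M := \matrix_(_, _) _.
  by have -> : M i j = SeqSub (hin i j) by rewrite mxE.
have Rr r : r \in R -> exists2 g, G g & r = rho g by rewrite mem_filter => /andP[/asboolP].
have uR : uniq R by rewrite filter_uniq ?undup_uniq.
have r1 := rho1 hG iw rhoE; have rM := rhoM hG iw rhoE.
pose Rs := \sum_(r <- R) r.
have RsG g : G g -> Rs *m rho g = Rs.
  move=> Gg; have [h [Gh gh hg]] := GV g Gg.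
  rewrite /Rs mulmx_suml -(big_map (fun r => r *m rho g) xpredT id) /=.
  apply: perm_big; apply: uniq_perm => //.
    rewrite map_inj_uniq // => r r' e'.
    by rewrite -[r]mulmx1 -[r']mulmx1 -r1 -gh rM // !mulmxA e'.
  move=> r; apply/mapP/idP => [[r' /Rr[g' Gg' ->] ->]|/Rr[g' Gg' ->]].
    by rewrite -rM //; apply/inR/GM.
  exists (rho (g' *m h)); first exact/inR/GM.
  by rewrite -rM ?GM // -?mulmxA ?hg ?mulmx1 //; exact: GM.
have Rsl : Rs *m l = (size R)%:R *: l.
  rewrite /Rs mulmx_suml big_seq (eq_bigr (fun=> l)) => [|r /Rr[g Gg ->]]; last exact: rhol.
  by rewrite -big_seq big_const_seq count_predT iter_addr addr0 scaler_nat.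
exists (comb w (v0 *m Rs)); split; first exact: A_comb.
  move=> g z' Gg; rewrite -[LHS]/((comb w _ \o mulmx g) z') comb_rho //.
  by rewrite -mulmxA RsG.
rewrite combl -mulmxA Rsl -scalemxAr mxE mulf_neq0 //; last by rewrite -combl.
rewrite pnatr_eq0 size_eq0; apply: contraTneq (inR _ G1) => ->; by rewrite in_nil.
Qed.

End Reynolds.

(** * Free closed orbits *)

Section OrbitMap.

Variables (K : numClosedFieldType) (m : nat) (G : set 'M[K]_m) (x : 'cV[K]_m).
Local Notation W := 'M[K]_m.
Local Notation D X := (dirD (mulmx X : W -> W)).
Hypothesis hG : mxgroup G.
Hypothesis Gclosed : forall t, (forall p, vanishing G p -> p t = 0) -> G t.
Hypothesis stab_trivial : forall g, G g -> g *m x = x -> g = 1%:M.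

Let G1 : G 1%:M. Proof. by case: hG. Qed.

Definition fix_eq (k : 'I_m) : W -> K := fun t => (t *m x - x) k 0.

Let linx : linear (fun t : W => t *m x).
Proof. by move=> a u v; rewrite mulmxDl -scalemxAl. Qed.

Let fix_lform k : lform (fun t : W => (t *m x) k 0).
Proof. by move=> a u v; rewrite linx !mxE. Qed.

Let fix_eqE k : fix_eq k = (fun t : W => (t *m x) k 0) - cst (x k 0).
Proof. by apply/funext => t; rewrite /fix_eq [LHS]mxE [X in _ + X]mxE. Qed.

Let fix_polyfun k : polyfun (fix_eq k).
Proof.
by rewrite fix_eqE; apply: polyfunB; [apply: polyfun_lform | apply: polyfun_cst].
Qed.

Let Tideal : set (W -> K) :=
  [set p | exists2 c : 'I_m -> W -> K, forall k, polyfun (c k) & p = \sum_k c k * fix_eq k].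

(* The ideal of the scheme-theoretic stabilizer of [x]. *)
Definition stab_ideal : set (W -> K) := pideal_add (vanishing G) Tideal.

Let Tideal_pideal : pideal Tideal.
Proof.
split.
- by move=> _ [c hc ->]; apply: polyfun_sum => k _; apply: polyfunM.
- by exists (fun=> 0) => [_|]; [exact: polyfun0 | rewrite big1 // => k _; rewrite mul0r].
- move=> _ _ [c hc ->] [c' hc' ->]; exists (fun k => c k + c' k) => [k|]; first exact: polyfunD.
  by rewrite -big_split; apply: eq_bigr => k _; rewrite mulrDl.
- move=> a _ ha [c hc ->]; exists (fun k => a * c k) => [k|]; first exact: polyfunM.
  by rewrite mulr_sumr; apply: eq_bigr => k _; rewrite mulrA.
Qed.

Let hS : pideal stab_ideal := pideal_addP (vanishing_pideal G) Tideal_pideal.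

Let fix_in k : stab_ideal (fix_eq k).
Proof.
apply: sub_pideal_addr; first exact: vanishing_pideal.
exists (fun l => cst (l == k)%:R) => [l|]; first exact: polyfun_cst.
apply/funext => t; rewrite fct_sumE (bigD1 k) //= big1 => [|l /negbTE lk].
  by rewrite !fctE eqxx mul1r addr0.
by rewrite !fctE lk mul0r.
Qed.

Let stab_at1 p : stab_ideal p -> p 1%:M = 0.
Proof.
move=> [q [_ Gq] [c _ e]]; rewrite -[p](subrK q) addrfctE Gq // addr0 e fct_sumE big1 // => k _.
by rewrite mulrfctE /fix_eq mul1mx subrr mxE mulr0.
Qed.

Let stab_zero t : (forall p, stab_ideal p -> p t = 0) -> t = 1%:M.
Proof.
move=> h; apply: stab_trivial.
  by apply: Gclosed => p hp; apply: h; apply: sub_pideal_addl.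
apply/eqP; rewrite -subr_eq0; apply/eqP/colP => k; rewrite [RHS]mxE.
exact: (h _ (fix_in k)).
Qed.

Let stab_dirD X p : lie G X -> X *m x = 0 -> stab_ideal p -> stab_ideal (D X p).
Proof.
move=> hX Xx [q hq [c hc e]]; have [_ _ SD SM] := hS.
have lX := mulmx_linear (k := m) X; have [pq _] := hq.
have -> : p = q + \sum_k c k * fix_eq k by rewrite -e addrC subrK.
rewrite dirDD //; last by apply: polyfun_sum => k _; apply: polyfunM.
apply: (SD); first by apply: sub_pideal_addl => //; exact: lie_dirD.
rewrite dirD_sum => [|k]; last exact: polyfunM.
apply: pideal_sum => // k _; rewrite dirDM //; apply: (SD).
  by apply: (SM) => //; exact: dirD_polyfun.
apply: (SM) => //.
have -> : D X (fix_eq k) = \sum_l cst (X k l) * fix_eq l.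
  rewrite fix_eqE dirDB; [|exact: polyfun_lform|exact: polyfun_cst].
  rewrite dirD_lform // dirD_cst subr0; apply/funext => t /=.
  have -> : X *m t *m x = X *m (t *m x - x) by rewrite mulmxBr Xx subr0 mulmxA.
  by rewrite fct_sumE mxE.
by apply: pideal_sum => // l _; apply: (SM) => //; exact: polyfun_cst.
Qed.

(** The power rule multiplied by [f], to avoid the exponent k - 1. *)
Lemma dirDX (X : W) f k : polyfun f -> D X (f ^+ k) * f = cst k%:R * f ^+ k * D X f.
Proof.
move=> hf; elim: k => [|k IH].
  by rewrite expr0 (dirD_cst (mulmx X) (1 : K)) mul0r !mul0r.
rewrite exprS dirDM // ?mulrDl; last exact: polyfunX.
rewrite -mulrA [_ * f]mulrC -mulrA IH.
by apply/funext => t; rewrite !fctE -natr1; ring.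
Qed.

(* The radical of a differential ideal is differential, in characteristic 0. *)
Let stab_radical X f n : lie G X -> X *m x = 0 -> polyfun f -> stab_ideal (f ^+ n) ->
  exists k, stab_ideal (D X f ^+ k).
Proof.
move=> hX Xx hf; have [_ _ SD SM] := hS; set g := D X f.
have pg : polyfun g by apply: dirD_polyfun => //; exact: mulmx_linear.
have pDg : polyfun (D X g) by apply: dirD_polyfun => //; exact: mulmx_linear.
(* Deriving f^(n+1) g^b and multiplying by [g] trades one factor [f] for two factors [g], up to the
   invertible integer n + 1. *)
suff H b : stab_ideal (f ^+ n * g ^+ b) -> exists k, stab_ideal (g ^+ k).
  by move=> h; apply: (H 0%N); rewrite expr0 mulr1.
elim: n b => [|n IH] b hb; first by exists b; rewrite expr0 mul1r in hb.
apply: (IH b.+2).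
have hD := stab_dirD hX Xx hb.
have pf k : polyfun (f ^+ k) := polyfunX k hf.
have pgk k : polyfun (g ^+ k) := polyfunX k pg.
have Sf : stab_ideal (cst n.+1%:R * (f ^+ n * g ^+ b.+2)).
  have -> : cst n.+1%:R * (f ^+ n * g ^+ b.+2) =
      g * D X (f ^+ n.+1 * g ^+ b) - cst b%:R * D X g * (f ^+ n.+1 * g ^+ b).
    have e1 : D X (f ^+ n.+1 * g ^+ b) = D X (f ^+ n.+1) * g ^+ b + f ^+ n.+1 * D X (g ^+ b).
      by rewrite dirDM.
    have e2 : D X (f ^+ n.+1) = g * f ^+ n + f * D X (f ^+ n) by rewrite exprS dirDM.
    have e3 : D X (f ^+ n) * f = cst n%:R * f ^+ n * g by exact: dirDX.
    have e4 : D X (g ^+ b) * g = cst b%:R * g ^+ b * D X g by exact: dirDX.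
    apply/funext => t; move: e1 e2 e3 e4.
    move=> /(congr1 (fun f => f t)) e1 /(congr1 (fun f => f t)) e2.
    move=> /(congr1 (fun f => f t)) e3 /(congr1 (fun f => f t)) e4.
    move: e1 e2 e3 e4; rewrite !fctE => -> -> e3 e4.
    rewrite -natr1 exprS !exprSr; ring: e3 e4.
  apply: pidealB => //; apply: (SM) => //.
  by apply: polyfunM => //; exact: polyfun_cst.
have -> : f ^+ n * g ^+ b.+2 = cst n.+1%:R^-1 * (cst n.+1%:R * (f ^+ n * g ^+ b.+2)).
  by apply/funext => t; rewrite !fctE mulKf ?pnatr_eq0.
by apply: (SM) => //; exact: polyfun_cst.
Qed.

Let loc1 i : exists k, stab_ideal (loc (1%:M : W) i ^+ k).
Proof.
apply: nullstellensatz => //; first exact: loc_polyfun.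
by move=> t /stab_zero ->; rewrite /loc subrr linear0.
Qed.

(** The identity is the only zero of the stabilizer ideal, so the centred coordinates are nilpotent
    modulo this ideal. So are their derivatives along [X], whose values at the identity are the
    coordinates of [X]. *)
Let lie_stab X : lie G X -> X *m x = 0 -> X = 0.
Proof.
move=> hX Xx.
have c0 i : coord (vbasis {:W}) i X = 0.
  have [k hk] := loc1 i.
  have [j hj] := stab_radical hX Xx (loc_polyfun _ i) hk.
  have := stab_at1 hj; rewrite exprfctE => /eqP; rewrite expf_eq0 => /andP[_ /eqP].
  have -> : loc (1%:M : W) i = (coord (vbasis {:W}) i : W ->
    K) + cst (- coord (vbasis {:W}) i 1%:M).
    by apply/funext => t; rewrite /loc linearB.
  rewrite dirDD; [|exact/polyfun_lform/lform_coord|exact: polyfun_cst].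
  by rewrite dirD_cst addr0 dirD_lform /= ?mulmx1 //; exact: lform_coord.
rewrite (coord_vbasis (memvf X)) big1 // => i _; by rewrite c0 scale0r.
Qed.

Let tangent (l : W -> K) : lform l ->
  pideal_add stab_ideal (lpow (1%:M : W) 2) (fun t => l (t - 1%:M)).
Proof.
move=> hl.
have [p [hp e]] : exists p, stab_ideal p /\ l = fun X => D X p 1%:M.
  apply: (lform_duality (D := [set d | exists p, stab_ideal p /\ d = fun X => D X p 1%:M])) => //.
  - move=> _ [p [[q hq hpq] ->]] a X Y; rewrite dirD_mulmxL //.
    by have [S _ _ _] := hS; apply: S; exists q.
  - have [_ S0 _ _] := hS; exists 0; split => //; apply/funext => X; by rewrite dirD0.
  - move=> a _ _ [p [hp ->]] [q [hq ->]]; have [S _ SD SM] := hS.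
    exists (cst a * p + q); split; first by apply: (SD) => //; apply: (SM) => //;
      exact: polyfun_cst.
    by apply/funext => X; rewrite dirD_linear //; exact: S.
  - move=> X hX; suff -> : X = 0 by exact: lform0.
    apply: lie_stab => [p hp|].
      by apply: (hX (fun X => D X p 1%:M)); exists p; split => //; apply: sub_pideal_addl.
    apply/colP => k; rewrite [RHS]mxE.
    have := hX (fun X => D X (fix_eq k) 1%:M) (ex_intro _ _ (conj (fix_in k) erefl)).
    rewrite fix_eqE dirDB; [|exact: polyfun_lform|exact: polyfun_cst].
    by rewrite dirD_cst subr0 dirD_lform //= mulmx1.
have pp : polyfun p by have [S _ _ _] := hS; exact: S.
exists p => //.
have -> : (fun t => l (t - 1%:M)) - p =
    - (p - cst (p 1%:M) - (fun x => dirD (fun=> x - 1%:M) p 1%:M)).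
  apply/funext => t; rewrite !fctE stab_at1 // subr0 opprB e; congr (_ - _).
  by rewrite /dirD mulmx1.
by apply: pidealN; [exact: lpow_pideal | exact: taylor2].
Qed.

(* The scheme-theoretic stabilizer is reduced: its ideal is the maximal ideal
   at the identity. *)
Lemma stab_ideal_maximal p : polyfun p -> p 1%:M = 0 -> stab_ideal p.
Proof.
move=> hp p1; have [_ S0 SD SM] := hS.
have [c hc] := choice loc1.
have [i|k hk] := @pideal_lpow_sub K W 1%:M stab_ideal (\max_i c i) hS.
  by rewrite -(subnK (leq_bigmax i)) exprD; apply: (SM) => //; apply: polyfunX; exact: loc_polyfun.
(* By [tangent], m is contained in the stabilizer ideal plus m^2, so the power of m known to lie in
   the ideal can be lowered one step at a time. *)
have down j : lpow (1%:M : W) j.+2 `<=` stab_ideal -> lpow (1%:M : W) j.+1 `<=` stab_ideal.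
  move=> hj _ [q hq ->]; apply: pideal_sum => // i _.
  have [r Sr hr] := tangent (lform_coord i).
  have -> : loc 1%:M i * q i = q i * r + (loc 1%:M i - r) * q i by ring.
  apply: (SD); first by apply: (SM) => //; exact: lpow_polyfun (hq i).
  apply: hj; exact: (lpowM (a := 2) (b := j) hr (hq i)).
have all j : lpow (1%:M : W) (k - j).+1 `<=` stab_ideal.
  elim: j => [|j IH]; last first.
    rewrite subnS; case: (k - j)%N IH => //= n; exact: down.
  rewrite subn0 => _ [q hq ->]; apply: pideal_sum => // i _; apply: (SM); first exact: loc_polyfun.
  by apply: hk; apply: hq.
have := all k; rewrite subnn; apply.
have -> : p = p - cst (p 1%:M) by apply/funext => t; rewrite p1 !fctE subr0.
exact: lpow1.
Qed.

Lemma entry_fix i j : exists c : 'I_m -> W -> K, (forall k, polyfun (c k)) /\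
  forall t, G t -> (t - 1%:M) i j = \sum_k c k t * (t *m x - x) k 0.
Proof.
have [||q [_ Gq] [c hc e]] := @stab_ideal_maximal ((mxentry i j : W -> K) - cst ((1%:M : W) i j)).
- by apply: polyfunB; [exact: polyfun_mxentry | exact: polyfun_cst].
- by rewrite /mxentry !fctE subrr.
exists c; split => // t Gt; have := congr1 (fun f => f t) e.
rewrite !fctE Gq // subr0 /mxentry fct_sumE => e'.
by rewrite [LHS]mxE [X in _ + X]mxE e'.
Qed.

(** For fixed [h] this becomes a linear relation between functions of [g] whose coefficients depend
    on [g] through [g *m x] only. *)
Definition separated_sum (F : W -> W -> K) : Prop :=
  exists (J : finType) (a b : J -> W -> K) (q : J -> 'I_m), forall g h, G g -> G h ->
    F g h = \sum_s a s g * b s h * (h *m x - g *m x) (q s) 0.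

Lemma separated_sum_sum (I : finType) (F : I -> W -> W -> K) :
  (forall i, separated_sum (F i)) -> separated_sum (fun g h => \sum_i F i g h).
Proof.
move=> hF; elim: (index_enum I) => [|i r [J [a [b [q e]]]]].
  by exists void, (fun _ _ => 0), (fun _ _ => 0), (of_void 'I_m) => g h _ _;
    rewrite big_nil big1 // => -[].
have [J' [a' [b' [q' e']]]] := hF i.
exists (J' + J)%type, (fun x => match x with inl i => a' i | inr i => a i end),
    (fun x => match x with inl i => b' i | inr i => b i end),
    (fun x => match x with inl i => q' i | inr i => q i end) => g h Gg Gh.
by rewrite big_cons big_sumType /= e // e'.
Qed.

(** Write h - g as g (g^-1 h - 1), apply [entry_fix] at g^-1 h, and separate g^-1 from h in its
    coefficients. *)
Lemma entry_difference i j : separated_sum (fun g h => h i j - g i j).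
Proof.
have [_ GM GV] := hG.
have [c hc] := choice (fun l => entry_fix l j).
have hiv g : exists h, G g -> [/\ G h, g *m h = 1%:M & h *m g = 1%:M].
  by have [/GV[h hh]|ng] := pselect (G g); [exists h | exists 0].
have [iv hiv'] := choice hiv.
pose F (s : 'I_m * 'I_m * 'I_m) (g h : W) : K :=
  g i s.1.1 * c s.1.1 s.1.2 (iv g *m h) * iv g s.1.2 s.2 * (h *m x - g *m x) s.2 0.
have hF s : separated_sum (F s).
  have [I [a [b [_ _ e]]]] := polyfun_mulmx_split ((hc s.1.1).1 s.1.2).
  exists I, (fun r (g : W) => g i s.1.1 * a r (iv g) * iv g s.1.2 s.2), b, (fun=> s.2) => g h Gg Gh.
  rewrite /F e mulr_sumr !mulr_suml; by apply: eq_bigr => r _; ring.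
have [J [a [b [q e]]]] := separated_sum_sum hF.
exists J, a, b, q => g h Gg Gh; rewrite -e //.
have [Gi gi ig] := hiv' g Gg.
have -> : h i j - g i j = (g *m (iv g *m h - 1%:M)) i j.
  by rewrite mulmxBr mulmxA gi mul1mx mulmx1 [RHS]mxE [X in _ = _ + X]mxE.
rewrite mxE.
transitivity (\sum_l \sum_k \sum_q F (l, k, q) g h); last first.
  by rewrite pair_big pair_big; apply: eq_bigr => -[[]].
apply: eq_bigr => l _; rewrite (hc l).2; last exact: GM.
rewrite mulr_sumr; apply: eq_bigr => k _.
have -> : iv g *m h *m x - x = iv g *m (h *m x - g *m x).
  by rewrite mulmxBr !mulmxA ig mul1mx.
rewrite [X in _ * (_ * X)]mxE !mulr_sumr; apply: eq_bigr => r _; rewrite /F /=; ring.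
Qed.

End OrbitMap.

(** * Minors of linear relations along an orbit *)

Section Minors.

Variables (K : numClosedFieldType) (m : nat) (G : set 'M[K]_m) (x : 'cV[K]_m).
Local Notation W := 'M[K]_m.
Local Notation Y := 'cV[K]_m.

(** Cofactors along the bordering row do not see that row, so 0 can stand in for it when the minors
    are defined. *)
Lemma cofactor_last k r (f : 'I_(k + 1) -> 'I_r) (M : 'M[K]_(k, r)) (v v' : 'rV[K]_r) j :
  cofactor (colsub f (col_mx M v)) (rshift k ord0) j =
  cofactor (colsub f (col_mx M v')) (rshift k ord0) j.
Proof.
rewrite /cofactor; congr (_ * \det _); apply/matrixP => a b; rewrite !mxE.
case: splitP => // c ec.
have := neq_lift (rshift k (ord0 : 'I_1)) a; rewrite -val_eqE /= -/(val (lift _ _)).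
by move: ec => /= ->; rewrite (ord1 c) eqxx.
Qed.

Lemma row_free_colsub k r (f : 'I_k -> 'I_r) (N : 'M[K]_(k, r)) :
  \det (colsub f N) != 0 -> row_free N.
Proof.
move=> h; have := mulmx1 N; rewrite /row_free => e.
have eN : colsub f N = N *m colsub f 1%:M.
  by rewrite -[in LHS](mulmx1 N) mxsub_mul mxsub_id.
have : (\rank (colsub f N) <= \rank N)%N by rewrite eN mxrankM_maxl.
by rewrite mxrank_unit ?unitmxE ?unitfE // eqn_leq rank_leq_row => ->.
Qed.

Variables (r : nat) (mu : 'I_r -> W -> K) (o : 'I_r).

Definition relation (a : 'I_r -> Y -> K) : Prop :=
  (forall i, polyfun (a i)) /\ forall g, G g -> \sum_i a i (g *m x) * mu i g = 0.

Let relmx k (a : 'I_k -> 'I_r -> Y -> K) y : 'M[K]_(k, r) := \matrix_(i, j) a i j y.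

Let free_at k := exists g (a : 'I_k -> 'I_r -> Y -> K),
  [/\ G g, forall i, relation (a i) & row_free (relmx a (g *m x))].

(* A maximal independent family of relations, bordered by one more row: its
   minors annihilate all the relations. *)
Lemma relation_minors g1 : G g1 -> (forall g, G g -> mu o g = 1) ->
  exists g0 (w : 'I_r -> Y -> K), [/\ G g0, forall i, polyfun (w i), w o (g0 *m x) != 0
    & forall a, relation a -> forall g, G g -> \sum_i w i (g *m x) * a i (g *m x) = 0].
Proof.
move=> Gg1 mu1.
have ex0 : exists k, `[< free_at k >].
  exists 0%N; apply/asboolP; exists g1, (fun _ _ _ => 0); split => //; first by case.
  by rewrite /row_free -leqn0 rank_leq_row.
have bnd k : `[< free_at k >] -> (k <= r)%N.
  by move=> /asboolP[g [a [_ _ /eqP <-]]]; exact: rank_leq_col.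
case: (ex_maxnP ex0 bnd) => k /asboolP[g0 [a [Gg0 ra fa]]] kmax.
(* The relations kill the values of [mu] at [g0], the unit row at [o] does not: bordering by it
   preserves independence. *)
have free0 : row_free (col_mx (relmx a (g0 *m x)) (delta_mx (0 : 'I_1) o)).
  apply: inj_row_free => v; rewrite -[v]hsubmxK mul_row_col => e.
  have e2 : rsubmx v = 0.
    have := congr1 (fun u => u *m (\col_i mu i g0)) e; rewrite mulmxDl -!mulmxA mul0mx.
    have -> : relmx a (g0 *m x) *m (\col_i mu i g0) = 0.
      apply/colP => i; rewrite !mxE -[RHS]((ra i).2 g0 Gg0).
      by apply: eq_bigr => j _; rewrite !mxE.
    have -> : delta_mx 0 o *m (\col_i mu i g0) = 1%:M :> 'M[K]_1.
      apply/matrixP => i j; rewrite !ord1 -rowE !mxE mu1 //.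
    by rewrite mulmx0 add0r mulmx1.
  move: e; rewrite e2 mul0mx addr0 => e1.
  suff -> : lsubmx v = 0 by rewrite row_mx0.
  by apply: (row_free_inj fa); rewrite e1 mul0mx.
have full0 : row_full (col_mx (relmx a (g0 *m x)) (delta_mx (0 : 'I_1) o))^T.
  by rewrite /row_full mxrank_tr.
(* The columns [f] carry a minor that is nonzero at [g0]; [w] will collect the cofactors of its
   border. *)
pose f : 'I_(k + 1) -> 'I_r := fullrankfun full0.
have := fullrowsub_unit full0; rewrite -/f -trmx_mxsub unitmx_tr unitmxE unitfE => det0.
pose cf j y := cofactor (colsub f (col_mx (relmx a y) (0 : 'rV_r))) (rshift k ord0) j.
have detE (b : 'I_r -> K) y : \det (colsub f (col_mx (relmx a y) (\row_i b i))) =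
    \sum_j b (f j) * cf j y.
  rewrite (expand_det_row _ (rshift k ord0)); apply: eq_bigr => j _.
  by rewrite (cofactor_last _ _ _ (0 : 'rV_r)) mxE col_mxEd mxE.
exists g0, (fun i y => \sum_j (f j == i)%:R * cf j y); split => // [i||b rb g Gg].
- have -> : (fun y => \sum_j (f j == i)%:R * cf j y) =
    \sum_j (cst (f j == i)%:R * cf j) by apply/funext => y; rewrite fct_sumE.
  apply: polyfun_sum => j _; apply: polyfunM; first exact: polyfun_cst.
  rewrite /cf /cofactor.
  apply: (polyfunM (polyfun_cst _ ((-1) ^+ (rshift k (ord0 : 'I_1) + j)))).
  apply: polyfun_det; apply: polymap_mx => i1 j1.
  pose s := fintype.split (lift (rshift k (ord0 : 'I_1)) i1).
  have -> : (fun y => row' (rshift k ord0) (col' j (colsub f (col_mx (relmx a y) 0))) i1 j1) =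
      match s with inl l => a l (f (lift j j1)) | inr _ => cst 0 end.
    by apply/funext => y; rewrite !mxE -/s; case: s => l; rewrite mxE.
  by case: s => l; [exact: (ra l).1 | exact: polyfun_cst].
- suff -> : \sum_j (f j == o)%:R * cf j (g0 *m x) =
    \det (colsub f (col_mx (relmx a (g0 *m x)) (delta_mx (0 : 'I_1) o))) by [].
  rewrite -[RHS](_ : \det (colsub f (col_mx (relmx a (g0 *m x)) (\row_i (i == o)%:R))) = _).
    by rewrite detE.
  by congr (\det (colsub f (col_mx _ _))); apply/matrixP => i j; rewrite !mxE ord1.
have -> : \sum_i (\sum_j (f j == i)%:R * cf j (g *m x)) * b i (g *m x) =
    \det (colsub f (col_mx (relmx a (g *m x)) (\row_i b i (g *m x)))).
  rewrite detE; under eq_bigr do rewrite mulr_suml.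
  rewrite exchange_big; apply: eq_bigr => j _.
  rewrite (bigD1 (f j)) //= eqxx mul1r big1 ?addr0 => [|i /negbTE fi]; first exact: mulrC.
  by rewrite eq_sym fi !mul0r.
apply/eqP; apply: contraT => /row_free_colsub fr.
suff /kmax : `[< free_at (k + 1) >] by rewrite addn1 ltnn.
apply/asboolP; exists g, (fun i => match fintype.split i with inl l => a l | inr _ => b end).
split => // [i|]; first by case: (fintype.split i).
move: fr; rewrite (_ : col_mx _ _ = relmx (fun i => match fintype.split i with inl l => a l | inr
  _ => b end) (g *m x)) //.
by apply/matrixP => i j; rewrite !mxE; case: (fintype.split i) => l; rewrite mxE.
Qed.

End Minors.

(** * Polynomial inverse of the orbit map *)

Section OrbitSection.

Variables (K : numClosedFieldType) (m : nat) (G : set 'M[K]_m) (x : 'cV[K]_m).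
Local Notation W := 'M[K]_m.
Local Notation Y := 'cV[K]_m.
Hypothesis hG : mxgroup G.
Hypothesis Gclosed : forall t : W, (forall p, vanishing G p -> p t = 0) -> G t.
Hypothesis stab_trivial : forall g, G g -> g *m x = x -> g = 1%:M.
Hypothesis orbit_closed : forall z : Y,
  (forall p, polyfun p -> (forall g, G g -> p (g *m x) = 0) -> p z = 0) ->
  exists2 g, G g & z = g *m x.

Lemma finite_relation_minors (I : finType) (mu : I -> W -> K) (o : I) :
    (forall g, G g -> mu o g = 1) ->
  exists g0 (w : I -> Y -> K), [/\ G g0, forall i, polyfun (w i), w o (g0 *m x) != 0
    & forall a, (forall i, polyfun (a i)) ->
      (forall g, G g -> \sum_i a i (g *m x) * mu i g = 0) ->
      forall g, G g -> \sum_i w i (g *m x) * a i (g *m x) = 0].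
Proof.
move=> mu1; have [G1 _ _] := hG.
have sumE (F : I -> K) : \sum_i F i = \sum_(j < #|I|) F (enum_val j).
  by rewrite -big_enum_val.
have [||g0 [w [Gg0 hw wo hrel]]] :=
    @relation_minors K m G x #|I| (fun j => mu (enum_val j)) (enum_rank o) 1%:M => //.
  by move=> g Gg; rewrite enum_rankK mu1.
exists g0, (fun i => w (enum_rank i)); split => // a ha hz g Gg.
rewrite sumE -[RHS](hrel (fun j => a (enum_val j)) _ g Gg).
  by apply: eq_bigr => j _; rewrite enum_valK.
by split => // h Gh; rewrite -[RHS](hz h Gh) sumE.
Qed.

(** The unknown functions are 1, the entries of g and the left factors of the separated sums. The
    relation attached to a fixed h is evaluated at the point h x, where the terms with a factor h x
    - y vanish; the minors then give w_1 h_ij = w_ij. *)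
Lemma local_section : exists g0 (q : Y -> K), [/\ G g0, polyfun q, q (g0 *m x) != 0
  & forall i j, exists2 b : Y -> K, polyfun b & forall g, G g -> q (g *m x) * g i j = b (g *m x)].
Proof.
have H ij : exists T : {J : finType & ((J -> W -> K) * (J -> W -> K) * (J -> 'I_m))%type},
    forall g h, G g -> G h -> h ij.1 ij.2 - g ij.1 ij.2 =
      \sum_s (tagged T).1.1 s g * (tagged T).1.2 s h * (h *m x - g *m x) ((tagged T).2 s) 0.
  have [J [a [b [q e]]]] := entry_difference hG Gclosed stab_trivial ij.1 ij.2.
  by exists (existT _ J (a, b, q)).
have [T hT] := choice H.
pose S := {ij : 'I_m * 'I_m & tag (T ij)}.
pose mu (i : unit + 'I_m * 'I_m + S) (g : W) : K :=
  match i with inl (inl _) => 1 | inl (inr ij) => g ij.1 ij.2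
  | inr s => (tagged (T (tag s))).1.1 (tagged s) g end.
have [//|g0 [w [Gg0 pw wo hw]]] := @finite_relation_minors _ mu (inl (inl tt)).
exists g0, (w (inl (inl tt))); split => // i j; exists (w (inl (inr (i, j)))) => // g Gg.
pose a (h : W) (k : unit + 'I_m * 'I_m + S) : Y -> K :=
  match k with inl (inl _) => cst (h i j)
  | inl (inr ij) => cst (- (ij == (i, j))%:R)
  | inr s => fun y => - (tag s == (i, j))%:R *
     ((tagged (T (tag s))).1.2 (tagged s) h * (h *m x - y) ((tagged (T (tag s))).2 (tagged s)) 0)
  end.
have := hw (a g) _ _ g Gg; rewrite !big_sumType /=.
rewrite (bigD1 tt) //= big1 => [|[] //]; rewrite addr0.
rewrite (bigD1 (i, j)) //= eqxx big1 => [|ij /negbTE ->]; last by rewrite !fctE oppr0 mulr0.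
rewrite addr0 [X in _ + X]big1 => [|s _]; last by rewrite subrr mxE !mulr0.
rewrite !fctE addr0 mulrN1 => E; apply/eqP; rewrite -subr_eq0; apply/eqP; apply: E.
  move=> [[u|ij]|s]; [exact: polyfun_cst | exact: polyfun_cst |].
  apply: (polyfunM (polyfun_cst _ _)); apply: (polyfunM (polyfun_cst _ _)).
  apply: polyfun_entry; apply: polymap_mx => k l.
  have -> : (fun y => (g *m x - y) k l) = cst ((g *m x) k l) - mxentry k l.
    by apply/funext => y; rewrite [LHS]mxE [X in _ + X]mxE.
  by apply: polyfunB; [exact: polyfun_cst | exact: polyfun_mxentry].
move=> h Gh; rewrite !big_sumType /=.
rewrite (bigD1 tt) //= big1 => [|[] //]; rewrite addr0.
rewrite (bigD1 (i, j)) //= eqxx big1 => [|ij /negbTE ->]; last by rewrite !fctE oppr0 mul0r.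
rewrite addr0 !fctE mulr1 mulN1r (hT (i, j) h g Gh Gg) /mu.
rewrite -(@sig_big_dep _ _ _ _ (fun ij => tag (T ij)) predT (fun=> predT) (fun ij s => - (ij ==
  (i, j))%:R *
     ((tagged (T ij)).1.2 s g * (g *m x - h *m x) ((tagged (T ij)).2 s) 0) * (tagged (T ij)).1.1
       s h)) /=.
rewrite [X in _ + X](bigD1 (i, j)) //= eqxx [X in _ + (_ + X)]big1 => [|ij /negbTE ->].
  rewrite addr0 -big_split big1 //= => s _; ring.
by apply: big1 => s _; rewrite oppr0 !mul0r.
Qed.

(** The denominators form an ideal without zeros: off the orbit an equation of the closed orbit
    serves, on it a translate of the local denominator. Hence 1 is a denominator. *)
Theorem orbit_section : exists2 F : Y -> W, polymap F & forall g, G g -> F (g *m x) = g.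
Proof.
have [G1 GM GV] := hG.
pose J : set (Y -> K) := [set q | polyfun q /\ forall i j, exists2 b : Y -> K, polyfun b
  & forall g, G g -> q (g *m x) * g i j = b (g *m x)].
have hJ : pideal J.
  split.
  - by move=> q [].
  - split; first exact: polyfun0.
    by move=> i j; exists 0 => [|g _]; [exact: polyfun0 | rewrite mul0r].
  - move=> p q [pp hp] [pq hq]; split; first exact: polyfunD.
    move=> i j; have [b pb hb] := hp i j; have [c pc hc] := hq i j.
    by exists (b + c) => [|g Gg]; [exact: polyfunD | rewrite !fctE mulrDl hb ?hc].
  - move=> a q pa [pq hq]; split; first exact: polyfunM.
    move=> i j; have [b pb hb] := hq i j.
    by exists (a * b) => [|g Gg]; [exact: polyfunM | rewrite !fctE -mulrA hb].
have [|J1p J1] := weak_nullstellensatz hJ.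
  move=> z; have [[g Gg ->]|nz] := pselect (exists2 g, G g & z = g *m x); last first.
    have /existsNP[p /not_implyP[pp /not_implyP[p0 /eqP pz]]] :
        ~ forall p, polyfun p -> (forall g, G g -> p (g *m x) = 0) -> p z = 0.
      by move/orbit_closed.
    exists p => //; split => // i j; exists 0 => [|h Gh]; first exact: polyfun0.
    by rewrite p0 // mul0r.
  have [g0 [q [Gg0 pq q0 hq]]] := local_section.
  have [g' [Gg' gg' g'g]] := GV g Gg.
  have [g0' [Gg0' gg0' g0'g]] := GV g0 Gg0.
  have lin : linear (fun y : Y => (g0 *m g') *m y) by move=> c u v; rewrite mulmxDr -scalemxAr.
  exists (q \o (fun y : Y => (g0 *m g') *m y)); last first.
    by rewrite /= !mulmxA -(mulmxA g0) g'g mulmx1.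
  split; first by apply: polyfun_comp pq; exact: polymap_linear.
  move=> i j; have [b hb] := choice (fun l => let: ex_intro2 b p e :=
    hq l j in ex_intro (fun b => polyfun b /\ _) b (conj p e)).
  exists (\sum_l cst ((g *m g0') i l) * (b l \o (fun y : Y => (g0 *m g') *m y))) => [|h Gh].
    apply: polyfun_sum => l _; apply: polyfunM; first exact: polyfun_cst.
    by apply: (polyfun_comp (polymap_linear lin)); exact: (hb l).1.
  have Gk : G (g0 *m g' *m h) by do 2?apply: (GM) => //.
  have eh : h = g *m g0' *m (g0 *m g' *m h).
    by rewrite !mulmxA -(mulmxA g) g0'g mulmx1 gg' mul1mx.
  have e : h i j = \sum_l (g *m g0') i l * (g0 *m g' *m h) l j by rewrite {1}eh mxE.
  rewrite fct_sumE e mulr_sumr; apply: eq_bigr => l _; rewrite !fctE /=.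
  by rewrite mulmxA -(hb l).2 // mulrCA.
have H i j := let: ex_intro2 b p e := J1 i j in ex_intro (fun b => polyfun b /\ _) b (conj p e).
have [F hF] := choice (fun ij => H ij.1 ij.2).
exists (fun y => \matrix_(i, j) F (i, j) y).
  apply: polymap_mx => i j; rewrite (_ : (fun _ => _) = F (i, j)); first exact: (hF (i, j)).1.
  by apply/funext => y; rewrite mxE.
by move=> g Gg; apply/matrixP => i j; rewrite mxE -(hF (i, j)).2 // mul1r.
Qed.

End OrbitSection.

(** * Reductive groups *)

Section Connected.

Variables (K : numClosedFieldType) (W : vectType K).

(** Along a polynomial curve, an equation of [Y] times one of [Z] is the zero polynomial, so one of
    them vanishes on the whole curve. *)
Lemma curve_connected (N : set W) (e : W) : N e ->
  (forall u, N u -> exists c, [/\ polycurve c, c 0 = e, c 1 = u & forall t, N (c t)]) ->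
  zconnected N.
Proof.
move=> Ne hc.
have H (Y Z : set W) : zclosed Y -> zclosed Z -> N `<=` Y `|` Z -> N `&` Y `&` Z = set0 ->
    Y e -> N `<=` Y.
  move=> [S pS ->] [T pT ->] hN h0 Ye u /hc[c [pc c0 <- Nc]] p Sp.
  apply: contrapT => p1.
  have [P hP] := polycurve_comp pc (pS p Sp).
  suff : (set0 : set W) e by [].
  rewrite -h0; split; first by split.
  move=> q Tq; have [Q hQ] := polycurve_comp pc (pT q Tq).
  have /eqP : P * Q = 0.
    apply: horner_eq_inj => t; rewrite hornerM horner0.
    have [/(_ p Sp)|/(_ q Tq)] := hN _ (Nc t).
      by rewrite -[p (c t)]/((p \o c) t) hP => ->; rewrite mul0r.
    by rewrite -[q (c t)]/((q \o c) t) hQ => ->; rewrite mulr0.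
  rewrite mulf_eq0 => /orP[] /eqP z.
    by case: p1; rewrite -[LHS]/((p \o c) 1) hP z horner0.
  by rewrite -c0 -[LHS]/((q \o c) 0) hQ z horner0.
move=> Y Z cY cZ hN h0; have [Ye|Ze] := hN e Ne.
  by left; apply: H hN h0 Ye.
right; apply: (H Z Y) => //; first by rewrite setUC.
by rewrite setIAC.
Qed.

End Connected.

(** * Polynomial curves through powers of a unipotent matrix *)

Section BinomialCurve.

Variable K : numClosedFieldType.

Definition binomp (k : nat) : {poly K} := (k`!%:R)^-1 *: \prod_(j < k) ('X - j%:R%:P).

Lemma binomp_nat k s : (binomp k).[s%:R] = 'C(s, k)%:R.
Proof.
rewrite /binomp hornerZ.
have -> : (\prod_(j < k) ('X - j%:R%:P) : {poly K}).[s%:R] = (s ^_ k)%:R.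
  elim: k => [|k IH]; first by rewrite big_ord0 hornerC.
  rewrite big_ord_recr hornerM IH hornerXsubC ffactnSr natrM.
  have [ks|sk] := leqP k s; first by rewrite natrB.
  by rewrite ffact_small // !mul0r.
by rewrite -bin_ffact natrM mulrC mulfK // pnatr_eq0 -lt0n fact_gt0.
Qed.

Variables (n : nat).
Implicit Types Y u : 'M[K]_n.

Definition mxpow k Y : 'M[K]_n := iter k (mulmx Y) 1%:M.

(** The power u^t of a unipotent u = 1 + Y by the binomial series. At natural t it is an actual
    power of u, which ties the curve to any group containing u. *)
Definition mxbin L Y t : 'M[K]_n := \sum_(k < L) (binomp k).[t] *: mxpow k Y.

Lemma mxbin_curve L Y : polycurve (mxbin L Y).
Proof.
move=> l hl; exists (\sum_(k < L) l (mxpow k Y) *: binomp k).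
apply/funext => t; rewrite /= /mxbin lform_sum // horner_sum; apply: eq_bigr => k _.
by rewrite lformZ // [RHS]hornerZ mulrC.
Qed.

Lemma mxbin_nat L u s : mxpow L (u - 1%:M) = 0 -> mxbin L (u - 1%:M) s%:R = mxpow s u.
Proof.
have : u = 1%:M + (u - 1%:M) by rewrite addrC subrK.
move: (u - 1%:M) => Y -> hL.
have h0 k : (L <= k)%N -> mxpow k Y = 0.
  by move=> /subnK <-; rewrite /mxpow iterD -/(mxpow L Y) hL; elim: (k - L)%N => //= j ->;
    rewrite mulmx0.
elim: s => [|s IH].
  rewrite /mxbin; case: L hL {h0} => [|L] hL; first by rewrite big_ord0 -hL.
  rewrite big_ord_recl big1 => [|k _]; last by rewrite binomp_nat bin0n scale0r.
  by rewrite binomp_nat scale1r addr0.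
rewrite [RHS]/= -IH mulmxDl mul1mx /mxbin mulmx_sumr.
have -> : \sum_(k < L) Y *m ((binomp k).[s%:R] *: mxpow k Y) =
    \sum_(k < L) (if (k : nat) is k'.+1 then 'C(s, k')%:R else 0) *: mxpow k Y.
  rewrite (eq_bigr (fun k : 'I_L => 'C(s, k)%:R *: mxpow k.+1 Y)) => [|k _]; last first.
    by rewrite -scalemxAr binomp_nat.
  case: L hL h0 {IH} => [|L] _ h0; first by rewrite !big_ord0.
  rewrite big_ord_recr big_ord_recl /= -[Y *m mxpow L Y]/(mxpow L.+1 Y) h0 //.
  by rewrite scaler0 addr0 scale0r add0r.
rewrite -big_split; apply: eq_bigr => -[[|k] hk] _ /=; rewrite !binomp_nat -scalerDl.
  by rewrite !bin0 addr0.
by rewrite binS natrD.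
Qed.

Lemma mxpow_row k Y (v : 'rV_n) : v *m mxpow k Y = iter k (rmul Y) v.
Proof. by elim: k v => [|k IH] v; rewrite ?mulmx1 // iterSr -IH mulmxA. Qed.

Lemma mxnil_pow Y : mxnil Y -> exists L, mxpow L Y = 0.
Proof.
by move=> [L hL]; exists L; apply/row_matrixP => i; rewrite rowE mxpow_row hL row0.
Qed.

End BinomialCurve.

(** * From the unipotent radical to nilpotent ideals *)

Section Reductive.

Variables (K : numClosedFieldType) (n : nat).
Implicit Types (G N : set 'M[K]_n) (g u : 'M[K]_n).

(** Closedness relative to the invertible matrices: singular ones may satisfy the equations of
    [G]. *)
Definition mxclosed G := forall g : 'M[K]_n,
  g \in unitmx -> (forall p, vanishing G p -> p g = 0) -> G g.

Lemma invmx_eq g (h : 'M[K]_n) : g *m h = 1%:M -> invmx g = h.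
Proof.
by move=> e; have [ug _] := mulmx1_unit e; rewrite -[h]mul1mx -(mulVmx ug) -mulmxA e mulmx1.
Qed.

Variable G : set 'M[K]_n.
Hypothesis hG : mxgroup G.
Hypothesis cG : mxclosed G.

(* The image of [G] under [g |-> (g, g^-T)] is closed in the whole matrix
   space, unlike [G]. *)
Definition dbl g : 'M[K]_(n + n) := block_mx g 0 0 (invmx g)^T.
Definition dbl_group : set 'M[K]_(n + n) := [set dbl g | g in G].

Lemma mxgroup_unit g : G g -> g \in unitmx.
Proof. by have [_ _ GV] := hG; move=> /GV[h [_ /mulmx1_unit[]]]. Qed.

Lemma mxgroup_inv g : G g -> G (invmx g).
Proof. by have [_ _ GV] := hG; move=> /GV[h [Gh /invmx_eq -> _]]. Qed.

Lemma dblM g h : G g -> G h -> dbl (g *m h) = dbl g *m dbl h.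
Proof.
move=> /mxgroup_unit ug /mxgroup_unit uh; rewrite /dbl mulmx_block !mulmx0 !mul0mx !addr0 add0r.
rewrite -trmx_mul; congr (block_mx _ _ _ _^T).
by apply: invmx_eq; rewrite mulmxA -(mulmxA g) mulmxV // mulmx1 mulmxV.
Qed.

Lemma dbl1 : dbl 1%:M = 1%:M.
Proof. by rewrite /dbl invmx1 trmx1 -scalar_mx_block. Qed.

Lemma dbl_mxgroup : mxgroup dbl_group.
Proof.
have [G1 GM _] := hG; split.
- by exists 1%:M => //; exact: dbl1.
- by move=> _ _ [g Gg <-] [h Gh <-]; exists (g *m h); [exact: GM | exact: dblM].
- move=> _ [g Gg <-]; have ug := mxgroup_unit Gg; have Gi := mxgroup_inv Gg.
  exists (dbl (invmx g)); split; first by exists (invmx g).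
    by rewrite -dblM // mulmxV // dbl1.
  by rewrite -dblM // mulVmx // dbl1.
Qed.

Let usub_linear m1 m2 n1 n2 : linear (@ulsubmx K m1 m2 n1 n2).
Proof. by move=> a x y; apply/matrixP => i j; rewrite !mxE. Qed.

Let dsub_linear m1 m2 n1 n2 : linear (fun x => (@drsubmx K m1 m2 n1 n2 x)^T).
Proof. by move=> a x y; apply/matrixP => i j; rewrite !mxE. Qed.

Lemma dbl_closed (t : 'M[K]_(n + n)) : (forall p, vanishing dbl_group p -> p t = 0) -> dbl_group t.
Proof.
move=> ht.
have e2 : ursubmx t = 0.
  apply/matrixP => i j; rewrite !mxE; apply: (ht (mxentry (lshift n i) (rshift n j))).
  by split; [exact: polyfun_mxentry | move=> _ [g _ <-]; rewrite /mxentry block_mxEur mxE].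
have e3 : dlsubmx t = 0.
  apply/matrixP => i j; rewrite !mxE; apply: (ht (mxentry (rshift n i) (lshift n j))).
  by split; [exact: polyfun_mxentry | move=> _ [g _ <-]; rewrite /mxentry block_mxEdl mxE].
have e1 : ulsubmx t *m (drsubmx t)^T = 1%:M.
  apply/matrixP => i j; apply/eqP; rewrite -subr_eq0; apply/eqP.
  apply: (ht (fun t => (ulsubmx t *m (drsubmx t)^T) i j - cst ((1%:M : 'M_n) i j) t)); split.
    apply: (polyfunB _ (polyfun_cst _ _)); apply: polyfun_entry.
    apply: polymap_mulmx; [exact: polymap_linear (@usub_linear _ _ _ _) | exact: polymap_linear
      (@dsub_linear _ _ _ _)].
  move=> _ [g /mxgroup_unit ug <-].
  by rewrite block_mxKul block_mxKdr trmxK mulmxV // subrr.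
exists (ulsubmx t); last first.
  by rewrite /dbl (invmx_eq e1) trmxK -{3}[t]submxK e2 e3.
apply: cG; first by have [] := mulmx1_unit e1.
move=> q [pq hq]; apply: (ht (q \o ulsubmx)); split.
  exact: polyfun_comp (polymap_linear (@usub_linear _ _ _ _)) pq.
by move=> _ [g Gg <-]; rewrite /= block_mxKul; exact: hq.
Qed.

Lemma lie_dbl X : lie dbl_group X -> X = block_mx (ulsubmx X) 0 0 (drsubmx X).
Proof.
move=> hX; rewrite -[LHS]submxK; congr (block_mx _ _ _ _); apply/matrixP => i j; rewrite !mxE.
  have := hX (mxentry (lshift n i) (rshift n j)); rewrite dirD_lform /=; last exact: lform_mxentry.
  rewrite mulmx1.
  by apply; split; [exact: polyfun_mxentry | move=> _ [g _ <-]; rewrite /mxentry block_mxEur mxE].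
have := hX (mxentry (rshift n i) (lshift n j)); rewrite dirD_lform /=; last exact: lform_mxentry.
  rewrite mulmx1.
by apply; split; [exact: polyfun_mxentry | move=> _ [g _ <-]; rewrite /mxentry block_mxEdl mxE].
Qed.

Hypothesis rG : forall N, N `<=` G -> mxgroup N -> mxclosed N -> zconnected N ->
  (forall g h u, G g -> g *m h = 1%:M -> h *m g = 1%:M -> N u -> N (g *m u *m h)) ->
  (forall u, N u -> mxnil (u - 1%:M)) -> forall u, N u -> u = 1%:M.

Section Chain.

Variables (M : set 'M[K]_n) (L : nat).
Local Notation C := (engel_chain M).
Hypothesis CL : forall v, C L v.
Hypothesis MG : forall g h X, G g -> G h -> g *m h = 1%:M -> h *m g = 1%:M -> M X ->
  M (g *m X *m h).

Let CS i : subspace (C i) := engel_chain_subspace M i.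

Definition chain_step (Y : 'M[K]_n) := forall i v, C i.+1 v -> C i (v *m Y).

Let step_stable Y i v : chain_step Y -> C i v -> C i (v *m Y).
Proof.
move=> hY; case: i => [/= ->|i h]; first by rewrite mul0mx.
by apply: engel_chain_leS; exact: hY.
Qed.

(** Serves both the binomial series of a group element and the exponential series of a Lie algebra
    element. *)
Lemma step_sum Y k (c : nat -> K) : chain_step Y -> c 0%N = 1 ->
  chain_step (\sum_(j < k.+1) c j *: mxpow j Y - 1%:M).
Proof.
move=> hY c0 i v hv; rewrite big_ord_recl c0 scale1r addrC addrA addNr add0r mulmx_sumr.
apply: subspace_sum => // j _; rewrite -scalemxAr; apply: subspaceZ => //.
rewrite mxpow_row lift0 iterSr -[rmul Y v]/(v *m Y).
move: (nat_of_ord j) (v *m Y) (hY i v hv) => {j} j; elim: j => [|l IH] w hw //.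
by apply: (step_stable (v := iter l (rmul Y) w)) => //; exact: IH.
Qed.

Let chain_G g i v : G g -> C i v -> C i (v *m g).
Proof.
move=> Gg; elim: i v => [|i IH] v /=; first by move=> ->; rewrite mul0mx.
move=> hv Y MY; have [_ _ GV] := hG; have [h [Gh gh hg]] := GV g Gg.
have -> : v *m g *m Y = v *m (g *m Y *m h) *m g by rewrite -!mulmxA hg mulmx1.
by apply/IH/hv; exact: MG.
Qed.

Definition chain_group : set 'M[K]_n := [set g | G g /\ chain_step (g - 1%:M)].

Let step_nil Y i v : chain_step Y -> C i v -> iter i (rmul Y) v = 0.
Proof. by move=> hY; elim: i v => [|i IH] v // /hY/IH; rewrite iterSr. Qed.

Let step_unit g : chain_step (g - 1%:M) -> g \in unitmx.
Proof.
move=> hg; rewrite -row_free_unit; apply: inj_row_free => v vg.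
elim: L (CL v) => [//|i IH] /hg; rewrite mulmxBr vg mulmx1 => h; apply: IH.
by have := subspaceB (CS i) (CS i).1 h; rewrite !sub0r opprK.
Qed.

(** [G] preserves the chain because conjugation preserves [M], so this subgroup is normal; it is
    unipotent since the chain exhausts the space, and connected by binomial curves. *)
Lemma chain_group_trivial g : chain_group g -> g = 1%:M.
Proof.
have [G1 GM GV] := hG; apply: rG.
- by move=> ? [].
- split.
  + by split => // i v _; rewrite subrr mulmx0; exact: (CS i).1.
  + move=> u w [Gu hu] [Gw hw]; split; first exact: GM.
    move=> i v hv.
    have -> : v *m (u *m w - 1%:M) = v *m (u - 1%:M) *m w + v *m (w - 1%:M).
      by rewrite -mulmxA mulmxBl mul1mx -mulmxDr addrA subrK.
    by apply: subspaceD => //; [apply: chain_G => //; exact: hu | exact: hw].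
  + move=> u [Gu hu]; have [h [Gh uh hu']] := GV u Gu; exists h; split => //; split => // i v hv.
    have -> : v *m (h - 1%:M) = 0 - v *m (u - 1%:M) *m h.
      by rewrite -mulmxA mulmxBl uh mul1mx sub0r -mulmxN opprB.
    apply: subspaceB => //; first exact: (CS i).1.
    by apply: chain_G => //; exact: hu.
- move=> u uu hu; split; first by apply: cG => // p [pp hp]; apply: hu; split => // w [] /hp.
  (* Closedness of the lowering condition: w - projv U w vanishes exactly on [C i], which turns
     membership into linear equations. *)
  move=> i v hv; have [U hU] := subspace_vspace (CS i).1 (CS i).2.
  apply/hU; pose f w := w - projv U w.
  have fU w : w \in U -> f w = 0 by move=> h; rewrite /f projv_id // subrr.
  suff : f (v *m (u - 1%:M)) = 0.
    by move/eqP; rewrite subr_eq0 => /eqP ->; exact: memv_proj.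
  apply/rowP => j; rewrite [RHS]mxE.
  apply: (hu (fun u => f (v *m (u - 1%:M)) 0 j)); split; last first.
    by move=> w [_ hw]; rewrite fU ?mxE //; apply/hU; exact: hw.
  apply: polyfun_entry.
  have -> : (fun u => f (v *m (u - 1%:M))) = (fun u => f (v *m u) + f (- v)).
    apply/funext => w; rewrite /f mulmxBr mulmx1 [projv U (_ - _)]linearB linearN /=.
    by rewrite opprD addrACA.
  apply: polymapD; last exact: polymap_cst.
  apply: polymap_linear => a x y.
  by rewrite /f mulmxDr -scalemxAr linearP scalerBr opprD addrACA.
- apply: (@curve_connected _ _ _ 1%:M).
    by split => // i v _; rewrite subrr mulmx0; exact: (CS i).1.
  move=> u [Gu hu].
  have hL : mxpow L (u - 1%:M) = 0.
    by apply/row_matrixP => i; rewrite rowE mxpow_row row0; exact: step_nil.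
  (* The sum over [L.+1] has a constant term even when [L] is 0. *)
  have hL1 : mxpow L.+1 (u - 1%:M) = 0 by rewrite /mxpow iterS -/(mxpow L _) hL mulmx0.
  have nat_pow s : mxbin L.+1 (u - 1%:M) s%:R = mxpow s u by exact: mxbin_nat.
  exists (mxbin L.+1 (u - 1%:M)); split.
  + exact: (@mxbin_curve K n L.+1 (u - 1%:M)).
  + exact: (nat_pow 0%N).
  + by rewrite (nat_pow 1%N) /mxpow /= mulmx1.
  move=> t.
  have st : chain_step (mxbin L.+1 (u - 1%:M) t - 1%:M).
    apply: (@step_sum (u - 1%:M) L (fun k => (binomp K k).[t])) => //.
    by rewrite /binomp big_ord0 fact0 invr1 scale1r hornerC.
  split => //; apply: cG; first exact: step_unit.
  (* An equation of [G] vanishes on the powers of u, that is at all natural parameters of the curve,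
     hence identically. *)
  move=> p [pp hp]; have [P hP] := polycurve_comp (mxbin_curve L.+1 (u - 1%:M)) pp.
  rewrite -[LHS]/((p \o mxbin L.+1 (u - 1%:M)) t) hP.
  suff -> : P = 0 by rewrite horner0.
  apply: contrapT => /eqP nP.
  have : (size [seq (s%:R : K) | s <- iota 0 (size P)] < size P)%N.
    apply: max_poly_roots => //.
      apply/allP => _ /mapP[s _ ->]; rewrite rootE -hP /= nat_pow hp // /mxpow.
      by elim: s => //= s IH; exact: GM.
    by rewrite map_inj_uniq ?iota_uniq // => i j /eqP; rewrite eqr_nat => /eqP.
  by rewrite size_map size_iota ltnn.
- move=> h h' u Gh hh' h'h [Gu hu].
  have Gh' : G h' by rewrite -(invmx_eq hh'); exact: mxgroup_inv.
  split; first by apply: (GM) => //; apply: (GM).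
  move=> i v hv; have -> : v *m (h *m u *m h' - 1%:M) = v *m h *m (u - 1%:M) *m h'.
    by rewrite -[in LHS]hh' -mulmxBl -{2}[h]mulmx1 -mulmxBr !mulmxA.
  by apply: chain_G => //; apply: hu; exact: chain_G.
- by move=> u [_ hu]; exists L => v; exact: step_nil.
Qed.

End Chain.

(** Engel's theorem gives a chain lowered by the upper left blocks of [N]. The exponential of t X
    comes from an element of [chain_group], hence is 1, and its coefficient at t gives X = 0. *)
Lemma reductive_no_nil_ideal : no_nil_ideal dbl_group.
Proof.
move=> N NL N0 Nlin NB NG Nnil X NX.
have hd := dbl_mxgroup.
have blk Y : N Y -> Y = block_mx (ulsubmx Y) 0 0 (drsubmx Y) by move=> /NL/lie_dbl.
pose M : set 'M[K]_n := [set Y | exists2 X, N X & Y = ulsubmx X].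
have ulpow k (A D : 'M[K]_n) : mxpow k (block_mx A 0 0 D) = block_mx (mxpow k A) 0 0 (mxpow k D).
  elim: k => [|k IH]; first by rewrite /mxpow /= -scalar_mx_block.
  by rewrite /mxpow !iterS -/(mxpow _ _) IH mulmx_block !mulmx0 !mul0mx !addr0 add0r.
have [||||L CL] := @engel K n M.
- by exists 0 => //; apply/matrixP => i j; rewrite !mxE.
- by move=> a _ _ [Y NY ->] [Z NZ ->]; exists (a *: Y + Z); [exact: Nlin | rewrite usub_linear].
- move=> _ _ [Y NY ->] [Z NZ ->]; exists (Y *m Z - Z *m Y); first exact: NB.
  rewrite {3 4}(blk Y NY) {3 4}(blk Z NZ) !mulmx_block !mulmx0 !mul0mx !addr0 !add0r.
  by rewrite opp_block_mx add_block_mx block_mxKul.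
- move=> _ [Y NY ->]; have [k hk] := mxnil_pow (Nnil Y NY); exists k => v.
  rewrite -mxpow_row; move: hk; rewrite (blk Y NY) ulpow block_mxKul.
  by rewrite -[RHS]block_mx0 => /eq_block_mx[-> _ _ _]; rewrite mulmx0.
have MG g h Y : G g -> G h -> g *m h = 1%:M -> h *m g = 1%:M -> M Y -> M (g *m Y *m h).
  move=> Gg Gh gh hg [Z NZ ->]; exists (dbl g *m Z *m dbl h).
    by apply: NG => //; [by exists g | by exists h | |]; rewrite -dblM // ?gh ?hg dbl1.
  by rewrite (blk Z NZ) /dbl !mulmx_block !mulmx0 !mul0mx !addr0 !add0r !block_mxKul.
have [k hk] := mxnil_pow (Nnil X NX).
(* With k + 2 terms the truncated exponential always contains its linear term. *)
have hk2 : mxpow k.+2 X = 0 by rewrite /mxpow !iterS -/(mxpow k X) hk !mulmx0.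
have exp1 t : mxexp k.+2 X t = 1%:M.
  have [g Gg eg] := lie_exp hd dbl_closed t (NL X NX) hk2.
  suff g1 : g = 1%:M by rewrite -eg g1 dbl1.
  apply: (chain_group_trivial CL MG); split => //.
  have -> : g = \sum_(j < k.+2) (t ^+ j / j`!%:R) *: mxpow j (ulsubmx X).
    have -> : g = ulsubmx (dbl g) by rewrite block_mxKul.
    rewrite eg; apply/matrixP => i j; rewrite !mxE !summxE; apply: eq_bigr => l _.
    rewrite -/(mxpow l X) [X in mxpow l X](blk X NX) ulpow.
    by rewrite mxE block_mxEul [RHS]mxE.
  apply: (@step_sum M (ulsubmx X) k.+1 (fun j => t ^+ j / j`!%:R));
    last by rewrite expr0 fact0 divr1.
  by move=> i v hv; apply: hv; exists X.
apply/matrixP => i j; rewrite [RHS]mxE.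
pose P : {poly K} := \poly_(l < k.+2) (mxpow l X i j / l`!%:R).
have : P = ((1%:M : 'M[K]_(n + n)) i j)%:P.
  apply: horner_eq_inj => t; rewrite hornerC -(exp1 t) /P horner_poly /mxexp summxE.
  apply: eq_bigr => l _; rewrite [RHS]mxE -/(mxpow l X); ring.
move/(congr1 (fun p : {poly K} => p`_1)); rewrite coef_poly /= coefC /= divr1.
by rewrite /mxpow /= mulmx1.
Qed.

End Reductive.

(** * Covariants and separation of orbits *)

Section Covariants.

Variables (K : numClosedFieldType) (n : nat) (G : set 'M[K]_n).
Local Notation V := 'cV[K]_n.
Hypothesis hG : mxgroup G.
Hypothesis cG : mxclosed G.
Hypothesis nG : no_nil_ideal (dbl_group G).

Definition closed_orbit (x : V) := forall z : V,
  (forall p, polyfun p -> (forall g, G g -> p (g *m x) = 0) -> p z = 0) ->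
  exists2 g, G g & z = g *m x.

Definition free_point (x : V) := forall g, G g -> g *m x = x -> g = 1%:M.

Definition same_invariants (x y : V) := forall p, polyfun p ->
  (forall g z, G g -> p (g *m z) = p z) -> p x = p y.

Let up (z : V) : 'cV[K]_(n + n) := col_mx z 0.

Let up_linear : linear up.
Proof. by move=> a x y; rewrite /up scale_col_mx add_col_mx scaler0 addr0. Qed.

Let dblup g z : dbl g *m up z = up (g *m z).
Proof. by rewrite /dbl /up mul_block_col !mul0mx !mulmx0 !addr0. Qed.

Let usub_linear k : linear (@usubmx K n n k).
Proof. by move=> a x y; apply/matrixP => i j; rewrite !mxE. Qed.

Lemma free_orbit_section (x : V) : closed_orbit x -> free_point x ->
  exists2 F : V -> 'M[K]_n, polymap F & forall g, G g -> F (g *m x) = g.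
Proof.
move=> ox fx.
have [||F pF hF] := @orbit_section K _ (dbl_group G) (up x) (dbl_mxgroup hG) (dbl_closed hG cG).
- move=> _ [g Gg <-]; rewrite dblup => /eq_col_mx[/(fx g Gg) -> _]; exact: dbl1.
- move=> z hz.
  have z2 : dsubmx z = 0.
    apply/colP => i; rewrite !mxE; apply: (hz (mxentry (rshift n i) 0));
      first exact: polyfun_mxentry.
    by move=> _ [g _ <-]; rewrite dblup /mxentry col_mxEd mxE.
  have [p pp hp|g Gg e] := ox (usubmx z).
    apply: (hz (p \o @usubmx K n n 1)).
      exact: polyfun_comp (polymap_linear (@usub_linear _)) pp.
    by move=> _ [g Gg <-]; rewrite dblup /= col_mxKu; exact: hp.
  by exists (dbl g); [exists g | rewrite dblup -e -[LHS]vsubmxK z2].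
exists (fun z => ulsubmx (F (up z))).
  apply: (polymap_comp (h' := fun t => ulsubmx t)); last first.
    by apply: polymap_linear => a s t; apply/matrixP => i j; rewrite !mxE.
  by apply: (polymap_comp (h := up)) pF; exact: polymap_linear.
move=> g Gg; rewrite -dblup hF; last by exists g.
exact: block_mxKul.
Qed.

(** Pairs (z, b) on which [dbl g] acts by (g z, b g^-1): the lower block supplies the dual
    representation. *)
Let io (z : V) (b : 'M[K]_n) : 'M[K]_(n + n, 1 + n) := block_mx z 0 0 b^T.

Let dblio g z b : G g -> dbl g *m io z b = io (g *m z) (b *m invmx g).
Proof.
move=> Gg; rewrite /dbl /io mulmx_block !mulmx0 !mul0mx !addr0 add0r.
by rewrite trmx_mul.
Qed.

Let trE (M : 'M[K]_n) i j : \tr (delta_mx i j *m M) = M j i.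
Proof.
rewrite /mxtrace (bigD1 i) //= big1 ?addr0 => [|k ki]; rewrite mxE.
  rewrite (bigD1 j) //= big1 ?addr0 => [|l lj]; rewrite mxE ?eqxx ?mul1r //.
  by rewrite (negbTE lj) andbF mul0r.
by rewrite big1 // => l _; rewrite mxE (negbTE ki) mul0r.
Qed.

Let tr_inj (M N : 'M[K]_n) : (forall b, \tr (b *m M) = \tr (b *m N)) -> M = N.
Proof. by move=> h; apply/matrixP => i j; have := h (delta_mx j i); rewrite !trE. Qed.

Let trmul_linear (M : 'M[K]_n) : linear (fun b : 'M[K]_n => \tr (b *m M) : K^o).
Proof. by move=> a b c; rewrite mulmxDl mxtraceD -scalemxAl mxtraceZ. Qed.

(* Linear reductivity applied to the functions [(z, b) |-> tr (b F z)]. *)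
Theorem covariant_exists (x : V) : closed_orbit x -> free_point x ->
  exists F : V -> 'M[K]_n, [/\ polymap F, F x = 1%:M
    & forall g z, G g -> F (g *m z) = g *m F z].
Proof.
move=> ox fx; have [G1 _ _] := hG; have [F0 pF0 hF0] := free_orbit_section ox fx.
have [n0|] := posnP n.
  exists F0; split => // [|g z Gg]; first by rewrite -{1}[x]mul1mx hF0.
  by apply/matrixP => i; have := ltn_ord i; rewrite {2}n0.
move=> n0; pose e0 := Ordinal n0.
(* On such functions the evaluation at (x, b) is invariant, since tr(b g^-1 g) = tr(b); the orbit
   section [F0] provides one with c = 1. *)
pose A : set ('M[K]_(n + n, 1 + n) -> K) := [set f | [/\ polyfun f,
  exists c, forall g b, G g -> f (io (g *m x) b) = c * \tr (b *m g)
  & forall z a b b', f (io z (a *: b + b')) = a * f (io z b) + f (io z b')]].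
have [||||||f [[pf [c fc] fl] finv f0]] := @invariant_exists K _ _ (dbl_group G) (dbl_mxgroup hG) nG
    A _ _ _ _ (io x (delta_mx e0 e0)).
- by move=> f [].
- split; first exact: polyfun0.
    by exists 0 => g b _; rewrite mul0r.
  by move=> z a b b'; rewrite mulr0 addr0.
- move=> a f g [pf [c fc] fl] [pg [d gd] gl]; split.
  + by apply: polyfunD pg; apply: polyfunM pf; exact: polyfun_cst.
  + by exists (a * c + d) => h b Gh; rewrite !fctE fc // gd // mulrDl mulrA.
  + by move=> z t b b'; rewrite !fctE fl gl; ring.
- move=> _ f [g Gg <-] [pf [c fc] fl]; split.
  + apply: (polyfun_comp _ pf); apply: polymap_linear => a s t.
    by rewrite mulmxDr -scalemxAr.
  + exists c => h b Gh; rewrite /= dblio // mulmxA fc; last by case: hG => _ GM _; exact: GM.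
    by rewrite -mulmxA (mulmxA (invmx g)) mulVmx ?mul1mx // (mxgroup_unit hG).
  + by move=> z t b b'; rewrite /= !dblio // mulmxDl -scalemxAl fl.
- move=> _ f [g Gg <-] [pf [c fc] fl]; rewrite dblio // fc // -[x]mul1mx fc //.
  by rewrite mulmx1 -mulmxA mulVmx ?mulmx1 // (mxgroup_unit hG).
- exists (fun t => \tr ((drsubmx t)^T *m F0 (ulsubmx t))); last first.
    by rewrite block_mxKdr block_mxKul trmxK -{1}[x]mul1mx hF0 // mulmx1 /= -[X in \tr X]mulmx1
      trE mxE eqxx oner_neq0.
  split.
  + have ptr : polyfun (fun M : 'M[K]_n => \tr M).
      by apply: polyfun_lform => a s t; rewrite mxtraceD mxtraceZ.
    apply: (polyfun_comp (h := fun t => (drsubmx t)^T *m F0 (ulsubmx t)) _ ptr).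
    apply: polymap_mulmx.
      by apply: polymap_linear => a s t; apply/matrixP => i j; rewrite !mxE.
    apply: (polymap_comp _ pF0); apply: polymap_linear => a s t.
    by apply/matrixP => i j; rewrite !mxE.
  + by exists 1 => g b Gg; rewrite block_mxKdr block_mxKul trmxK hF0 // mul1r.
  + by move=> z a b b'; rewrite !block_mxKdr !block_mxKul !trmxK trmul_linear.
have c0 : c != 0.
  by apply: contraNneq f0 => c0; rewrite -{1}[x]mul1mx fc // c0 mul0r.
(* The trace pairing turns a function linear in [b] back into a matrix, normalized by [c]. *)
pose F z : 'M[K]_n := \matrix_(i, j) (c^-1 * f (io z (delta_mx j i))).
have FE z b : f (io z b) = c * \tr (b *m F z).
  have lf : lform (fun b : 'M[K]_n => f (io z b)) by move=> a s t; rewrite fl.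
  rewrite (lform_mxE b lf) /mxtrace mulr_sumr; apply: eq_bigr => i _.
  by rewrite mxE mulr_sumr; apply: eq_bigr => j _; rewrite mxE; field.
exists F; split.
- apply: polymap_mx => i j.
  rewrite (_ : (fun _ => _) = cst c^-1 * (f \o (fun z => io z (delta_mx j i)))); last first.
    by apply/funext => z; rewrite mxE.
  apply: polyfunM; first exact: polyfun_cst.
  apply: polyfun_comp pf.
  have -> : (fun z => io z (delta_mx j i)) = (fun z => io z 0 + io 0 (delta_mx j i)).
    by apply/funext => z; rewrite /io add_block_mx trmx0 !addr0 add0r.
  apply: polymapD; last exact: polymap_cst.
  by apply: polymap_linear => a s t; rewrite /io scale_block_mx add_block_mx trmx0 !scaler0 !addr0.
- apply: tr_inj => b; apply: (mulfI c0); rewrite -FE -{1}[x]mul1mx fc //.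
move=> g z Gg; apply: tr_inj => b; apply: (mulfI c0); rewrite -FE.
have ug := mxgroup_unit hG Gg.
have := finv (dbl g) (io z (b *m g)) (ex_intro2 _ _ g Gg erefl).
by rewrite dblio // mulmxK // => ->; rewrite FE mulmxA.
Qed.

(* Otherwise the ideals of the two orbits are comaximal, and linear reductivity
   turns an identity [1 = p + q] into an invariant separating the orbits. *)
Lemma same_invariants_closure (x y : V) : closed_orbit x -> same_invariants x y ->
  forall q, polyfun q -> (forall g, G g -> q (g *m y) = 0) -> q x = 0.
Proof.
move=> ox xy; have [G1 GM GV] := hG.
have act_poly g : polymap (fun z : V => g *m z).
  by apply: polymap_linear => a s t; rewrite mulmxDr -scalemxAr.
pose I z : set (V -> K) := vanishing [set g *m z | g in G].
have hI z : pideal (I z) by exact: vanishing_pideal.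
have : exists z, forall p, pideal_add (I x) (I y) p -> p z = 0.
  apply: contrapT => /forallNP hz.
  have [|p1 [pp hp] [pq hq]] := weak_nullstellensatz (pideal_addP (hI x) (hI y)).
    move=> z; have /existsNP[p /not_implyP[Ip /eqP pz]] := hz z; by exists p.
  (* Functions vanishing on the orbit of [x] and constant on that of [y]. [p1] gives one equal to 1
     on the latter, and an invariant among them, nonzero at [y], contradicts [xy]. *)
  pose A : set ('cV[K]_(n + n) -> K) := [set f | [/\ polyfun f,
    forall g, G g -> f (up (g *m x)) = 0 & exists c, forall g, G g -> f (up (g *m y)) = c]].
  have [||||||f [[pf fx [c fy]] finv f0]] := @invariant_exists K _ _ (dbl_group G) (dbl_mxgroup
    hG) nG
    A _ _ _ _ (up y).
  - by move=> f [].
  - by split => //; [exact: polyfun0 | exists 0].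
  - move=> a f g [pf fx [c fy]] [pg gx [d gy]]; split.
    + by apply: polyfunD pg; apply: polyfunM pf; exact: polyfun_cst.
    + by move=> h Gh; rewrite !fctE fx // gx // mulr0 addr0.
    + by exists (a * c + d) => h Gh; rewrite !fctE fy // gy.
  - move=> _ f [g Gg <-] [pf fx [c fy]]; split.
    + apply: (polyfun_comp _ pf); apply: polymap_linear => a s t.
      by rewrite mulmxDr -scalemxAr.
    + by move=> h Gh; rewrite /= dblup mulmxA fx //; exact: GM.
    + by exists c => h Gh; rewrite /= dblup mulmxA fy //; exact: GM.
  - move=> _ f [g Gg <-] [pf fx [c fy]]; rewrite dblup fy //.
    by rewrite -[y]mul1mx fy.
  - exists (p1 \o @usubmx K n n 1); last first.
      have := hq y (ex_intro2 _ _ 1%:M G1 (mul1mx y)).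
      rewrite /= col_mxKu !fctE => /eqP; rewrite subr_eq0 => /eqP <-; exact: oner_neq0.
    split.
    + exact: polyfun_comp (polymap_linear (@usub_linear _)) pp.
    + by move=> g Gg; rewrite /= col_mxKu; apply: hp; exists g.
    + exists 1 => g Gg; rewrite /= col_mxKu.
      have := hq (g *m y) (ex_intro2 _ _ g Gg erefl).
      by rewrite !fctE => /eqP; rewrite subr_eq0 => /eqP <-.
  have pfu : polyfun (f \o up) by exact: polyfun_comp (polymap_linear up_linear) pf.
  have /eqP := xy (f \o up) pfu (fun g z Gg => etrans (congr1 f (esym (dblup g z))) (finv _ _
    (ex_intro2 _ _ g Gg erefl))).
  by rewrite /= -{1}[x]mul1mx fx // eq_sym (negbTE f0).
move=> [z hz] q pq hq.
have [g Gg ez] : exists2 g, G g & z = g *m x.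
  apply: ox => p pp hp; apply: hz; apply: sub_pideal_addl => //.
  by split => // _ [h Gh <-]; exact: hp.
have [h [Gh gh hg]] := GV g Gg.
have -> : q x = (q \o (fun z : V => h *m z)) z by rewrite /= ez mulmxA hg mul1mx.
apply: hz; apply: sub_pideal_addr => //; split; first exact: polyfun_comp pq.
by move=> _ [k Gk <-]; rewrite /= mulmxA; apply: hq; exact: GM.
Qed.

(** Polynomial identities valid on the orbit of [y] hold at [x]. On that orbit F(g y) = g M with M =
    F(y), so F(z) M^-1 lies in [G] and F(z) M^-1 y = z; at z = x, where F is 1, this gives M^-1 in
    [G] and M^-1 y = x. *)
Theorem same_invariants_orbit (x y : V) : closed_orbit x -> free_point x ->
  same_invariants x y -> exists2 g, G g & y = g *m x.
Proof.
move=> ox fx xy; have [G1 GM GV] := hG; have [F [pF Fx FG]] := covariant_exists ox fx.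
have clo := same_invariants_closure ox xy.
have dF : \det (F y) != 0.
  apply/eqP => d0.
  have e : \det (F x) = 0.
    by apply: (clo (fun z => \det (F z)) (polyfun_det pF)) => g Gg;
      rewrite FG // det_mulmx d0 mulr0.
  by move/eqP: e; rewrite Fx det1 oner_eq0.
have uF : F y \in unitmx by rewrite unitmxE unitfE.
set M := F y in dF uF.
have GMi : G (invmx M).
  apply: cG; first by rewrite unitmx_inv.
  move=> p [pp hp].
  have <- : p (F x *m invmx M) = p (invmx M) by rewrite Fx mul1mx.
  apply: (clo (p \o (fun z => F z *m invmx M))).
    by apply: polyfun_comp pp; apply: polymap_mulmx => //; exact: polymap_cst.
  by move=> g Gg; rewrite /= FG // -/M mulmxK // hp.
have GM' : G M by have := mxgroup_inv hG GMi; rewrite invmxK.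
exists M => //.
suff <- : invmx M *m y = x by rewrite mulmxA mulmxV // mul1mx.
apply/colP => i; apply/eqP; rewrite -subr_eq0; apply/eqP.
have -> : (invmx M *m y) i 0 - x i 0 = (F x *m (invmx M *m y) - x) i 0.
  by rewrite Fx mul1mx [RHS]mxE [X in _ = _ + X]mxE.
apply: (clo (fun z => (F z *m (invmx M *m y) - z) i 0)).
  apply: polyfun_entry.
  have -> : (fun z : V => F z *m (invmx M *m y) - z) = (fun z => F z *m (invmx M *m y) + (-1) *: z).
    by apply/funext => z; rewrite scaleN1r.
  apply: polymapD.
    by apply: polymap_mulmx => //; exact: polymap_cst.
  by apply: polymap_linear => a s t; rewrite scalerDr !scalerA mulrC.
move=> g Gg; rewrite FG // -/M -mulmxA (mulmxA M) mulmxV // mul1mx subrr mxE //.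
Qed.

End Covariants.

(** * Codimension *)

(** Over the fraction field of [B], the prime [P] is generated by an irreducible polynomial, so no
    nonzero prime lies strictly below it. Here [r] plays this polynomial, with divisions up to
    powers of its leading coefficient. *)
Lemma prime_chain (B : idomainType) (P Q : set {poly B}) :
  prime_ideal P -> prime_ideal Q -> Q `<=` P -> (forall b, b != 0 -> ~ P b%:P) ->
  (exists2 q, Q q & q != 0) -> P `<=` Q.
Proof.
move=> [[P0 PD PM] _ _] [[Q0 QD QM] Q1 QQ] QP PB [q0 Qq0 nq0].
have [|q [Qq nq] qmin] := @ex_min_nat {poly B} (fun p => size p) [set q | Q q /\ q != 0].
  by exists q0.
have [|r [Pr nr] rmin] := @ex_min_nat {poly B} (fun p => size p) [set r | P r /\ r != 0].
  by exists q0; split => //; exact: QP.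
have div h : P h -> exists a k, (lead_coef r ^+ k)%:P * h = a * r.
  move=> Ph; exists (h %/ r)%R, (scalp h r).
  have e := Pdiv.Idomain.divp_eq h r.
  have : P (h %% r).
    have -> : h %% r = (lead_coef r ^+ scalp h r)%:P * h + (- (h %/ r)) * r.
      by rewrite mul_polyC e mulNr addrC addKr.
    by apply: (PD); apply: (PM).
  move=> Prem; rewrite mul_polyC e; have [->|nz] := eqVneq (h %% r) 0; first by rewrite addr0.
  have := rmin (h %% r) (conj Prem nz).
  by rewrite leqNgt Pdiv.Idomain.ltn_modp nr.
have lr k : lead_coef r ^+ k != 0 by rewrite expf_neq0 // lead_coef_eq0.
have Qr : Q r.
  have [a [k e]] := div q (QP q Qq).
  have : Q (a * r) by rewrite -e; exact: QM.
  case/QQ => // Qa.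
  have na : a != 0.
    apply: contraTneq nq => a0; move: e; rewrite a0 mul0r => /eqP.
    by rewrite mulf_eq0 polyC_eq0 (negbTE (lr k)) /= => ->.
  have := qmin a (conj Qa na).
  have : size (a * r) = size q by rewrite -e mul_polyC size_scale.
  rewrite size_mul // => <-; rewrite -ltnS prednK; last by rewrite addn_gt0 lt0n size_poly_eq0 na.
  have [sr|] := leqP (size r) 1.
    case: (PB r`_0) => //; last by rewrite -size1_polyC.
    by move: nr; rewrite (size1_polyC sr) polyC_eq0 coefC.
  by move=> sr; rewrite -[X in (_ <= X)%N]addn1 leq_add2l leqNgt sr.
move=> h Ph; have [a [k e]] := div h Ph.
have : Q ((lead_coef r ^+ k)%:P * h) by rewrite e; exact: QM.
by case/QQ => // /QP /PB; case.
Qed.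

Section Codimension.

Variables (K : numClosedFieldType) (W : vectType K).
Implicit Types (A : set W) (u : W).

Lemma zclosureP A x : zclosure A x <-> forall p, vanishing A p -> p x = 0.
Proof.
split=> [h p [pp hp]|h _ [S pS ->] AS p Sp].
  have := h [set y | forall q, [set p] q -> q y = 0]; apply=> //; last by move=> y Ay q ->;
    exact: hp.
  by exists [set p] => // q ->.
by apply: h; split; [exact: pS | move=> y /AS; apply].
Qed.

Lemma zclosed_vanishing A x : zclosed A -> ~ A x -> exists2 p, vanishing A p & p x != 0.
Proof.
move=> [S pS ->] /existsNP[p /not_implyP[Sp /eqP px]]; exists p => //.
by split; [exact: pS | move=> y; apply].
Qed.

Lemma zclosed_zeros (S : set (W -> K)) : S `<=` @polyfun K W ->
  zclosed [set x | forall p, S p -> p x = 0].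
Proof. by move=> h; exists S. Qed.

Lemma basis_with_last u : u != 0 -> exists n (X : n.+1.-tuple W), basis_of fullv X /\ X`_n = u.
Proof.
move=> u0; exists (\dim <[u]>^C), [tuple of rcons (vbasis <[u]>^C) u]; split.
  rewrite /= -(addv_complf <[u]>) addvC.
  suff : basis_of (<[u]>^C + <[u]>) (vbasis <[u]>^C ++ [:: u]) by rewrite cats1.
  apply: cat_basis.
  - by apply/directv_addP; rewrite capvC capv_compl.
  - exact: vbasisP.
  - exact: seq1_basis.
by rewrite nth_rcons size_tuple ltnn eqxx.
Qed.

Lemma coord_zero_exists (v : W) : v != 0 -> exists2 l : W -> K, lform l & l v != 0.
Proof.
move=> v0; apply: contrapT => H.
suff /eqP : v = 0 by rewrite (negbTE v0).
rewrite (coord_vbasis (memvf v)) big1 // => i _.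
have [->|ci] := eqVneq (coord (vbasis {:W}) i v) 0; first by rewrite scale0r.
by case: H; exists (coord (vbasis {:W}) i) => //; exact: lform_coord.
Qed.

Lemma ipoly_neq0 n (X : n.+1.-tuple W) m (b : ipoly K m) : basis_of fullv X -> (m <= n.+1)%N ->
  b != 0 -> exists x, iev_at X b x != 0.
Proof.
move=> hX mn b0.
have [||v [_ hv]] := @prime_ideal_zero K m [set 0] b.
- split; [split => //= | by apply/eqP; exact: oner_neq0 |].
  + by move=> x y -> ->; rewrite addr0.
  + by move=> a x ->; rewrite mulr0.
  by move=> x y /= /eqP; rewrite mulf_eq0 => /orP[] /eqP; [left | right].
- by move=> /= /eqP; rewrite (negbTE b0).
have [x hx] := chart_surj hX v; exists x.
by rewrite /iev_at (@iev_ext K m _ v) // => i im; apply/hx/(leq_trans im).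
Qed.

(* If every equation of [A] involves the last coordinate, a prime ideal above
   the equations of [A] and without nonzero constants in that coordinate defines
   a hypersurface inside the closure of [A]. *)
Theorem codim2_direction A (w0 : W) : w0 != 0 -> codim_ge 2 A ->
  exists u (b : W -> K), [/\ u != 0, ~ zclosure A u, polyfun b, exists v, b v != 0
    & (forall v s, b (v + s *: u) = b v) /\ forall v, zclosure A v -> b v = 0].
Proof.
move=> nw0 cA.
(* [A] is not dense: the whole space is irreducible, and no set lies strictly above it. *)
have [r0 [pr0 hr0] [x0 rx0]] : exists2 r, vanishing A r & exists x, r x != 0.
  apply: contrapT => H.
  have full x : zclosure A x.
    apply/zclosureP => p hp; apply: contrapT => /eqP px.
    by apply: H; exists p => //; exists x.
  have [||x _|c [c0 _ /(_ 0%N isT)[_]]] := cA setT.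
  - by exists set0 => //; apply/seteqP; split => // x _ p.
  - split; first by exists 0.
    move=> Y Z cY cZ hYZ; apply: contrapT => /not_orP[].
    move=> /existsNP[y /not_implyP[_ Yy]] /existsNP[z /not_implyP[_ Zz]].
    have [p [pp hp] py] := zclosed_vanishing cY Yy.
    have [q [pq hq] qz] := zclosed_vanishing cZ Zz.
    have [t] := polyfun_mul_neq0 pp pq py qz.
    by case: (hYZ t I) => [/hp|/hq] ->; rewrite ?mul0r ?mulr0 eqxx.
  - exact: full.
  by rewrite c0; apply.
have [l hl lw0] := coord_zero_exists nw0.
have [u] := polyfun_mul_neq0 pr0 (polyfun_lform hl) rx0 lw0.
rewrite mulf_eq0 negb_or => /andP[ru lu].
have nu : u != 0 by apply: contraNneq lu => ->; rewrite lform0.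
have nAu : ~ zclosure A u by move=> /zclosureP/(_ r0 (conj pr0 hr0))/eqP; rewrite (negbTE ru).
have [n [X [hX Xn]]] := basis_with_last nu.
pose ev (h : ipoly K n.+1) : W -> K := iev_at X h.
have evP p : polyfun p -> exists h, p = ev h by exact: polyfun_iev_at.
have evM h h' x : ev (h * h') x = ev h x * ev h' x by rewrite /ev /iev_at rmorphM.
have evD h h' x : ev (h + h') x = ev h x + ev h' x by rewrite /ev /iev_at rmorphD.
have ev0 x : ev 0 x = 0 by rewrite /ev /iev_at rmorph0.
have ev1 x : ev 1 x = 1 by rewrite /ev /iev_at rmorph1.
have pev h : polyfun (ev h) by exact: iev_at_polyfun.
pose I (Z : set W) : set (ipoly K n.+1) := [set h | forall x, Z x -> ev h x = 0].
have hI Z : ideal (I Z).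
  split; first by move=> x _; exact: ev0.
  - by move=> h h' Ih Ih' x Zx; rewrite evD Ih // Ih' // addr0.
  - by move=> a h Ih x Zx; rewrite evM Ih // mulr0.
(* The last coordinate is the one along [u], so an equation not involving it is constant in the
   direction [u]. *)
have [[b nb Ib]|noB] := pselect (exists2 b : ipoly K n, b != 0 & I A (b%:P : {poly ipoly K n})).
  have evb x : ev (b%:P : {poly ipoly K n}) x = iev_at X b x.
    by rewrite /ev /iev_at /= map_polyC /horner_eval hornerC.
  exists u, (iev_at X b); split => //; first exact: iev_at_polyfun.
    exact: (ipoly_neq0 hX (leqnSn n) nb).
  split=> [v s|v /zclosureP]; last by apply; split => [|x Ax];
    [exact: iev_at_polyfun | rewrite -evb; exact: Ib].
  apply: iev_ext => i ni; rewrite /chart insubT ?ltnS 1?ltnW //= => hi.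
  rewrite linearD linearZ /= -Xn.
  rewrite (_ : X`_n = X`_(Ordinal (ltnSn n))) // coord_free ?(basis_free hX) //.
  by rewrite -val_eqE /= gtn_eqF // mulr0 addr0.
exfalso.
have [|||P [hP IP PB]] := @prime_disjoint _ (I A) [set h | exists2 b : ipoly K n,
  b != 0 & h = (b%:P : {poly ipoly K n})] _ _ (hI A).
- by exists 1; [exact: oner_neq0 | rewrite polyC1].
- move=> _ _ [b nb ->] [c nc ->]; exists (b * c); last by rewrite polyCM.
  by rewrite mulf_neq0.
- by apply/seteqP; split => // h [Ih [b nb e]]; apply: noB; exists b => //; rewrite -e.
pose Z := [set x | forall p, [set ev h | h in P] p -> p x = 0].
have cZ : zclosed Z by apply: zclosed_zeros => _ [h _ <-].
have ZP h x : P h -> Z x -> ev h x = 0 by move=> Ph; apply; exists h.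
have IZ h : I Z h -> P h.
  move=> Ih; apply: contrapT => nPh.
  have [v [hv hc]] := prime_ideal_zero hP nPh.
  have [x hx] := chart_surj hX v.
  have evv h' : ev h' x = iev n.+1 v h' by apply: iev_ext.
  have : Z x by move=> _ [h' Ph' <-]; rewrite evv; exact: hv.
  by move=> /Ih/eqP; rewrite evv (negbTE hc).
have irrP (Y : set W) : zirreducible Y <-> prime_ideal (I Y).
  split=> [[[y Yy] irr]|[_ I1 IM]].
    split => //; first by move=> /(_ y Yy)/eqP; rewrite ev1 oner_eq0.
    move=> h h' Ihh'.
    have [||t Yt||] := irr [set x | forall p, [set ev h] p -> p x = 0] [set x | forall p,
      [set ev h'] p -> p x = 0].
    - by apply: zclosed_zeros => _ ->.
    - by apply: zclosed_zeros => _ ->.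
    - have /eqP := Ihh' t Yt; rewrite evM mulf_eq0 => /orP[] /eqP e; [left | right] => _ -> //.
    - by move=> H; left => x Yx; apply: H.
    - by move=> H; right => x Yx; apply: H.
  split; first by apply: contrapT => H; apply: I1 => x Yx; case: H; exists x.
  move=> Y1 Y2 cY1 cY2 hY; apply: contrapT => /not_orP[].
  move=> /existsNP[y /not_implyP[Yy Y1y]] /existsNP[z /not_implyP[Yz Y2z]].
  have [p [/evP[h ->] hp] py] := zclosed_vanishing cY1 Y1y.
  have [q [/evP[h' ->] hq] qz] := zclosed_vanishing cY2 Y2z.
  have [x Yx|/(_ y Yy)/eqP|/(_ z Yz)/eqP] := IM h h'.
  - by rewrite evM; case: (hY x Yx) => [/hp|/hq] ->; rewrite ?mul0r ?mulr0.
  - by rewrite (negbTE py).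
  - by rewrite (negbTE qz).
have PIZ : I Z = P by apply/seteqP; split => h; [exact: IZ | move=> Ph x; exact: ZP].
have [|x Zx|c [c0 hc cs]] := cA Z cZ.
- by apply/irrP; rewrite PIZ.
- apply/zclosureP => _ [/evP[h ->] hp]; apply: ZP Zx; apply: IP => y Ay; exact: hp.
(* The middle term of the chain gives a nonzero prime inside [P], which [prime_chain] identifies
   with [P], against strictness. *)
have [[[cc1 ic1] s01] s12] := (hc 1%N isT, cs 0%N isT, cs 1%N isT).
rewrite c0 in s01; move: s01 s12 => -[Zc1 nc1] [c12 nc2].
apply: nc1 => y c1y; apply: contrapT => nZy.
have hQ : prime_ideal (I (c 1%N)) by exact/irrP.
have QP : I (c 1%N) `<=` P by move=> h Ih; apply: IZ => x /Zc1; exact: Ih.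
have PBn (b : ipoly K n) : b != 0 -> ~ P (b%:P : {poly ipoly K n}).
  by move=> nb Pb; have : set0 (b%:P : {poly ipoly K n}) by rewrite -PB; split => //; exists b.
have nQ : exists2 q, I (c 1%N) q & q != 0.
  have /existsNP[z /not_implyP[_ nz]] := nc2.
  have [p [/evP[h ->] hp] pz] := zclosed_vanishing cc1 nz.
  exists h => //; apply: contraNneq pz => ->; rewrite ev0 //.
have PQ := prime_chain hP hQ QP PBn nQ.
by apply: nZy => _ [h Ph <-]; exact: (PQ h Ph).
Qed.

End Codimension.

(** * Preservers of invariants *)

Section PolynomialCurves.

Variable K : numClosedFieldType.

(* A fraction whose denominator has least degree cannot have a pole. *)
Lemma locally_fraction_poly (f : K -> K) :
  (forall s, exists q a : {poly K}, q.[s] != 0 /\ forall t, f t * q.[t] = a.[t]) ->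
  exists p : {poly K}, forall t, f t = p.[t].
Proof.
move=> hf.
pose S := [set qa : {poly K} * {poly K} | qa.1 != 0 /\ forall t, f t * qa.1.[t] = qa.2.[t]].
have [|[q a] [/= q0 qa] qmin] := @ex_min_nat _ (fun qa : {poly K} * {poly K} => size qa.1) S.
  have [q [a [h qa]]] := hf 0; exists (q, a); split => //=.
  by apply: contraNneq h => ->; rewrite horner0.
have [sq|sq] := leqP (size q) 1.
  exists ((q`_0)^-1 *: a) => t; rewrite hornerZ -qa (size1_polyC sq) coefC /= hornerC.
  by rewrite mulrC mulfK //; move: q0; rewrite {1}(size1_polyC sq) polyC_eq0.
have /closed_rootP[s /factor_theorem[q' eq]] : size q != 1%N by rewrite gtn_eqF.
have : root a s by rewrite rootE -qa eq hornerM hornerXsubC subrr !mulr0.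
move=> /factor_theorem[a' ea]; exfalso.
have q'0 : q' != 0 by apply: contraNneq q0 => q'0; rewrite eq q'0 mul0r.
suff hS : S (q', a').
  have := qmin _ hS; rewrite /= eq size_Mmonic ?monicXsubC // size_XsubC addn2 /=.
  by rewrite ltnn.
split => //= t; have [->|ts] := eqVneq t s; last first.
  apply: (mulIf (x := t - s)); first by rewrite subr_eq0.
  by have := qa t; rewrite eq ea !hornerM hornerXsubC mulrA.
have [q1 [a1 [h1 qa1]]] := hf s.
have e : a1 * q' = a' * q1.
  have nX : 'X - s%:P != 0 by rewrite polyXsubC_eq0.
  apply: (mulIf nX); rewrite -mulrA -eq mulrAC -ea.
  by apply: horner_eq_inj => z; rewrite !hornerM -qa -qa1; ring.
by apply: (mulIf h1); rewrite mulrAC qa1 -!hornerM e.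
Qed.

(** Multiplied by X^l, [p] becomes the reversal of [r], of degree at most l. *)
Lemma poly_inv_const (p r : {poly K}) : (forall s, s != 0 -> p.[s] = r.[s^-1]) -> (size p <= 1)%N.
Proof.
move=> h; set l := size r.
pose R : {poly K} := \sum_(i < l) r`_i *: 'X^(l - i).
have e : p * 'X^l = R.
  have nX : 'X != 0 :> {poly K} by rewrite polyX_eq0.
  apply: (mulIf nX); apply: horner_eq_inj => s; rewrite !hornerM hornerX hornerXn.
  have [->|s0] := eqVneq s 0; first by rewrite !mulr0.
  congr (_ * _); rewrite h // horner_coef mulr_suml horner_sum; apply: eq_bigr => i _.
  by rewrite hornerZ hornerXn -mulrA expfB ?exprVn 1?[_^-1 * _]mulrC.
have [->|p0] := eqVneq p 0; first by rewrite size_poly0.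
have : (size (p * 'X^l)%R <= l.+1)%N.
  rewrite e; apply: (leq_trans (size_sum _ _ _)); apply/bigmax_leqP => i _.
  by apply: (leq_trans (size_scale_leq _ _)); rewrite size_polyXn ltnS leq_subr.
by rewrite size_mulXn // -[X in (_ <= X)%N]addn1 leq_add2l.
Qed.

End PolynomialCurves.

Section InvariantPreserver.

Variables (K : numClosedFieldType) (n : nat) (G : set 'M[K]_n) (phi : 'M[K]_n).
Local Notation V := 'cV[K]_n.
Hypothesis hG : mxgroup G.
Hypothesis cG : mxclosed G.
Hypothesis nG : no_nil_ideal (dbl_group G).
Hypothesis hphi : forall p : V -> K, polyfun p -> (forall g z, G g -> p (g *m z) = p z) ->
  forall z, p (phi *m z) = p z.

Let U : set V := [set x | closed_orbit G x /\ free_point G x].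
Hypothesis codimU : codim_ge 2 (~` U).

Let UZ x (t : K) : t != 0 -> U x -> U (t *: x).
Proof.
move=> t0 [ox fx]; split; last first.
  move=> g Gg; rewrite -scalemxAr => /(scalerI t0); exact: fx.
move=> z hz; have [p pp hp|g Gg e] := ox (t^-1 *: z).
  apply: (hz (p \o (fun z => t^-1 *: z))).
    apply: polyfun_comp pp; apply: polymap_linear => a x1 x2.
    by rewrite scalerDr !scalerA mulrC.
  by move=> g Gg; rewrite /= -scalemxAr scalerA mulVf // scale1r hp.
by exists g => //; rewrite -scalemxAr -e scalerA mulfV // scale1r.
Qed.

Let gamma_exists x : U x -> exists2 g, G g & phi *m x = g *m x.
Proof.
move=> [ox fx]; apply: (same_invariants_orbit hG cG nG ox fx) => p pp hp.
by rewrite hphi.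
Qed.

Let gamma_uniq x g h : U x -> G g -> G h -> g *m x = h *m x -> g = h.
Proof.
have [G1 GM _] := hG; move=> [_ fx] Gg Gh e; have Gi := mxgroup_inv hG Gg.
have ug := mxgroup_unit hG Gg.
have := fx (invmx g *m h) (GM _ _ Gi Gh);
  rewrite -mulmxA -e mulmxA mulVmx // mul1mx => /(_ erefl) e1.
by rewrite -[LHS]mulmx1 -e1 mulmxA mulmxV // mul1mx.
Qed.

(** Near each parameter, the covariant of the corresponding point expresses g as F(phi z) F(z)^-1, a
    fraction with denominator det F(z); [locally_fraction_poly] glues these fractions. *)
Let gamma_line x v : (forall s, U (x + s *: v)) -> exists g : K -> 'M[K]_n,
  [/\ forall s, G (g s), forall s, phi *m (x + s *: v) = g s *m (x + s *: v)
    & forall i j, exists p : {poly K}, forall s, g s i j = p.[s]].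
Proof.
move=> hU.
have [g hg] := choice (fun s => let: ex_intro2 g Gg e :=
  gamma_exists (hU s) in ex_intro (fun g => G g /\ _) g (conj Gg e)).
exists g; split => [s|s|i j]; [exact: (hg s).1 | exact: (hg s).2 |].
apply: (locally_fraction_poly (f := fun s => g s i j)) => s.
have [F [pF Fs FG]] := covariant_exists hG cG nG (hU s).1 (hU s).2.
have [q hq] := polyfun_line x v (polyfun_det pF).
have [a ha] : exists a : {poly K}, forall t,
    (F (phi *m (x + t *: v)) *m \adj (F (x + t *: v))) i j = a.[t].
  apply: (polyfun_line (p := fun z => (F (phi *m z) *m \adj (F z)) i j)).
  apply: polyfun_entry; apply: polymap_mulmx; last exact: polymap_adj.
  apply: (polymap_comp (h := fun z => phi *m z)) pF; apply: polymap_linear => c y z.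
  by rewrite mulmxDr -scalemxAr.
exists q, a; rewrite -hq Fs det1; split; first exact: oner_neq0.
move=> t; rewrite -hq -ha (hg t).2 FG; last exact: (hg t).1.
by rewrite -mulmxA mul_mx_adj mul_mx_scalar mxE mulrC.
Qed.

Theorem invariant_preserver_mx : G phi.
Proof.
have [G1 _ _] := hG; have [n0|n0] := posnP n.
  suff -> : phi = 1%:M by [].
  by apply/matrixP => i; have := ltn_ord i; rewrite {2}n0.
have w0 : const_mx 1 != 0 :> V.
  by apply/eqP => /matrixP/(_ (Ordinal n0) 0)/eqP; rewrite !mxE oner_eq0.
have [u [b [nu nZu pb [v0 bv0] [bshift bZ]]]] := codim2_direction w0 codimU.
have inU x : ~ zclosure (~` U) x -> U x.
  by move=> nz; apply: contrapT => nU; apply: nz => Z _; apply.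
have Uu := inU u nZu.
have [g Gg eg] := gamma_exists Uu.
suff -> : phi = g by [].
have key v : b v != 0 -> phi *m v = g *m v.
  move=> bv.
  have U1 s : U (v + s *: u).
    by apply: inU => /bZ/eqP; rewrite bshift (negbTE bv).
  (* For s nonzero this is a multiple of a point v + s^-1 u, and [U] is a cone. *)
  have U2 s : U (u + s *: v).
    have [->|s0] := eqVneq s 0; first by rewrite scale0r addr0.
    rewrite (_ : _ + _ = s *: (v + s^-1 *: u)); first exact: UZ.
    by rewrite scalerDr scalerA mulfV // scale1r addrC.
  have [g1 [Gg1 e1 p1]] := gamma_line U1; have [g2 [Gg2 e2 p2]] := gamma_line U2.
  have g12 s : s != 0 -> g2 s = g1 s^-1.
    move=> s0; apply: (gamma_uniq (U2 s)) => //; rewrite -e2.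
    rewrite (_ : u + _ = s *: (v + s^-1 *: u)); last first.
      by rewrite scalerDr scalerA mulfV // scale1r addrC.
    by rewrite -!scalemxAr e1.
  have g2c s : g2 s = g.
    have -> : g = g2 0.
      by apply: (gamma_uniq Uu) => //; rewrite -eg; have := e2 0; rewrite scale0r addr0.
    apply/matrixP => i j; have [p hp] := p2 i j; have [r hr] := p1 i j.
    have sp : (size p <= 1)%N.
      by apply: (poly_inv_const (r := r)) => t t0; rewrite -hp -hr g12.
    by rewrite !hp (size1_polyC sp) !hornerC.
  have := e2 1; rewrite g2c scale1r !mulmxDr eg; exact: addrI.
(* [phi] and [g] agree where [b] is nonzero; a nonzero entry of the difference would be seen by a
   linear form at some such point. *)
apply/matrixP => i j; apply: contrapT => /eqP; rewrite -subr_eq0 => nz.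
pose l (z : V) := ((phi - g) *m z) i 0.
have ll : lform l by move=> a y z; rewrite /l mulmxDr -scalemxAr [LHS]mxE [X in X + _]mxE.
have lj : l (delta_mx j 0) != 0 by rewrite /l -colE mxE [X in X != 0]mxE [X in _ + X]mxE.
have [z] := polyfun_mul_neq0 pb (polyfun_lform ll) bv0 lj.
rewrite mulf_eq0 negb_or => /andP[/key e].
by rewrite /l mulmxBl e subrr mxE eqxx.
Qed.

End InvariantPreserver.

(** * Transfer of closedness and codimension along isomorphisms *)

Section Isomorphism.

Variables (K : numClosedFieldType) (W W' : vectType K) (h : W -> W') (h' : W' -> W).
Hypotheses (hh : polymap h) (hh' : polymap h') (hK : cancel h h') (hK' : cancel h' h).

Lemma zclosed_preimage (X X' : vectType K) (f : X -> X') (Z : set X') :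
  polymap f -> zclosed Z -> zclosed (f @^-1` Z).
Proof.
move=> pf [S pS ->]; exists [set p \o f | p in S].
  by move=> _ [p /pS pp <-]; exact: polyfun_comp.
apply/seteqP; split => x /= hx; first by move=> _ [p Sp <-]; exact: hx.
by move=> p Sp; apply: (hx (p \o f)); exists p.
Qed.

Lemma zirreducible_preimage (X X' : vectType K) (f : X -> X') (f' : X' -> X) (Z : set X') :
  polymap f' -> cancel f' f -> cancel f f' -> zirreducible Z -> zirreducible (f @^-1` Z).
Proof.
move=> pf' fK' fK [[z Zz] irr]; split; first by exists (f' z); rewrite /= fK'.
move=> Y Y' cY cY' hY.
have [||y Zy|H|H] := irr (f' @^-1` Y) (f' @^-1` Y').
- exact: zclosed_preimage.
- exact: zclosed_preimage.
- by apply: hY; rewrite /= fK'.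
- by left => x /H; rewrite /= fK.
- by right => x /H; rewrite /= fK.
Qed.

Lemma codim_ge_iso k (A : set W) (B : set W') : (forall y, B y -> A (h' y)) ->
  codim_ge k A -> codim_ge k B.
Proof.
move=> BA cA Z cZ iZ ZB.
have [|||c [c0 hc cs]] := cA (h @^-1` Z).
- exact: zclosed_preimage.
- exact: zirreducible_preimage hh' hK' hK iZ.
- move=> x Zx Y cY AY; rewrite -[x]hK; apply: (ZB (h x) Zx (h' @^-1` Y)).
    exact: zclosed_preimage.
  by move=> y /BA/AY.
exists (fun i => h' @^-1` c i); split.
- by rewrite c0; apply/seteqP; split => y /=; rewrite hK'.
- move=> i /hc[ci ii]; split; first exact: zclosed_preimage.
  exact: zirreducible_preimage hh hK hK' ii.
- move=> i /cs[ci nci]; split => [y /ci //|H]; apply: nci => x cx.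
  by rewrite -[x]hK; apply: H; rewrite /= hK.
Qed.

End Isomorphism.

(** * Matrix coordinates for endomorphisms *)

Section Coordinates.

Variables (K : numClosedFieldType) (V : vectType K).
Local Notation n := (\dim {:V}).
Local Notation e := (vbasis {:V}).

Definition tocol (x : V) : 'cV[K]_n := \col_i coord e i x.
Definition ofcol (c : 'cV[K]_n) : V := \sum_i c i 0 *: e`_i.

Lemma tocol_linear : linear tocol.
Proof. by move=> a x y; apply/colP => i; rewrite !mxE linearP. Qed.

Lemma ofcol_linear : linear ofcol.
Proof.
move=> a x y; rewrite /ofcol scaler_sumr -big_split; apply: eq_bigr => i _.
by rewrite !mxE scalerDl scalerA.
Qed.

Lemma tocolK : cancel tocol ofcol.
Proof. by move=> x; rewrite [RHS](coord_vbasis (memvf x)); apply: eq_bigr => i _; rewrite mxE. Qed.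

Lemma ofcolK : cancel ofcol tocol.
Proof. by move=> c; apply/colP => i; rewrite mxE coord_sum_free // (basis_free (vbasisP _)). Qed.

Definition tomx (f : 'End(V)) : 'M[K]_n := \matrix_(i, j) coord e i (f e`_j).

Definition mxact (A : 'M[K]_n) (x : V) : V := ofcol (A *m tocol x).

Lemma mxact_linear A : linear (mxact A).
Proof. by move=> a x y; rewrite /mxact tocol_linear mulmxDr -scalemxAr ofcol_linear. Qed.

HB.instance Definition _ A := GRing.isLinear.Build K V V *:%R (mxact A) (mxact_linear A).

Definition ofmx A : 'End(V) := linfun (mxact A).

Lemma tomxE (f : 'End(V)) x : tocol (f x) = tomx f *m tocol x.
Proof.
apply/colP => i; rewrite !mxE {1}(coord_vbasis (memvf x)) !linear_sum.
by apply: eq_bigr => j _; rewrite !linearZ /= !mxE mulrC.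
Qed.

Lemma ofmxE A x : tocol (ofmx A x) = A *m tocol x.
Proof. by rewrite lfunE /= ofcolK. Qed.

Lemma mulcol_inj (A B : 'M[K]_n) : (forall x, A *m tocol x = B *m tocol x) -> A = B.
Proof.
move=> h; apply/matrixP => i j.
have := h (ofcol (delta_mx j 0)); rewrite ofcolK -!colE.
by move=> /colP/(_ i); rewrite !mxE.
Qed.

Lemma ofmxK : cancel ofmx tomx.
Proof. by move=> A; apply: mulcol_inj => x; rewrite -tomxE ofmxE. Qed.

Lemma tomxK : cancel tomx ofmx.
Proof. by move=> f; apply/lfunP => x; apply: (can_inj tocolK); rewrite ofmxE tomxE. Qed.

Lemma tomx1 : tomx \1%VF = 1%:M.
Proof. by apply: mulcol_inj => x; rewrite -tomxE lfunE mul1mx. Qed.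

Lemma tomxM (f g : 'End(V)) : tomx (f \o g)%VF = tomx f *m tomx g.
Proof. by apply: mulcol_inj => x; rewrite -tomxE comp_lfunE -mulmxA -!tomxE. Qed.

Lemma tomx_linear : linear tomx.
Proof. by move=> a f g; apply/matrixP => i j; rewrite !mxE add_lfunE scale_lfunE linearP. Qed.

Lemma ofmx_linear : linear ofmx.
Proof. by move=> a A B; apply: (can_inj tomxK); rewrite tomx_linear !ofmxK. Qed.

Lemma GL_tomx (f : 'End(V)) : GL f -> tomx f \in unitmx.
Proof.
move=> /eqP lf; have : tomx f *m tomx f^-1%VF = 1%:M by rewrite -tomxM lker0_compfV ?lf // tomx1.
by case/mulmx1_unit.
Qed.

Lemma GL_ofmx A : A \in unitmx -> GL (ofmx A).
Proof.
move=> uA; apply/lker0P => x y /(congr1 tocol); rewrite !ofmxE.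
by move/(can_inj (mulKmx uA))/(can_inj tocolK).
Qed.

Variable G : set 'End(V).
Definition mxset : set 'M[K]_n := [set A | G (ofmx A)].

Hypothesis rG : reductive G.

Let sG : subgroupGL G := (rG.1).1.

Lemma mxset_mxgroup : mxgroup mxset.
Proof.
have [GGL G1 GM GV] := sG; split.
- by rewrite /mxset /= -tomx1 tomxK.
- by move=> A B GA GB; rewrite /mxset /= -[A]ofmxK -[B]ofmxK -tomxM tomxK; exact: GM.
move=> A GA; exists (tomx (ofmx A)^-1%VF).
have /eqP lA := GGL _ GA.
split; first by rewrite /mxset /= tomxK; exact: GV.
  by rewrite -{1}[A]ofmxK -tomxM lker0_compfV ?lA // tomx1.
by rewrite -{2}[A]ofmxK -tomxM lker0_compVf ?lA // tomx1.
Qed.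

Lemma mxset_mxclosed : mxclosed mxset.
Proof.
have [[_ [Z [S pS eZ] eG]] _] := rG.
move=> A uA hA; rewrite /mxset /= eG; split; first exact: GL_ofmx.
rewrite eZ => p Sp; apply: (hA (p \o ofmx)); split.
  exact: polyfun_comp (polymap_linear ofmx_linear) (pS p Sp).
by move=> B; rewrite /mxset /= eG => -[_]; rewrite eZ; apply.
Qed.

Lemma mxset_no_nil_ideal : no_nil_ideal (dbl_group mxset).
Proof.
apply: reductive_no_nil_ideal; [exact: mxset_mxgroup | exact: mxset_mxclosed |].
move=> N NG hN cN zN nN uN u Nu; have [N1 NM NV] := hN.
have [[GGL _ _ GV] [_ HG]] := (sG, rG).
pose M : set 'End(V) := [set f | N (tomx f)].
have MG f : M f -> G f by move=> /NG; rewrite /mxset /= tomxK.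
suff eM : M = [set \1%VF].
  have : M (ofmx u) by rewrite /M /= ofmxK.
  by rewrite eM /= => e; rewrite -[u]ofmxK e tomx1.
apply: HG.
- split.
    split; first by move=> f /MG/GGL.
    + by rewrite /M /= tomx1.
    + by move=> f g Mf Mg; rewrite /M /= tomxM; exact: NM.
    + move=> f Mf; have /eqP lf := GGL _ (MG _ Mf).
      rewrite /M /= -(@invmx_eq K n (tomx f) (tomx f^-1%VF)); first exact: mxgroup_inv.
      by rewrite -tomxM lker0_compfV ?lf // tomx1.
  exists [set f | forall p, [set q \o tomx | q in vanishing N] p -> p f = 0].
    apply: zclosed_zeros => _ [q [pq _] <-].
    exact: polyfun_comp (polymap_linear tomx_linear) pq.
  apply/seteqP; split => [f Mf|f [Gf hf]].
    split; first exact/GGL/MG.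
    by move=> _ [q [_ hq] <-]; exact: hq.
  apply: cN; first exact: GL_tomx.
  by move=> q hq; apply: (hf (q \o tomx)); exists q.
- move=> Y Z cY cZ MYZ M0.
  have [||x Nx|||] := zN (ofmx @^-1` Y) (ofmx @^-1` Z).
  + exact: zclosed_preimage (polymap_linear ofmx_linear) cY.
  + exact: zclosed_preimage (polymap_linear ofmx_linear) cZ.
  + by apply: MYZ; rewrite /M /= ofmxK.
  + apply/seteqP; split => // x [[Nx Yx] Zx].
    have : set0 (ofmx x) by rewrite -M0; split => //; split => //; rewrite /M /= ofmxK.
    by [].
  + by move=> H; left => f /H; rewrite /= tomxK.
  + by move=> H; right => f /H; rewrite /= tomxK.
- split; first exact: MG.
  move=> g f Gg Mf; have /eqP lg := GGL _ Gg; rewrite /M /= !tomxM; apply: nN => //.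
  + by rewrite /mxset /= tomxK.
  + by rewrite -tomxM lker0_compfV ?lg // tomx1.
  + by rewrite -tomxM lker0_compVf ?lg // tomx1.
- move=> f Mf; have [L hL] := mxnil_pow (uN _ Mf); exists L => x.
  apply: (can_inj tocolK).
  have -> : tocol 0 = mxpow L (tomx f - 1%:M) *m tocol x.
    by rewrite hL mul0mx; apply/colP => i; rewrite !mxE linear0.
  elim: L {hL} => [|L IH]; first by rewrite /mxpow /= mul1mx.
  rewrite iterS tomxE IH /mxpow iterS -mulmxA; congr (_ *m _).
  apply/matrixP => i j; rewrite -tomx1 !mxE.
  by rewrite add_lfunE opp_lfunE linearB.
Qed.

Lemma mxset_points x : closed_free_points G x ->
  closed_orbit mxset (tocol x) /\ free_point mxset (tocol x).
Proof.
move=> [[S pS eO] eS]; split.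
  move=> z hz.
  suff : Defs.orbit G x (ofcol z).
    by move=> [g Gg e]; exists (tomx g); [rewrite /mxset /= tomxK | rewrite -tomxE e ofcolK].
  rewrite eO => p Sp; apply: (hz (p \o ofcol)).
    exact: polyfun_comp (polymap_linear ofcol_linear) (pS p Sp).
  move=> A GA; rewrite /= -ofmxE tocolK.
  have : Defs.orbit G x (ofmx A x) by exists (ofmx A).
  by rewrite eO; apply.
move=> A GA e; have : stabilizer G x (ofmx A).
  by split => //; apply: (can_inj tocolK); rewrite ofmxE.
by rewrite eS /= => eA; rewrite -[A]ofmxK eA tomx1.
Qed.

End Coordinates.

Theorem theorem3p1 (R : realType) (V : vectType R[i]) (G : set 'End(V)) :
  reductive G ->
  codim_ge 2 (~` closed_free_points G) ->
  invariant_preserver G = G.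
Proof.
move=> rG cG; have [[[GGL G1 GM GV] _] _] := rG.
apply/seteqP; split => [phi [_ hphi]|g Gg]; last first.
  by split; [exact: GGL | move=> p [_ hp] x; exact: hp].
rewrite -[phi]tomxK.
apply: (@invariant_preserver_mx R[i] _ (mxset G) (tomx phi)).
- exact: mxset_mxgroup.
- exact: mxset_mxclosed.
- exact: mxset_no_nil_ideal.
- move=> p pp hp z; rewrite -[z]ofcolK -tomxE.
  apply: (hphi (p \o @tocol R[i] V)); split.
    exact: polyfun_comp (polymap_linear (@tocol_linear _ _)) pp.
  move=> g Gg x; rewrite /= tomxE; apply: hp.
  by rewrite /mxset /= tomxK.
apply: (codim_ge_iso (polymap_linear (@tocol_linear _ V)) (polymap_linear (@ofcol_linear _ V))
  (@tocolK _ V) (@ofcolK _ V) _ cG) => y ny.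
by move=> hy; apply: ny; rewrite -[y]ofcolK; exact: mxset_points.
Qed.
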